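(* Let $q$ be a prime power, let $m\ge 1$ and $n\ge 1$ be integers, and let $R'_{2,2m}=\mathbb{F}_q[[T]]+T^m\mathbb{F}_{q^2}[[T]]\subseteq \mathbb{F}_{q^2}[[T]]$. Write $t:=q^{-s}$. Then the finitized rank-$n$ Coh zeta function of $R'_{2,2m}$ is given by $$\widehat{\zeta}_{R'_{2,2m},n}(s)=\frac{1}{(tq^{-1};q^{-1})_n}\,\mathbf{Br}_n^{(2m+2)}(t,q^{-1}).$$
   Context: Pochhammer symbols: $(A;x)_N:=\prod_{j=0}^{N-1}(1-Ax^j)$ for integers $N\ge 0$. For a commutative ring $R$ and an $R$-module $M$, the Quot zeta function is the formal Dirichlet series $\zeta_M^R(s):=\sum_{L\subseteq_R M}|M/L|^{-s}$, the sum being over all finite-index $R$-submodules $L$ of $M$. The finitized rank-$n$ Coh zeta function of $R$ is $\widehat{\zeta}_{R,n}(s):=\zeta^R_{R^n}(s+n)$. For $R=R'_{2,2m}$ all indices $|M/L|$ are powers of $q$, so these are formal power series in $t=q^{-s}$, and replacing $s$ by $s+n$ means replacing $t$ by $tq^{-n}$. The $t$-deformed finite Bressoud sum is $$\mathbf{Br}_n^{(2m+2)}(t,x):=(x;x)_n\sum_{n_1,\ldots,n_m\ge 0}\frac{t^{\sum_{i=1}^m 2n_i}\,x^{\sum_{i=1}^m n_i^2}}{(x;x)_{n-n_m}(x;x)_{n_m-n_{m-1}}\cdots(x;x)_{n_2-n_1}(x;x)_{n_1}(-tx;x)_{n_1}},$$ where $1/(x;x)_k:=0$ for $k<0$, so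 that only terms with $0\le n_1\le n_2\le\cdots\le n_m\le n$ contribute. *)

(* Defs.v *)
From HB Require Import structures.
From mathcomp Require Import all_boot all_order all_algebra finmap.
From mathcomp Require Import ring.
From mathcomp Require Import mathcomp_extra boolp classical_sets functions.
From mathcomp Require Import cardinality.

Set Implicit Arguments.
Unset Strict Implicit.
Unset Printing Implicit Defensive.

Import Order.TTheory GRing.Theory Num.Theory.
Local Open Scope classical_set_scope.
Local Open Scope card_scope.
Local Open Scope ring_scope.

(* Formal power series: MathComp has no such type.  The function space       *)
(* [nat -> R] is wrapped in a record because it already carries the          *)
(* pointwise ring structure.                                                 *)

Record fps (R : Type) := Fps { fcoef : nat -> R }.

HB.instance Definition _ (R : Type) := [isNew for @fcoef R].
HB.instance Definition _ (R : choiceType) := [Choice of fps R by <:].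

Lemma fpsP (R : Type) (f g : fps R) : fcoef f =1 fcoef g -> f = g.
Proof. by case: f g => f [g] /= /funext ->. Qed.

Section FpsZmod.
Variable R : zmodType.
Implicit Types f g : fps R.

Definition fps_zero := Fps (fun _ => 0 : R).
Definition fps_opp f := Fps (fun k => - fcoef f k).
Definition fps_add f g := Fps (fun k => fcoef f k + fcoef g k).

Fact fps_addA : associative fps_add.
Proof. by move=> f g h; apply: fpsP => k /=; rewrite addrA. Qed.
Fact fps_addC : commutative fps_add.
Proof. by move=> f g; apply: fpsP => k /=; rewrite addrC. Qed.
Fact fps_add0 : left_id fps_zero fps_add.
Proof. by move=> f; apply: fpsP => k /=; rewrite add0r. Qed.
Fact fps_addN : left_inverse fps_zero fps_opp fps_add.
Proof. by move=> f; apply: fpsP => k /=; rewrite addNr. Qed.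

HB.instance Definition _ :=
  GRing.isZmodule.Build (fps R) fps_addA fps_addC fps_add0 fps_addN.

Lemma fcoef0 k : fcoef (0 : fps R) k = 0. Proof. by []. Qed.
Lemma fcoefD f g k : fcoef (f + g) k = fcoef f k + fcoef g k.
Proof. by []. Qed.
Lemma fcoefN f k : fcoef (- f) k = - fcoef f k. Proof. by []. Qed.
Lemma fcoefB f g k : fcoef (f - g) k = fcoef f k - fcoef g k.
Proof. by []. Qed.
Lemma fcoef_sum I (r : seq I) (P : pred I) (F : I -> fps R) k :
  fcoef (\sum_(i <- r | P i) F i) k = \sum_(i <- r | P i) fcoef (F i) k.
Proof. exact: (big_morph (fun f => fcoef f k)). Qed.

End FpsZmod.

Section FpsRing.
Variable R : comNzRingType.
Implicit Types f g h : fps R.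

Definition fpsC (c : R) := Fps (fun k => if k == 0%N then c else 0).
Definition fps_mul f g :=
  Fps (fun k => \sum_(i < k.+1) fcoef f i * fcoef g (k - i)%N).

Definition fps_trunc n f : {poly R} := \poly_(i < n) fcoef f i.

Lemma fps_mul_trunc n f g k : (k < n)%N ->
  fcoef (fps_mul f g) k = (fps_trunc n f * fps_trunc n g)`_k.
Proof.
move=> ltkn; rewrite coefM; apply: eq_bigr => i _; rewrite !coef_poly.
by rewrite (leq_ltn_trans _ ltkn) ?leq_ord // (leq_ltn_trans _ ltkn) ?leq_subr.
Qed.

Fact fps_mulC : commutative fps_mul.
Proof.
by move=> f g; apply: fpsP => k; rewrite !(@fps_mul_trunc k.+1) // mulrC.
Qed.

Fact fps_mulA : associative fps_mul.
Proof.
move=> f g h; apply: fpsP => k.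
transitivity ((fps_trunc k.+1 f * fps_trunc k.+1 g * fps_trunc k.+1 h)`_k).
  rewrite -mulrA coefM; apply: eq_bigr => i _.
  rewrite coef_poly ltn_ord; congr (_ * _).
  by apply: fps_mul_trunc; rewrite ltnS leq_subr.
rewrite coefM; apply: eq_bigr => i _; rewrite -fps_mul_trunc ?ltn_ord //.
by rewrite coef_poly ltnS leq_subr.
Qed.

Fact fps_mul1 : left_id (fpsC 1) fps_mul.
Proof.
move=> f; apply: fpsP => k /=; rewrite big_ord_recl /= mul1r subn0 big1 ?addr0 //.
by move=> i _; rewrite mul0r.
Qed.

Fact fps_mulDl : left_distributive fps_mul (@fps_add R).
Proof.
move=> f g h; apply: fpsP => k /=; rewrite -big_split; apply: eq_bigr => i _.
exact: mulrDl.
Qed.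

Fact fps_1neq0 : fpsC 1 != 0.
Proof.
apply/eqP => /(congr1 (fun f => fcoef f 0)) /= /eqP.
by rewrite (negPf (oner_neq0 R)).
Qed.

HB.instance Definition _ := GRing.Zmodule_isComNzRing.Build (fps R)
  fps_mulA fps_mulC fps_mul1 fps_mulDl fps_1neq0.

Lemma fcoef1 k : fcoef (1 : fps R) k = (k == 0%N)%:R.
Proof. by rewrite /=; case: eqP. Qed.
Lemma fcoefM f g k :
  fcoef (f * g) k = \sum_(i < k.+1) fcoef f i * fcoef g (k - i)%N.
Proof. by []. Qed.
Lemma fcoefM0 f g : fcoef (f * g) 0 = fcoef f 0 * fcoef g 0.
Proof. by rewrite fcoefM big_ord1. Qed.

Definition fpsX : fps R := Fps (fun k => (k == 1%N)%:R).

End FpsRing.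
Arguments fpsX {R}.

Section FpsUnit.
Variable R : comUnitRingType.
Implicit Types f g h : fps R.

Definition fps_unit : pred (fps R) := [pred f | fcoef f 0 \is a GRing.unit].

(* With c = f_0^-1 and g = 1 - c f, the series g has no constant term and    *)
(* f^-1 = c (1 + g + g^2 + ...); g^j does not contribute to T^k for j > k.   *)
Definition fps_inv f : fps R :=
  if f \in fps_unit then
    let c := fpsC (fcoef f 0)^-1 in
    c * Fps (fun k => fcoef (\sum_(j < k.+1) (1 - c * f) ^+ j) k)
  else f.

Lemma fcoef_expr_lt g n k : fcoef g 0 = 0 -> (k < n)%N -> fcoef (g ^+ n) k = 0.
Proof.
move=> g0; elim: n k => // n IHn k ltkn; rewrite exprS fcoefM.
rewrite big1 // => -[[|i] ltik] _ /=; first by rewrite g0 mul0r.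
by rewrite IHn ?mulr0 // ltn_subLR // (leq_trans ltkn) // addSn ltnS leq_addl.
Qed.

Fact fps_mulVf : {in fps_unit, left_inverse 1 fps_inv *%R}.
Proof.
move=> f Uf; rewrite /fps_inv Uf; set c := fpsC _.
set g := 1 - c * f; set S := Fps _.
have g0 : fcoef g 0 = 0.
  by rewrite fcoefB fcoef1 fcoefM0 /= mulVr ?subrr.
have cfE : c * f = 1 - g by rewrite /g opprB addrC subrK.
rewrite mulrAC cfE; apply: fpsP => k.
have -> : fcoef ((1 - g) * S) k = fcoef ((1 - g) * \sum_(j < k.+1) g ^+ j) k.
  rewrite !fcoefM; apply: eq_bigr => i _; congr (_ * _).
  rewrite /= !fcoef_sum -!(big_mkord xpredT (fun j => fcoef (g ^+ j) (k - i)%N)).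
  rewrite [RHS](@big_cat_nat _ _ _ (k - i).+1) //= ?ltnS ?leq_subr //.
  rewrite [X in _ + X]big_nat_cond [X in _ + X]big1 ?addr0 //.
  move=> j /andP[/andP[ltj _] _].
  exact: fcoef_expr_lt.
by rewrite -opprB mulNr -subrX1 opprB fcoefB (fcoef_expr_lt g0) ?subr0.
Qed.

Fact fps_unitPl f g : g * f = 1 -> fps_unit f.
Proof.
move=> /(congr1 (fun h => fcoef h 0)); rewrite fcoefM0 fcoef1 => gf1.
by apply/unitrPr; exists (fcoef g 0); rewrite mulrC.
Qed.

Fact fps_inv_out : {in [predC fps_unit], fps_inv =1 id}.
Proof. by move=> f; rewrite inE /= /fps_inv => /negPf; rewrite -topredE => ->. Qed.

HB.instance Definition _ := GRing.ComNzRing_hasMulInverse.Build (fps R)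
  fps_mulVf fps_unitPl fps_inv_out.

End FpsUnit.

Section MapFps.
Variables (R S : comNzRingType) (iota : {rmorphism R -> S}).

Definition map_fps (f : fps R) : fps S := Fps (iota \o fcoef f).

Fact map_fps_zmod_morphism : zmod_morphism map_fps.
Proof. by move=> f g; apply: fpsP => k; exact: rmorphB. Qed.

Fact map_fps_monoid_morphism : monoid_morphism map_fps.
Proof.
split=> [|f g]; apply: fpsP => k /=; first by case: eqP; rewrite ?rmorph1 ?rmorph0.
by rewrite rmorph_sum; apply: eq_bigr => i _; rewrite rmorphM.
Qed.

HB.instance Definition _ :=
  GRing.isZmodMorphism.Build (fps R) (fps S) map_fps map_fps_zmod_morphism.
HB.instance Definition _ :=
  GRing.isMonoidMorphism.Build (fps R) (fps S) map_fps map_fps_monoid_morphism.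

End MapFps.

(* The subring k[[T]] + T^m K[[T]] of K[[T]], for k embedded in K by iota.   *)

Section Order.
Variables (k K : fieldType) (iota : {rmorphism k -> K}) (m : nat).

Definition fps_order : {pred fps K} := fun f =>
  `[< exists (g : fps k) (h : fps K), f = map_fps iota g + fpsX ^+ m * h >].

Fact fps_order_subring : subring_closed fps_order.
Proof.
split.
- by apply/asboolP; exists 1, 0; rewrite rmorph1 mulr0 addr0.
- move=> _ _ /asboolP[g [h ->]] /asboolP[g' [h' ->]]; apply/asboolP.
  by exists (g - g'), (h - h'); rewrite rmorphB; ring.
move=> _ _ /asboolP[g [h ->]] /asboolP[g' [h' ->]]; apply/asboolP.
exists (g * g').
exists (map_fps iota g * h' + h * (map_fps iota g' + fpsX ^+ m * h')).
by rewrite rmorphM; ring.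
Qed.

HB.instance Definition _ := GRing.isSubringClosed.Build (fps K) fps_order
  fps_order_subring.

Record Rprime := Rprime_of { Rprime_val : fps K; _ : Rprime_val \in fps_order }.

HB.instance Definition _ := [isSub for Rprime_val].
HB.instance Definition _ := [Choice of Rprime by <:].
HB.instance Definition _ := [SubChoice_isSubComNzRing of Rprime by <:].

End Order.

(* A formal Dirichlet series sum_N a_N N^(-s) is its coefficient function a; *)
(* the value a 0 is always 0 below.                                          *)
Definition dirichlet := nat -> rat.

Section QuotZeta.
Variables (R : comPzRingType) (M : lmodType R).

Definition cosets (L : set M) : set (set M) :=
  [set C | exists x : M, C = [set x + y | y in L]].

Definition submodules_of_index (N : nat) : set (set M) :=
  [set L : set M | submod_closed (mem L) /\ cosets L #= `I_N].

Definition quot_zeta : dirichlet :=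
  fun N => #|` fset_set (submodules_of_index N)|%:R.

End QuotZeta.
Arguments submodules_of_index {R} M N.
Arguments quot_zeta {R} M N.

(* The substitution s |-> s + n.                                             *)
Definition dirichlet_shift (n : nat) (a : dirichlet) : dirichlet :=
  fun N => a N / N%:R ^+ n.

Definition coh_zeta (R : comPzRingType) (n : nat) : dirichlet :=
  dirichlet_shift n (quot_zeta 'rV[R]_n).

(* The substitution t := q^(-s), for q > 1.                                  *)
Definition dirichlet_of_fps (q : nat) (f : fps rat) : dirichlet :=
  fun N => \sum_(k < N.+1 | (q ^ k == N)%N) fcoef f k.

Definition poch (A : comNzRingType) (a x : A) (N : nat) : A :=
  \prod_(j < N) (1 - a * x ^+ j).

Section Bressoud.
Variable A : comUnitRingType.
Implicit Types t x : A.

(* 1 / (x;x)_k, which is 0 for k < 0.                                        *)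
Definition inv_poch x (k : int) : A :=
  if k is Posz j then (poch x x j)^-1 else 0.

(* Br_n^(2m+2)(t, x); for t = fpsX and x = q^-1 the Pochhammer symbols below *)
(* have a nonzero constant term, so they are units of Q[[t]].                *)
(* The entries of nu are n_1, ..., n_m; a summand with some n_i > n would    *)
(* vanish. With the conventions n_0 = 0 and n_(m+1) = n, c i is n_i for all  *)
(* i <= m + 1.                                                               *)
Definition bressoud (m n : nat) t x : A :=
  poch x x n *
  \sum_(nu : m.-tuple 'I_n.+1)
    let c i := nth n (0%N :: map val nu) i in
    t ^+ (\sum_(1 <= i < m.+1) 2 * c i) * x ^+ (\sum_(1 <= i < m.+1) c i ^ 2)
    * (\prod_(0 <= i < m.+1) inv_poch x ((c i.+1)%:Z - (c i)%:Z))
    / poch (- t * x) x (c 1%N).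

End Bressoud.

(* Main.v *)
Require Import Defs.
From HB Require Import structures.
From mathcomp Require Import all_boot all_order all_algebra finmap.
From mathcomp Require Import zify ring.
From mathcomp Require Import mathcomp_extra boolp classical_sets functions.
From mathcomp Require Import cardinality.

(** Let k and K be the two fields, q = |k|, x = 1/q, K = k[w], and let
    R_m = k[[T]] + T^m K[[T]]; so R_0 = K[[T]], and 1 and theta_m = T^m w
    generate R_m over R_(m+1). The submodules of finite index in R_m^n are
    its R_m-lattices. They are counted by their codimension d over k, and
    the theorem computes the series Z_m(n) of these numbers, where t^d has
    the weight x^(n d).

    The proof is an induction on m along the orders R_m. The maximal ideal
    of R_(m+1) is T R_m. An R_(m+1)-lattice W generates the R_m-lattice
    H = W + theta_m W, its hull, and W lies between T H and H. Conversely,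
    every k-subspace between T H and H that generates H over R_m is such a
    lattice. For m = 0 these are the k-subspaces of H / T H = K^r that span
    over K (count_spanningS). For m > 0, by Nakayama's lemma, they are the
    supplements of the image of P H in H / T H, where P is the maximal ideal
    of R_m (count_supplements). Their number depends on the codimension of H
    in the R_(m-1)-lattice that it generates, the defect of H, which is
    therefore a second parameter of all counts (count_hulls). In this way
    the R_(m+1)-lattices in R_m^n, or equivalently in T R_m^n, are counted.
    To pass to R_(m+1)^n, the coordinates are treated one by one. A lattice
    either has only nonunits at a coordinate, or contains a vector e + v
    with the coordinate 1 there. In the second case it is R_(m+1) (e + v)
    plus a lattice that does not involve this coordinate (count_lat_split).
    Together, the two steps determine all numbers of lattices
    (count_lattices).

    On generating series, the defects b are recorded by a polynomial in a
    variable z, written in the basis (z t; q)_(n-b). The splitting of the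
    coordinates then becomes a recursion that can be solved in closed form
    (split_recursion), and the passage to the hulls becomes an explicit
    linear map (transfer). Put u_m(n) = (t x; x)_n Z_m(n). By induction on
    m, the series of the R_(m+1)-lattices in R_m^j is equal to

      1 / (t x; x)_j  sum_k [j, k] t^k (z; q)_k u_m(k),

    where [j, k] is the Gaussian binomial at q (transfer_identityS). At
    z = 0, where the defects are forgotten, this leads to

      u_(m+1)(n) = sum_k [n, k] x^(n k) t^(2 k) u_m(k)

    (u_seriesS), and u_0(n) = 1 / (- t x; x)_n is the classical case of
    K[[T]]. As [n, k] x^(n k) = x^(k^2) (x; x)_n / ((x; x)_k (x; x)_(n-k)),
    the m-fold iteration of this recursion is the Bressoud sum
    (lattice_series_bressoud). *)

Set Implicit Arguments.
Unset Strict Implicit.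
Unset Printing Implicit Defensive.

Import Order.TTheory GRing.Theory Num.Theory.
Local Open Scope classical_set_scope.
Local Open Scope ring_scope.

(** * Cardinalities of subsets *)

Section HasCard.
Variable X : choiceType.
Implicit Types (P Q : set X) (n : nat).

(** Finiteness and cardinality are bundled in one relation, so that counts can
    be added, multiplied and transported without separate finiteness
    arguments. *)
Definition has_card P n :=
  exists s : seq X, [/\ uniq s, size s = n & forall x, (x \in s) <-> P x].

Lemma has_card_inj P n n' : has_card P n -> has_card P n' -> n = n'.
Proof.
move=> [s [us <- sP]] [s' [us' <- s'P]]; apply/perm_size/uniq_perm => // x.
by apply/idP/idP => [/sP/s'P|/s'P/sP].
Qed.

Lemma has_card_ext P Q n : (forall x, P x <-> Q x) -> has_card P n -> has_card Q n.
Proof.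
by move=> PQ [s [us ss sP]]; exists s; split=> // x; rewrite sP.
Qed.

Lemma has_card0 P : (forall x, ~ P x) -> has_card P 0.
Proof. by move=> P0; exists [::]; split=> // x; split=> // /P0. Qed.

Lemma has_card1 P x : P x -> (forall y, P y -> y = x) -> has_card P 1.
Proof.
move=> Px Py; exists [:: x]; split=> // y; rewrite inE.
by split=> [/eqP->|/Py->].
Qed.

Lemma has_cardU P Q n n' : has_card P n -> has_card Q n' ->
  (forall x, P x -> Q x -> False) -> has_card [set x | P x \/ Q x] (n + n')%N.
Proof.
move=> [s [us <- sP]] [s' [us' <- s'P]] PQ; exists (s ++ s').
rewrite size_cat cat_uniq us us'; split=> // [|x].
  rewrite /= andbT; apply/hasPn => x /s'P Qx; apply/negP => /sP Px.
  exact: PQ Px Qx.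
rewrite mem_cat; split=> [/orP[/sP|/s'P]|/= [/sP|/s'P] ->]; rewrite ?orbT //.
  by left.
by right.
Qed.

Lemma has_cardD P Q n n' : has_card P n -> has_card Q n' ->
  (forall x, Q x -> P x) -> has_card [set x | P x /\ ~ Q x] (n - n')%N.
Proof.
move=> [s [us <- sP]] [s' [us' <- s'P]] QP; exists [seq x <- s | x \notin s'].
split; first exact: filter_uniq.
  rewrite size_filter -[size s](count_predC [in s']).
  suff -> : count [in s'] s = size s' by rewrite addKn.
  rewrite -size_filter; apply/perm_size/uniq_perm => //; first exact: filter_uniq.
  move=> x; rewrite mem_filter; apply/andP/idP => [[]//|s'x]; split=> //.
  by apply/sP/QP/s'P.
move=> x; rewrite mem_filter; split=> [/andP[/negP ns' /sP]|[/sP-> ns']].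
  by split=> // /s'P.
by rewrite andbT; apply/negP => /s'P.
Qed.

Lemma has_card_sum (P : nat -> set X) (c : nat -> nat) N :
  (forall i, (i < N)%N -> has_card (P i) (c i)) ->
  (forall i j x, (i < N)%N -> (j < N)%N -> P i x -> P j x -> i = j) ->
  has_card [set x | exists2 i, (i < N)%N & P i x] (\sum_(i < N) c i).
Proof.
elim: N => [|N IH] cP PP; first by rewrite big_ord0; apply: has_card0 => x [].
have {}IH : has_card [set x | exists2 i, (i < N)%N & P i x] (\sum_(i < N) c i).
  apply: IH => [i lti|i j x lti ltj]; first by apply: cP; apply: ltnW.
  by apply: PP; apply: ltnW.
rewrite big_ord_recr /=.
apply: has_card_ext (has_cardU IH (cP N (leqnn _)) _) => x /=.
  split=> [[[i lti Pi]|PN]|[i]]; first by exists i => //; apply: ltnW.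
    by exists N.
  rewrite ltnS leq_eqVlt => /orP[/eqP->|lti] Pi; first by right.
  by left; exists i.
move=> [i lti Pi] PN; have := PP i N x (ltnW lti) (leqnn _) Pi PN.
by move=> eiN; rewrite eiN ltnn in lti.
Qed.

End HasCard.

Lemma has_card_fib (X Y : choiceType) (P : set X) (Q : set Y) (f : X -> Y) n k :
  has_card Q n -> (forall x, P x -> Q (f x)) ->
  (forall y, Q y -> has_card [set x | P x /\ f x = y] k) -> has_card P (n * k)%N.
Proof.
move=> [s [us <- sQ]]; elim: s P Q us sQ => [|y s IH] P Q us sQ PQ fib.
  by apply: has_card0 => x /PQ /sQ.
move: us => /= /andP[nys us].
have sy : y \in y :: s by rewrite mem_head.
rewrite mulSn.
have c1 := fib y (iffLR (sQ y) sy).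
have c2 : has_card [set x | P x /\ f x != y] (size s * k)%N.
  apply: (IH _ [set z | z \in s]) => // [x /= [Px fxy]|z /= zs].
    by have := iffRL (sQ _) (PQ _ Px); rewrite in_cons (negPf fxy).
  apply: has_card_ext (fib z _); last by apply/sQ; rewrite inE zs orbT.
  move=> x /=; split=> [[Px fz]|[[]]] //; split=> //; split=> //.
  by apply/eqP => fxy; case/negP: nys; rewrite -fxy fz.
apply: has_card_ext (has_cardU c1 c2 _) => x /=; last first.
  by move=> [_ ->] [_]; rewrite eqxx.
split=> [[[]|[]]//|Px]; have [fxy|nfxy] := eqVneq (f x) y; first by left.
by right.
Qed.

Lemma has_card_bij (X Y : choiceType) (P : set X) (Q : set Y) (f : X -> Y)
    (g : Y -> X) n :
  (forall x, P x -> Q (f x)) -> (forall y, Q y -> P (g y) /\ f (g y) = y) ->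
  (forall x, P x -> g (f x) = x) -> has_card Q n -> has_card P n.
Proof.
move=> PQ gQ gf cQ; rewrite -[n]muln1; apply: has_card_fib cQ PQ _ => y Qy.
have [Pg fg] := gQ y Qy; apply: (@has_card1 _ _ (g y)) => //= x [Px <-].
by rewrite gf.
Qed.

(** Second half of a double count: the size of the base is recovered from that
    of the total space, and its finiteness is part of the conclusion. *)
Lemma has_card_base (X Y : choiceType) (P : set X) (Q : set Y) (f : X -> Y) N k :
  (0 < k)%N -> has_card P N -> (forall x, P x -> Q (f x)) ->
  (forall y, Q y -> has_card [set x | P x /\ f x = y] k) ->
  exists2 n, has_card Q n & (n * k)%N = N.
Proof.
move=> k_gt0 cP PQ fib; have [s [us ss sP]] := cP.
have cQ : has_card Q (size (undup [seq f x | x <- s])).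
  exists (undup [seq f x | x <- s]); split=> //; first exact: undup_uniq.
  move=> y; rewrite mem_undup; split=> [/mapP[x /sP/PQ ? ->]//|Qy].
  have [[|x r] [_ rk rP]] := fib y Qy; first by rewrite -rk in k_gt0.
  have /rP[Px <-] : x \in x :: r by rewrite mem_head.
  by apply: map_f; apply/sP.
exists (size (undup [seq f x | x <- s])) => //.
exact: has_card_inj (has_card_fib cQ PQ fib) cP.
Qed.

Lemma has_card_finite (X : choiceType) (P : set X) n : has_card P n ->
  finite_set P /\ #|` fset_set P| = n.
Proof.
move=> [s [us <- sP]].
have Ps : P = [set` s] by apply/predeqP => x /=; rewrite sP.
have finP : finite_set P by rewrite Ps; exact: finite_seq.
split=> //; have -> : fset_set P = seq_fset tt s.
  apply/fsetP => x; rewrite in_fset_set // seq_fsetE.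
  by apply/idP/idP => [/set_mem/sP|/sP Px] //; apply/mem_set.
by rewrite size_seq_fset undup_id.
Qed.

Lemma has_card_eq (X : choiceType) (P : set X) n : has_card P n <-> (P #= `I_n)%card.
Proof.
split=> [cP|Pn].
  have [finP <-] := has_card_finite cP; have /finite_setP[n' Pn'] := finP.
  by rewrite (card_fset_set Pn').
have finP : finite_set P by apply/finite_setP; exists n.
exists (fset_set P); split; first exact: fset_uniq.
  exact: card_fset_set.
by move=> x; rewrite in_fset_set // inE.
Qed.

(** * Gaussian binomials and the counting recursions *)

Section GBin.
Variable q : nat.

(** The Gaussian binomial [n, j] at the integer q. Among the two Pascal rules,
    this is the one that count_supplements meets. *)
Fixpoint gbin n j : nat :=
  match n, j with
  | _, 0 => 1
  | 0, _.+1 => 0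
  | n'.+1, j'.+1 => gbin n' j'.+1 + q ^ (n' - j') * gbin n' j'
  end.

Lemma gbin0 n : gbin n 0 = 1%N. Proof. by case: n. Qed.

Lemma gbinS n j :
  gbin n.+1 j.+1 = (gbin n j.+1 + q ^ (n - j) * gbin n j)%N.
Proof. by []. Qed.

Lemma gbin_small n j : (n < j)%N -> gbin n j = 0%N.
Proof.
elim: n j => [|n IH] [|j] //= ltnj.
by rewrite !IH ?muln0 //; lia.
Qed.

Lemma gbinn n : gbin n n = 1%N.
Proof. by elim: n => //= n ->; rewrite gbin_small // subnn. Qed.

Lemma gbin_gt0 n j : (0 < q)%N -> (j <= n)%N -> (0 < gbin n j)%N.
Proof.
move=> q0; elim: n j => [|n IH] [|j] //= lejn.
by rewrite addn_gt0 orbC muln_gt0 expn_gt0 q0 IH.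
Qed.

Lemma gbin1_le a b : (a <= b)%N -> (gbin a 1 <= gbin b 1)%N.
Proof.
move=> /subnK <-; elim: (b - a)%N => // j IH.
by rewrite addSn gbinS (leq_trans IH) ?leq_addr.
Qed.

Hypothesis q_gt1 : (1 < q)%N.
Local Notation Q := (q%:R : rat).

(** A rational number rather than a natural one: the identities between
    Gaussian binomials are obtained from gbin_fact by cancelling nonzero
    factors. *)
Definition qfact n : rat := \prod_(i < n) (Q ^+ i.+1 - 1).

Lemma qfactS n : qfact n.+1 = qfact n * (Q ^+ n.+1 - 1).
Proof. by rewrite /qfact big_ord_recr. Qed.

Lemma Qexp_neq1 n : Q ^+ n.+1 - 1 != 0.
Proof. by rewrite subr_eq0 -natrX (eqr_nat rat _ 1) -[1%N](expn0 q) eqn_exp2l. Qed.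

Lemma qfact_neq0 n : qfact n != 0.
Proof. by rewrite prodf_seq_neq0; apply/allP => i _; rewrite Qexp_neq1. Qed.

Lemma gbin_fact a b : (gbin (a + b) b)%:R * qfact a * qfact b = qfact (a + b).
Proof.
elim: a b => [|a IHa] b; first by rewrite gbinn mul1r /qfact big_ord0 mul1r.
elim: b => [|b IHb]; first by rewrite gbin0 mul1r addn0 /qfact big_ord0 mulr1.
rewrite addnS gbinS natrD natrM !mulrDl addSnnS.
have -> : (a + b.+1 - b = a.+1)%N by lia.
rewrite [qfact (a + b.+1).+1]qfactS.
have -> : (gbin (a + b.+1) b.+1)%:R * qfact a.+1 * qfact b.+1
        = qfact (a + b.+1) * (Q ^+ a.+1 - 1).
  rewrite -IHa [qfact a.+1]qfactS; move: (Q ^+ a.+1 - 1) (gbin _ _)%:R => x y; ring.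
have -> : (q ^ a.+1)%:R * (gbin (a + b.+1) b)%:R * qfact a.+1 * qfact b.+1
        = qfact (a + b.+1) * (Q ^+ a.+1 * (Q ^+ b.+1 - 1)).
  by rewrite addSnnS in IHb; rewrite -IHb [qfact b.+1]qfactS natrX; ring.
rewrite -mulrDr -addSn exprD; congr (_ * _).
by move: (Q ^+ a.+1) (Q ^+ b.+1) => x y; ring.
Qed.

Lemma gbin_revision n j i : (i <= j)%N -> (j <= n)%N ->
  (gbin n j * gbin j i = gbin n i * gbin (n - i) (j - i))%N.
Proof.
move=> ij jn; apply/eqP; rewrite -(eqr_nat rat) !natrM; apply/eqP.
have [a jE] : exists a, j = (a + i)%N by exists (j - i)%N; lia.
have [b nE] : exists b, n = (b + j)%N by exists (n - j)%N; lia.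
have h1 := gbin_fact b j; have h2 := gbin_fact a i.
have h3 := gbin_fact (b + a) i; have h4 := gbin_fact b a.
have -> : (n - i = b + a)%N by lia.
have -> : (j - i = a)%N by lia.
rewrite nE; have h5 : (b + j = b + a + i)%N by lia.
rewrite -h5 in h3; rewrite -jE in h2.
have nz := qfact_neq0; apply: (mulIf (nz b)); apply: (mulIf (nz a)); apply: (mulIf (nz i)).
transitivity (qfact (b + j)); first by rewrite -h1 -h2; ring.
by rewrite -h3 -h4; ring.
Qed.

Lemma gbin_multi n j i : (i + j <= n)%N ->
  (gbin n j * gbin (n - j) i = gbin n i * gbin (n - i) j)%N.
Proof.
move=> ijn; apply/eqP; rewrite -(eqr_nat rat) !natrM; apply/eqP.
have [a nE] : exists a, n = (a + i + j)%N by exists (n - (i + j))%N; lia.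
have h1 := gbin_fact (a + i) j; have h2 := gbin_fact a i.
have h3 := gbin_fact (a + j) i; have h4 := gbin_fact a j.
rewrite addnAC -nE in h3; rewrite -nE in h1.
have -> : (n - j = a + i)%N by lia.
have -> : (n - i = a + j)%N by lia.
have nz := qfact_neq0; apply: (mulIf (nz a)); apply: (mulIf (nz i)); apply: (mulIf (nz j)).
by transitivity (qfact n); [rewrite -h1 -h2|rewrite -h3 -h4]; ring.
Qed.

Lemma gbin_absorb a j : (gbin (a + j).+1 j.+1)%:R * (Q ^+ j.+1 - 1)
  = (gbin (a + j).+1 j)%:R * (Q ^+ a.+1 - 1).
Proof.
have h1 := gbin_fact a j.+1; have h2 := gbin_fact a.+1 j.
rewrite addnS in h1; rewrite addSn in h2.
have nz := qfact_neq0; apply: (mulIf (nz a)); apply: (mulIf (nz j)).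
transitivity (qfact (a + j).+1); first by rewrite -h1 [qfact j.+1]qfactS; ring.
by rewrite -h2 [qfact a.+1]qfactS; ring.
Qed.

Lemma gbinS' n j : gbin n.+1 j.+1 = (q ^ j.+1 * gbin n j.+1 + gbin n j)%N.
Proof.
have [ltnj|lejn] := ltnP n j.
  by rewrite gbinS !gbin_small ?muln0 //; lia.
have [a nE] : exists a, n = (a + j)%N by exists (n - j)%N; lia.
apply/eqP; rewrite -(eqr_nat rat) natrD natrM natrX; apply/eqP.
have [a0|a_gt0] := posnP a.
  by rewrite nE a0 add0n !gbinn gbin_small // mulr0 add0r.
have [c aE] : exists c, a = c.+1 by exists a.-1; lia.
rewrite gbinS natrD natrM natrX; have -> : (n - j = a)%N by lia.
have h := gbin_absorb c j; rewrite -addSn -aE -nE in h.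
have -> : Q ^+ a * (gbin n j)%:R = (gbin n j)%:R + (gbin n j)%:R * (Q ^+ a - 1) by ring.
by rewrite -h; ring.
Qed.

End GBin.

Section Numbers.
Variable q : nat.

(** With q = |k| and K quadratic over k, the number of k-subspaces of
    codimension c in K^r that span K^r over K. *)
Definition nforms r c := (gbin q r c * \prod_(i < c) (q ^ r + q ^ i))%N.

(** The number of K[[T]]-lattices of k-codimension d in K[[T]]^n. Splitting
    off one coordinate, either the lattice contains a vector with a unit there
    (first term), or all its vectors are divisible by T there (second term); T
    has k-codimension 2 in K[[T]]. *)
Fixpoint count0 n : nat -> nat :=
  if n is n'.+1 then
    fix g d := (count0 n' d * q ^ d + (if d is d'.+2 then g d' else 0))%N
  else fun d => (d == 0%N) : nat.

(** The number of R_(m+1)-lattices W of codimension c in R_m W, when R_m W is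
    a given R_m-lattice of rank r and, for m > 0, of codimension b in the
    R_(m-1)-lattice that it generates; see count_hull_fibre. *)
Definition fibre_count m r b c :=
  if m is 0 then nforms r c else (q ^ (c * (2 * r - b)) * gbin q b c)%N.

(** The number of R_(m+1)-lattices W of codimension d in R_m^r that have
    codimension c in R_m W. *)
Definition hull_count m (lattice_count : nat -> nat -> nat -> nat) r d c : nat :=
  if (c <= d)%N then (\sum_(b < (2 * r).+1) lattice_count r (d - c) b * fibre_count m r b c)%N
    else 0%N.

(** The number of lattices of codimension d and defect a in R^i + P^j, where P
    is the maximal ideal of R and where base treats the case i = 0. Either all
    the vectors have a nonunit at the coordinate that is split off (first
    term), or the lattice is obtained by gluing a vector to a lattice without
    this coordinate (second term). *)
Fixpoint split_count (base : nat -> nat -> nat -> nat) i j d a : nat :=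
  if i is i'.+1 then
    ((if d is d'.+1 then split_count base i' j.+1 d' a else 0)
      + (if a is a'.+1 then split_count base i' j d a' * q ^ d else 0))%N
  else base j d a.

(** The number of R_m-lattices of codimension d and defect b in R_m^n. *)
Fixpoint lattice_count m : nat -> nat -> nat -> nat :=
  if m is m'.+1 then fun n => split_count (hull_count m' (lattice_count m')) n 0
  else fun n d b => if b == 0%N then count0 n d else 0%N.

Hypothesis q_gt1 : (1 < q)%N.

(** The form in which the numbers nforms come out of the double count of
    count_spanningS. *)
Lemma nforms_rec r c :
  (nforms r c.+1 * gbin q c.+1 c = nforms r c * (gbin q (2 * r - c) 1 - gbin q c 1))%N.
Proof.
have [ltcr|] := ltnP c r; last first.
  rewrite leq_eqVlt => /orP[/eqP->|ltrc].
    have -> : (2 * c - c = c)%N by lia.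
    by rewrite subnn muln0 /nforms (@gbin_small q c c.+1).
  by rewrite /nforms (@gbin_small q r c.+1) ?(@gbin_small q r c) // ltnW.
apply/eqP; rewrite -(eqr_nat rat) !natrM natrB; last by apply: gbin1_le; lia.
have [s rE] : exists s, r = (s + c).+1 by exists (r - c.+1)%N; lia.
rewrite big_ord_recr /= natrM natrD !natrX; apply/eqP.
have h1 := gbin_absorb q_gt1 s c; rewrite -rE in h1.
have h2 := gbin_absorb q_gt1 (2 * r - c).-1 0; rewrite addn0 gbin0 prednK ?mul1r in h2; last lia.
have h3 : (gbin q c 1)%:R * (q%:R ^+ 1 - 1) = q%:R ^+ c - 1 :> rat.
  case: (c) => [|j]; first by rewrite mul0r expr0 subrr.
  by have := gbin_absorb q_gt1 j 0; rewrite addn0 gbin0 mul1r.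
have h4 := gbin_absorb q_gt1 0 c; rewrite add0n gbinn mul1r in h4.
have nz1 := Qexp_neq1 q_gt1 c; have nz2 := Qexp_neq1 q_gt1 0.
apply: (mulIf nz1); apply: (mulIf nz2).
have -> : (gbin q r c.+1)%:R * ((\prod_(i < c) (q ^ r + q ^ i))%:R * (q%:R ^+ r + q%:R ^+ c))
    * (gbin q c.+1 c)%:R * (q%:R ^+ c.+1 - 1) * (q%:R ^+ 1 - 1)
  = ((gbin q r c.+1)%:R * (q%:R ^+ c.+1 - 1)) * ((gbin q c.+1 c)%:R * (q%:R ^+ 1 - 1))
    * ((\prod_(i < c) (q ^ r + q ^ i))%:R * (q%:R ^+ r + q%:R ^+ c)) :> rat by ring.
rewrite h1 -h4.
have -> (x y z u v s' : rat) : x * y * (z - u) * v * s' = x * y * v * (z * s' - u * s') by ring.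
rewrite h2 h3; have -> : (2 * r - c = s.+1 + r)%N by lia.
have -> : q%:R ^+ r = q%:R ^+ s.+1 * q%:R ^+ c :> rat by rewrite rE -exprD addSn.
rewrite exprD; have -> : q%:R ^+ r = q%:R ^+ s.+1 * q%:R ^+ c :> rat by rewrite rE -exprD addSn.
by move: (q%:R ^+ s.+1) (q%:R ^+ c) (q%:R ^+ c.+1) => x y z; ring.
Qed.

End Numbers.

(** * Codimensions and counts of k-subspaces *)

Section Codim.
Variables (k : finFieldType) (F : comNzRingType) (io : {rmorphism k -> F}).
Variable V : lmodType F.
Implicit Types (A B C W : set V) (e u v w : V) (a b : k) (d : nat).

(** Subspaces are plain sets, because the same set of vectors will be a module
    over several of the orders R_m; k acts on V through io. *)
Definition ksub A := A 0 /\ forall a u v, A u -> A v -> A (io a *: u + v).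

Definition adj A e : set V := [set v | exists a, A (v - io a *: e)].

(** A has codimension d in B. A chain of one-vector extensions is used because
    V is infinite dimensional over k and so are all subspaces of interest; no
    quotient has to be formed. *)
Fixpoint idx d A B : Prop :=
  if d is d'.+1 then exists e, [/\ B e, ~ A e & idx d' (adj A e) B] else A = B.

Definition sadd A B : set V :=
  [set v | exists u w, [/\ A u, B w & v = u + w]].

Lemma ksub0 A : ksub A -> A 0. Proof. by case. Qed.
Lemma ksubZ A a u : ksub A -> A u -> A (io a *: u).
Proof. by move=> [A0 kA] Au; rewrite -[_ *: _]addr0; apply: kA. Qed.
Lemma ksubD A u v : ksub A -> A u -> A v -> A (u + v).
Proof. by move=> [_ kA] Au Av; have := kA 1 u v Au Av; rewrite rmorph1 scale1r. Qed.
Lemma ksubN A u : ksub A -> A u -> A (- u).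
Proof. by move=> kA /(@ksubZ _ (-1) _ kA); rewrite rmorphN1 scaleN1r. Qed.
Lemma ksubB A u v : ksub A -> A u -> A v -> A (u - v).
Proof. by move=> kA Au Av; apply: ksubD => //; apply: ksubN. Qed.

Lemma ksubDr A u v : ksub A -> A u -> A (u + v) <-> A v.
Proof.
move=> kA Au; split=> [Auv|]; last exact: ksubD.
by rewrite -(addKr u v); apply: ksubD => //; apply: ksubN.
Qed.

Lemma ksubBr A u v : ksub A -> A u -> A (v - u) <-> A v.
Proof.
by move=> kA Au; rewrite addrC; apply: ksubDr => //; apply: ksubN.
Qed.

Lemma ksubZr A a u : ksub A -> a != 0 -> A (io a *: u) -> A u.
Proof.
move=> kA an0 /(@ksubZ _ a^-1 _ kA).
by rewrite scalerA -rmorphM mulVf // rmorph1 scale1r.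
Qed.

Lemma ksub_sadd A B : ksub A -> ksub B -> ksub (sadd A B).
Proof.
move=> kA kB; split; first by exists 0, 0; rewrite addr0; split=> //; apply: ksub0.
move=> a _ _ [u [w [Au Bw ->]]] [u' [w' [Au' Bw' ->]]].
exists (io a *: u + u'), (io a *: w + w'); rewrite scalerDr addrACA.
by split=> //; [apply: kA.2|apply: kB.2].
Qed.

Lemma adj_ksub A e : ksub A -> ksub (adj A e).
Proof.
move=> kA; split; first by exists 0; rewrite rmorph0 scale0r subr0; apply: ksub0.
move=> a u v [b Au] [b' Av]; exists (a * b + b').
suff -> : io a *: u + v - io (a * b + b') *: e
        = io a *: (u - io b *: e) + (v - io b' *: e) by apply: kA.2.
by rewrite scalerBr scalerA -rmorphM rmorphD scalerDl opprD addrACA.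
Qed.

Lemma sub_adj A e : A `<=` adj A e.
Proof. by move=> v Av; exists 0; rewrite rmorph0 scale0r subr0. Qed.

Lemma adj_mem A e : ksub A -> adj A e e.
Proof. by move=> kA; exists 1; rewrite rmorph1 scale1r subrr; apply: ksub0. Qed.

Lemma adj_sub A B e : ksub B -> A `<=` B -> B e -> adj A e `<=` B.
Proof.
move=> kB AB Be v [a /AB Bv]; rewrite -(subrK (io a *: e) v).
by apply: ksubD => //; apply: ksubZ.
Qed.

Lemma adjC A e f : adj (adj A e) f = adj (adj A f) e.
Proof.
by apply/predeqP => v; split=> -[a [b Av]]; exists b, a; rewrite addrAC.
Qed.

(** Steinitz exchange; it makes the length of a chain from A to B independent
    of the chain. *)
Lemma adj_exch A e f : ksub A -> adj A f e -> ~ A e -> adj A e = adj A f.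
Proof.
move=> kA [a Aef] nAe; have an0 : a != 0.
  by apply: contra_notN nAe => /eqP a0; move: Aef; rewrite a0 rmorph0 scale0r subr0.
apply/seteqP; split; apply: adj_sub => //; try exact: adj_ksub.
- exact: sub_adj.
- by exists a.
- exact: sub_adj.
exists a^-1; rewrite -opprB; apply: ksubN => //.
apply: (ksubZr kA an0); rewrite scalerBr scalerA -rmorphM mulfV //.
by rewrite rmorph1 scale1r.
Qed.

Lemma idx_sub d A B : idx d A B -> A `<=` B.
Proof.
elim: d A => [A -> //|d IH A /= [e [_ _ /IH]]]; apply: subset_trans.
exact: sub_adj.
Qed.

Lemma idx_ksubr d A B : ksub A -> idx d A B -> ksub B.
Proof.
elim: d A => [A kA <- //|d IH A kA /= [e [_ _ ]]]; apply: IH.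
exact: adj_ksub.
Qed.

Lemma idx_exch d A B e : ksub A -> idx d.+1 A B -> B e -> ~ A e ->
  idx d (adj A e) B.
Proof.
elim: d A e => [|d IH] A e kA [f [Bf nAf]].
  move=> /= AfB Be nAe; rewrite -AfB; apply: adj_exch => //.
  by rewrite AfB.
move=> /= idf Be nAe.
have [Afe|nAfe] := pselect (adj A f e).
  by rewrite (adj_exch kA Afe nAe).
have idfe := IH _ e (adj_ksub f kA) idf Be nAfe.
exists f; split=> //; last by rewrite adjC.
move=> Aef; apply: nAfe; rewrite (adj_exch kA Aef nAf); exact: adj_mem.
Qed.

(** The vectors of the chain are taken in W for as long as W is not
    exhausted. *)
Lemma idx_mid d A W B : ksub A -> ksub W -> idx d A B -> A `<=` W -> W `<=` B ->
  exists c c', [/\ idx c A W, idx c' W B & d = (c + c')%N].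
Proof.
elim: d A => [|d IH] A kA kW.
  by move=> /= <- AW WA; exists 0%N, 0%N; split=> //=; apply/seteqP; split.
move=> idB AW WB; have [[w [Ww nAw]]|WA] := pselect (exists w, W w /\ ~ A w).
  have idw := idx_exch kA idB (WB _ Ww) nAw.
  have [||c [c' [h1 h2 ->]]] := IH _ (adj_ksub w kA) kW idw; first 2 last.
  - by exists c.+1, c'; split=> //; exists w.
  - exact: adj_sub.
  by [].
exists 0%N, d.+1; split=> //.
  by apply/seteqP; split=> // w Ww; apply: contrapT => nAw; apply: WA; exists w.
suff <- : A = W by [].
by apply/seteqP; split=> // w Ww; apply: contrapT => nAw; apply: WA; exists w.
Qed.

Lemma idx_uniq d d' A B : ksub A -> idx d A B -> idx d' A B -> d = d'.
Proof.
elim: d A d' => [|d IH] A [|d'] kA //.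
- by move=> /= -> [e [Be nBe]].
- by move=> /= [e [Be nAe _]] AB; case: nAe; rewrite AB.
move=> [e [Be nAe id1]] id2; congr _.+1; apply: (IH _ _ (adj_ksub e kA) id1).
exact: idx_exch id2 Be nAe.
Qed.

Lemma idx_trans d d' A B C : ksub A -> idx d A B -> idx d' B C ->
  idx (d + d') A C.
Proof.
elim: d A => [|d IH] A kA /=; first by move=> ->.
move=> [e [Be nAe id1]] id2; exists e; split=> //; first exact: idx_sub id2 _ Be.
by apply: IH id2 => //; apply: adj_ksub.
Qed.

Lemma idx1 A B e : B e -> ~ A e -> adj A e = B -> idx 1 A B.
Proof. by move=> Be nAe AB; exists e. Qed.

Lemma idx0_sub d A B : ksub A -> B `<=` A -> idx d A B -> d = 0%N.
Proof. by case: d => // d kA BA [e [/BA Be nAe]]. Qed.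

(** The second isomorphism theorem, on codimensions. *)
Lemma idx_iso2 d A W : ksub A -> ksub W ->
  idx d (A `&` W) W <-> idx d A (sadd A W).
Proof.
move=> kA kW; elim: d A kA => [|d IH] A kA /=.
  split=> [AW|AW].
    apply/seteqP; split=> [v Av|_ [u [w [Au Ww ->]]]].
      by exists v, 0; rewrite addr0; split=> //; apply: ksub0.
    by apply: ksubD => //; move: Ww; rewrite -AW => -[].
  apply/seteqP; split=> [v []//|w Ww]; split=> //; rewrite AW.
  by exists 0, w; rewrite add0r; split=> //; apply: ksub0.
have key e : W e -> adj (A `&` W) e = adj A e `&` W.
  move=> We; apply/predeqP => v; split=> [[a [Av Wv]]|[[a Av] Wv]].
    split; first by exists a.
    by move: Wv => /(ksubBr v kW (ksubZ a kW We)).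
  by exists a; split=> //; apply/ksubBr => //; apply: ksubZ.
have key2 e : W e -> sadd (adj A e) W = sadd A W.
  move=> We; apply/predeqP => v; split=> [[u [w [[a Au] Ww ->]]]|[u [w [Au Ww ->]]]].
    exists (u - io a *: e), (w + io a *: e); split=> //; last by rewrite addrACA addNr addr0.
    by apply: ksubD => //; apply: ksubZ.
  by exists u, w; split=> //; apply: sub_adj.
split=> [[e [We nAe id]]|[e [AWe nAe id]]].
  exists e; split.
  - by exists 0, e; rewrite add0r; split=> //; apply: ksub0.
  - by move=> Ae; apply: nAe.
  by rewrite -(key2 _ We); apply/IH; [apply: adj_ksub|rewrite -key].
move: AWe => [u [w [Au Ww eE]]].
have Aew : adj A w = adj A e.
  apply: adj_exch => //; last first.
    by move=> Aw; apply: nAe; rewrite eE; apply: ksubD.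
  exists 1; rewrite rmorph1 scale1r eE opprD addrCA subrr addr0.
  exact: ksubN.
exists w; split=> //.
  by move=> [Aw _]; apply: nAe; rewrite eE; apply: ksubD.
rewrite key //; apply/IH; first exact: adj_ksub.
by rewrite key2 // Aew.
Qed.

Lemma adj_img (phi : V -> V) A e :
  (forall a u v, phi (io a *: u + v) = io a *: phi u + phi v) ->
  adj (phi @` A) (phi e) = phi @` (adj A e).
Proof.
move=> lin; have linB a u : phi (u - io a *: e) = phi u - io a *: phi e.
  by rewrite -scaleNr -rmorphN addrC lin rmorphN scaleNr addrC.
apply/predeqP => v; split=> [[a [u Au uE]]|[u [a Au] <-]].
  exists (u + io a *: e); first by exists a; rewrite addrK.
  by rewrite addrC lin uE addrC subrK.
by exists a, (u - io a *: e).
Qed.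

Lemma idx_img d (phi : V -> V) A B :
  (forall a u v, phi (io a *: u + v) = io a *: phi u + phi v) -> injective phi ->
  idx d A B <-> idx d (phi @` A) (phi @` B).
Proof.
move=> lin inj; elim: d A => [|d IH] A /=.
  split=> [-> //|AB]; apply/predeqP => v; split=> [Av|Bv].
    have : (phi @` A) (phi v) by exists v.
    by rewrite AB => -[u Bu /inj <-].
  have : (phi @` B) (phi v) by exists v.
  by rewrite -AB => -[u Bu /inj <-].
split=> [[e [Be nAe id]]|[_ [[e Be <-] nAe id]]].
  exists (phi e); split; first by exists e.
    by move=> [u Au /inj uE]; apply: nAe; rewrite -uE.
  by rewrite adj_img //; apply/IH.
exists e; split=> //; first by move=> Ae; apply: nAe; exists e.
by apply/IH; rewrite -adj_img.
Qed.

(** A system of representatives of B modulo A. *)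
Definition transv A B (s : seq V) :=
  [/\ uniq s, forall v, v \in s -> B v,
      forall u v, u \in s -> v \in s -> A (u - v) -> u = v &
      forall v, B v -> exists2 u, u \in s & A (v - u)].

Lemma idx_transv d A B : ksub A -> idx d A B ->
  exists2 s, size s = (#|k| ^ d)%N & transv A B s.
Proof.
elim: d A => [|d IH] A kA /=.
  move=> <-; exists [:: 0]; split=> //.
  - by move=> v; rewrite inE => /eqP ->; apply: ksub0.
  - by move=> u v; rewrite !inE => /eqP -> /eqP ->.
  by move=> v Av; exists 0; rewrite ?inE ?eqxx ?subr0.
move=> [e [Be nAe id]]; have [s ss [us sB sA sc]] := IH _ (adj_ksub e kA) id.
have kB : ksub B := idx_ksubr (adj_ksub e kA) id.
pose t := [seq u + io a *: e | u <- s, a <- enum k].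
have inj u u' a a' : u \in s -> u' \in s ->
    A (u + io a *: e - (u' + io a' *: e)) -> u = u' /\ a = a'.
  move=> us1 us1' Au; have uu' : u = u'.
    apply: sA => //; exists (a' - a); rewrite rmorphB scalerBl opprB.
    by move: Au; rewrite opprD addrACA [io a *: e - _]addrC addrA.
  split=> //; move: Au; rewrite uu' opprD addrACA subrr add0r -scalerBl -rmorphB.
  move=> Aae; apply/eqP; rewrite -subr_eq0; apply: contra_notT nAe => aa'.
  exact: ksubZr Aae.
exists t; first by rewrite size_allpairs ss -cardE expnSr.
split.
- apply: allpairs_uniq => //; first exact: enum_uniq.
  move=> [u a] [u' a'] /allpairsP[[u1 a1] /= [u1s _ [-> ->]]].
  move=> /allpairsP[[u2 a2] /= [u2s _ [-> ->]]] /= E.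
  by have [|||-> ->] := inj u1 u2 a1 a2; rewrite ?E ?subrr //; apply: ksub0.
- move=> v /allpairsP[[u a] /= [us1 _ ->]]; apply: ksubD => //; first exact: sB.
  exact: ksubZ.
- move=> u v /allpairsP[[u1 a1] /= [u1s _ ->]] /allpairsP[[u2 a2] /= [u2s _ ->]].
  by move=> /inj [] // -> ->.
move=> v /sc[u us1 [a Au]]; exists (u + io a *: e).
  by apply/allpairsP; exists (u, a); rewrite mem_enum.
by rewrite opprD addrA.
Qed.

(** Finite index implies finite codimension: the coset representatives are
    adjoined to A one after the other. *)
Lemma idx_of_cover A B (s : seq V) : ksub A -> ksub B -> A `<=` B ->
  (forall v, B v -> A v \/ exists2 u, u \in s & A (v - u)) -> exists d, idx d A B.
Proof.
move=> kA kB; elim: s A kA => [|e s IH] A kA AB cov.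
  exists 0%N => /=; apply/seteqP; split=> // v Bv.
  by have [|[u]] := cov v Bv; rewrite ?in_nil.
have [Ae|nAe] := pselect (A e).
  apply: IH => // v /cov[|[u]]; first by left.
  rewrite inE => /orP[/eqP->|us] Avu; last by right; exists u.
  by left; move: Avu => /(ksubBr v kA Ae).
have [Be|nBe] := pselect (B e); last first.
  apply: IH => // v Bv; have [|[u]] := cov v Bv; first by left.
  rewrite inE => /orP[/eqP->|us] Avu; last by right; exists u.
  case: nBe; rewrite -(subKr v e); apply: ksubB => //.
  exact: AB.
have [|v|d id] := IH _ (adj_ksub e kA); first exact: adj_sub.
  move=> /cov[Av|[u]]; first by left; apply: sub_adj.
  rewrite inE => /orP[/eqP->|us] Avu; last by right; exists u => //; apply: sub_adj.
  by left; exists 1; rewrite rmorph1 scale1r.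
by exists d.+1, e.
Qed.

Implicit Types (N X U : set V) (f : V) (c : nat).
Arguments idx : simpl never.

Lemma idxS d A B : idx d.+1 A B -> exists e, [/\ B e, ~ A e & idx d (adj A e) B].
Proof. by []. Qed.

Local Notation q := #|k|.

Lemma idx_cons d A B e : B e -> ~ A e -> idx d (adj A e) B -> idx d.+1 A B.
Proof. by move=> Be nAe id; exists e. Qed.

Lemma adj_proper W e X : ksub W -> ~ W e -> adj W e = X -> idx 1 W X.
Proof.
by move=> kW nWe WX; apply: (@idx1 _ _ e) => //; rewrite -WX; apply: adj_mem.
Qed.

(** For every vector f, a complement W of the line of e contains f - l e for
    exactly one scalar l. So each step of a chain from A + k e to X leaves q
    choices. *)
Lemma count_complements d A e X : ksub A -> ~ A e -> idx d (adj A e) X ->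
  has_card [set W | [/\ ksub W, A `<=` W, ~ W e & adj W e = X]] (q ^ d)%N.
Proof.
elim: d A => [|d IH] A kA nAe.
  move=> AX; apply: (@has_card1 _ _ A) => [|W [kW AW nWe WX]]; first by split.
  apply/seteqP; split=> // w Ww; have : X w by rewrite -WX; exact: sub_adj.
  rewrite -AX => -[a Aw]; suff a0 : a = 0 by move: Aw; rewrite a0 rmorph0 scale0r subr0.
  apply/eqP; apply: contra_notT nWe => an0; apply: (ksubZr kW an0).
  by rewrite -(subKr w (io a *: e)); apply: ksubB => //; apply: AW.
move=> /idxS[f [Xf nAf id]]; rewrite expnS.
pose Al (l : k) := adj A (f - io l *: e).
have Alf l : adj (Al l) e = adj (adj A e) f.
  have kAl : ksub (adj (Al l) e) by apply/adj_ksub/adj_ksub.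
  have kAf : ksub (adj (adj A e) f) by apply/adj_ksub/adj_ksub.
  have h1 : (adj (adj A e) f) e by apply/sub_adj/adj_mem.
  have h2 : (adj (adj A e) f) f by apply/adj_mem/adj_ksub.
  have h3 : (adj (Al l) e) e by apply/adj_mem/adj_ksub.
  have h4 : (adj (Al l) e) f.
    by exists l; apply: adj_mem.
  apply/seteqP; split; apply: adj_sub => //; apply: adj_sub => //.
  - by move=> v Av; do 2 apply: sub_adj.
  - by apply: ksubB => //; apply: ksubZ.
  by move=> v Av; do 2 apply: sub_adj.
have nAle l : ~ Al l e.
  move=> [a]; rewrite scalerBr scalerA -rmorphM => Aa.
  have [a0|an0] := eqVneq a 0.
    by apply: nAe; move: Aa; rewrite a0 mul0r rmorph0 !scale0r subrr subr0.
  apply: nAf; exists ((1 + a * l) / a).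
  rewrite -[f - _]opprB; apply: ksubN => //; apply: (ksubZr kA an0).
  rewrite scalerBr scalerA -rmorphM mulrCA mulfV // mulr1 rmorphD rmorph1.
  by rewrite scalerDl scale1r -addrA -[io (a * l) *: e - _]opprB.
have kX : ksub X.
  by apply: idx_ksubr id; apply/adj_ksub/adj_ksub.
have Xe : X e by apply: (idx_sub id); apply/sub_adj/adj_mem.
have AX : A `<=` X by move=> v Av; apply: (idx_sub id); do 2 apply: sub_adj.
(* The scalar l with f - l e in W, as a function of W. *)
pose h (W : set V) : k := if pselect (exists l, W (f - io l *: e)) is left p
                          then projT1 (cid p) else 0.
have hP (W : set V) l : ksub W -> ~ W e -> W (f - io l *: e) -> h W = l.
  move=> kW nWe Wl; rewrite /h; case: pselect => [p|[]]; last by exists l.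
  case: (cid p) => l' /= Wl'; apply/eqP; rewrite -subr_eq0.
  apply: contra_notT nWe => nl; apply: (ksubZr kW nl).
  rewrite rmorphB scalerBl.
  have -> : io l' *: e - io l *: e = (f - io l *: e) - (f - io l' *: e).
    by rewrite opprB [RHS]addrC addrA addrNK.
  exact: ksubB.
rewrite -[q]cardsT; have := @has_card_fib _ k _ setT h q (q ^ d)%N.
rewrite cardsT; apply=> //.
  by exists (enum k); rewrite -cardE enum_uniq; split=> // x; rewrite mem_enum.
move=> l _; have := IH _ (@adj_ksub A (f - io l *: e) kA) (nAle l).
rewrite -/(Al l) Alf => /(_ id); apply: has_card_ext => W /=; split.
  move=> [kW AlW nWe WX]; split; last by apply: hP => //; apply: AlW; apply: adj_mem.
  by split=> // v Av; apply: AlW; apply: sub_adj.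
move=> [[kW AW nWe WX] hl]; split=> //; apply: adj_sub => //.
have [l' Wl'] : adj W e f by rewrite WX.
by rewrite -hl (hP W l').
Qed.

(** Let e be a vector of N outside A. Either W contains e, and A can be
    enlarged by e; or W is a complement of the line of e in W + k e, which
    contains e and has codimension c - 1. The two cases give the two terms of
    the Pascal rule for [b, c]. *)
Lemma count_supplements (a b c : nat) A N X : ksub A -> idx b A N -> idx a N X ->
  has_card [set W | [/\ ksub W, A `<=` W, sadd W N = X & idx c W X]]
    (q ^ (c * a) * gbin q b c)%N.
Proof.
move=> kA idN idX; have kN := idx_ksubr kA idN; have kX := idx_ksubr kN idX.
have card0 A' : A' `<=` X ->
    has_card [set W | [/\ ksub W, A' `<=` W, sadd W N = X & idx 0 W X]] 1.
  move=> A'X; apply: (@has_card1 _ _ X) => [|W [] //]; split=> //.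
  apply/seteqP; split=> [_ [u [w [Xu Nw ->]]]|v Xv].
    by apply: ksubD => //; apply: (idx_sub idX).
  by exists v, 0; rewrite addr0; split=> //; apply: ksub0.
have AX : A `<=` X by apply: subset_trans (idx_sub idN) (idx_sub idX).
elim: b A c kA idN AX => [|b IH] A c kA idN AX.
  case: c => [|c]; first by rewrite mul0n expn0; apply: card0.
  rewrite muln0; apply: has_card0 => W [kW AW WN idW].
  have : c.+1 = 0%N; last by [].
  apply: idx0_sub idW => //; rewrite -WN -idN => _ [u [w [Wu Aw ->]]].
  by apply: ksubD => //; apply: AW.
case: c => [|c]; first by rewrite mul0n expn0 gbin0; apply: card0.
have [e [Ne nAe id]] := idxS idN.
have kAe : ksub (adj A e) by apply: adj_ksub.
have Xe : X e by apply: (idx_sub idX).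
have AeX : adj A e `<=` X by apply: adj_sub.
have c1 := IH (adj A e) c.+1 kAe id AeX.
have c2 := IH (adj A e) c kAe id AeX.
have c3 : has_card [set W | [/\ ksub W, A `<=` W, sadd W N = X & idx c.+1 W X]
     /\ ~ W e] (q ^ (c * a) * gbin q b c * q ^ (b + a - c))%N.
  apply: (has_card_fib (f := fun W => adj W e) c2) => [W /= [[kW AW WN idW] nWe]|].
    split.
    - exact: adj_ksub.
    - apply: adj_sub; [exact: adj_ksub| |exact: adj_mem].
      by move=> v Av; apply/sub_adj/AW.
    - apply/seteqP; split=> [_ [u [w [Wu Nw ->]]]|v].
        apply: ksubD => //; last exact: (idx_sub idX).
        by apply: (@adj_sub W X e) Wu => //; apply: idx_sub idW.
      rewrite -WN => -[u [w [Wu Nw ->]]]; exists u, w; split=> //.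
      exact: sub_adj.
    by apply: idx_exch idW _ nWe.
  move=> W' [kW' AW' W'N idW'].
  have idc : idx (b + a - c) (adj A e) W'.
    have [c' [c'' [h1 h2 bE]]] := idx_mid kAe kW' (idx_trans kAe id idX) AW' (idx_sub idW').
    by rewrite bE (idx_uniq kW' idW' h2) addnK.
  apply: has_card_ext (count_complements kA nAe idc) => W /=; split.
    move=> [kW AW nWe WW']; do !split=> //.
      apply/seteqP; split=> [_ [u [w [Wu Nw ->]]]|v].
        apply: ksubD => //; last exact: (idx_sub idX).
        by apply: (idx_sub idW'); rewrite -WW'; apply: sub_adj.
      rewrite -W'N -WW' => -[u [w [[l Wu] Nw ->]]].
      exists (u - io l *: e), (w + io l *: e).
      rewrite addrACA addNr addr0; split=> //.
      by apply: ksubD => //; apply: ksubZ.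
    apply: (idx_trans kW (adj_proper kW nWe WW')); exact: idW'.
  by move=> [[[kW AW WN idW] nWe] WW'].
rewrite gbinS mulnDr.
have -> : (q ^ (c.+1 * a) * (q ^ (b - c) * gbin q b c)
           = q ^ (c * a) * gbin q b c * q ^ (b + a - c))%N.
  have [ltbc|lecb] := ltnP b c; first by rewrite gbin_small // !muln0.
  by rewrite mulnAC -expnD mulnA -expnD; congr (_ ^ _ * _)%N; lia.
apply: has_card_ext (has_cardU c1 c3 _) => W /=; last first.
  by move=> [_ AW _ _] [_ []]; apply: AW; apply: adj_mem.
split=> [[[kW AW WN idW]|[[kW AW WN idW] _]]|[kW AW WN idW]].
- by split=> // v Av; apply: AW; apply: sub_adj.
- by split.
have [We|nWe] := pselect (W e); last by right.
by left; split=> //; apply: adj_sub.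
Qed.

(** The module generated by W over a ring that is spanned by 1 and om over the
    ring acting on W. It will be R_m W for an R_(m+1)-lattice W, with om =
    theta_m. *)
Definition hull (om : F) W : set V :=
  [set v | exists u u', [/\ W u, W u' & v = u + om *: u']].

Lemma hull_ksub om W : ksub W -> ksub (hull om W).
Proof.
move=> kW; split; first by exists 0, 0; rewrite scaler0 addr0; split=> //; apply: ksub0.
move=> a _ _ [u [u' [Wu Wu' ->]]] [v [v' [Wv Wv' ->]]].
exists (io a *: u + v), (io a *: u' + v'); split; rewrite ?kW.2 //.
- exact: kW.2.
- exact: kW.2.
by rewrite !scalerDr !scalerA [om * _]mulrC addrACA.
Qed.

Lemma sub_hull om W : ksub W -> W `<=` hull om W.
Proof. by move=> kW v Wv; exists v, 0; rewrite scaler0 addr0; split=> //; apply: ksub0. Qed.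

Lemma hull_scale om W v : ksub W -> W v -> hull om W (om *: v).
Proof. by move=> kW Wv; exists 0, v; rewrite add0r; split=> //; apply: ksub0. Qed.

Lemma hull_sub om W X : ksub X -> W `<=` X -> (forall v, W v -> X (om *: v)) ->
  hull om W `<=` X.
Proof.
by move=> kX WX wX _ [u [u' [Wu Wu' ->]]]; apply: ksubD; [|apply: WX|apply: wX].
Qed.

Section Quadratic.
Variables (om : F) (beta gam : k).
Hypothesis w_quad : om * om = io beta * om + io gam.
Hypothesis w_irr : forall l : k, l * l != beta * l + gam.

Lemma hull_stable W v : ksub W -> hull om W v -> hull om W (om *: v).
Proof.
move=> kW [u [u' [Wu Wu' ->]]]; exists (io gam *: u'), (u + io beta *: u').
split; [exact: ksubZ|by apply: ksubD => //; exact: ksubZ|].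
by rewrite !scalerDr !scalerA w_quad scalerDl [om * io _]mulrC [RHS]addrC -addrA.
Qed.

(** The norm l^2 - beta l - gam of om - l is a nonzero element of k and a
    multiple of om - l, so om - l acts injectively on V / W. *)
Lemma no_eigen W l v : ksub W -> (forall u, W u -> W (om *: u)) ->
  W (om *: v - io l *: v) -> W v.
Proof.
move=> kW wW Wv; have nz : l * l - (beta * l + gam) != 0 by rewrite subr_eq0.
apply: (ksubZr kW nz).
have -> : io (l * l - (beta * l + gam)) *: v =
  io (beta - l) *: (om *: v - io l *: v) - om *: (om *: v - io l *: v).
  rewrite !scalerBr !scalerA w_quad !rmorphB !rmorphD !rmorphM.
  rewrite -!scalerBl; congr (_ *: _); ring.
by apply: ksubB => //; [apply: ksubZ|apply: wW].
Qed.

Variables (A X : set V) (D : nat).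
Hypotheses (kA : ksub A) (idA : idx D A X).
Hypotheses (wA : forall v, A v -> A (om *: v)) (wX : forall v, X v -> X (om *: v)).

(** These are the subspaces of X / A, a vector space over the field k[om],
    that span it over k[om]. *)
Definition spanning c : set (set V) :=
  [set W | [/\ ksub W, A `<=` W, hull om W = X & idx c W X]].

Lemma spanning0 : has_card (spanning 0) 1.
Proof.
have kX := idx_ksubr kA idA.
apply: (@has_card1 _ _ X) => [|W []] //; split=> //; first exact: idx_sub idA.
by apply/seteqP; split; [exact: hull_sub|exact: sub_hull].
Qed.

(** The hyperplanes W of W1 that do not span correspond to the hyperplanes Y
    of X above W1, by Y = W1 + om W and W = { v in W1 | om v in Y }: since W1
    spans, Y cannot contain om W1, and no_eigen shows that W1 + om W is not
    all of X. *)
Lemma count_bad_hyperplanes c W1 : spanning c W1 ->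
  has_card [set W | [/\ ksub W, A `<=` W, idx 1 W W1 & hull om W <> X]]
    (gbin q c 1).
Proof.
move=> [kW1 AW1 W1X id1]; have kX := idx_ksubr kA idA; have W1_X := idx_sub id1.
have cY : has_card [set Y | [/\ ksub Y, W1 `<=` Y & idx 1 Y X]] (gbin q c 1).
  have := count_supplements 1 kW1 id1 (erefl : idx 0 X X).
  rewrite muln0 expn0 mul1n; apply: has_card_ext => Y /=; split=> [[]//|[kY W1Y idY]].
  split=> //; apply/seteqP; split=> [_ [u [u' [Yu Xu ->]]]|v Xv].
    by apply: ksubD => //; apply: (idx_sub idY).
  by exists 0, v; rewrite add0r; split=> //; apply: ksub0.
have idxY Y : ksub Y -> idx 1 Y X -> forall v, X v -> ~ Y v -> adj Y v = X.
  by move=> kY idY v Xv nYv; have := idx_exch kY idY Xv nYv.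
pose f (W : set V) : set V := [set v | exists u u', [/\ W1 u, W u' & v = u + om *: u']].
pose g (Y : set V) : set V := [set v | W1 v /\ Y (om *: v)].
have kf W : ksub W -> ksub (f W).
  move=> kW; split.
    by exists 0, 0; rewrite scaler0 addr0; split=> //; apply: ksub0.
  move=> a _ _ [u [u' [Wu Wu' ->]]] [v [v' [Wv Wv' ->]]].
  exists (io a *: u + v), (io a *: u' + v'); split; first exact: kW1.2.
    exact: kW.2.
  by rewrite !scalerDr !scalerA [om * _]mulrC addrACA.
have kg Y : ksub Y -> ksub (g Y).
  move=> kY; split; first by split; [exact: ksub0|rewrite scaler0; exact: ksub0].
  move=> a u v [W1u Yu] [W1v Yv]; split; first exact: kW1.2.
  by rewrite scalerDr scalerA mulrC -scalerA; apply: kY.2.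
have fX W : W `<=` W1 -> f W `<=` X.
  move=> WW1 _ [u [u' [Wu Wu' ->]]]; apply: ksubD => //; first exact: W1_X.
  by apply/wX/W1_X/WW1.
have W1f W : ksub W -> W1 `<=` f W.
  by move=> kW u W1u; exists u, 0; rewrite scaler0 addr0; split=> //; apply: ksub0.
have wf W v : W v -> f W (om *: v).
  by move=> Wv; exists 0, v; rewrite add0r; split=> //; apply: ksub0.
(* As W1 spans X, a proper subspace above W1 does not contain om W1. *)
have X_W1 Y : ksub Y -> W1 `<=` Y -> idx 1 Y X ->
    exists2 w0, W1 w0 & ~ Y (om *: w0).
  move=> kY W1Y idY; apply: contrapT => nw0.
  have YX : X `<=` Y.
    rewrite -W1X; apply: hull_sub => // v W1v; apply: contrapT => nYv.
    by apply: nw0; exists v.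
  by have := idx0_sub kY YX idY.
have gf_id Y : ksub Y -> W1 `<=` Y -> idx 1 Y X -> idx 1 (g Y) W1.
  move=> kY W1Y idY; have [w0 W1w0 nYw0] := X_W1 Y kY W1Y idY.
  apply: (@idx1 _ _ w0) => //; first by case.
  apply/seteqP; split; first by apply: adj_sub => // v [].
  move=> v W1v; have [l Yl] : adj Y (om *: w0) (om *: v).
    by rewrite (idxY Y) //; apply/wX/W1_X.
  exists l; split; first by apply: ksubB => //; apply: ksubZ.
  by rewrite scalerBr scalerA mulrC -scalerA.
have fg_id W : ksub W -> idx 1 W W1 -> hull om W <> X -> idx 1 (f W) X.
  move=> kW idW nWX; have [w0 [W1w0 nWw0 W1E]] := idxS idW.
  have WW1 := idx_sub idW.
  have W1adj : adj W w0 = W1 by [].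
  have fwX : adj (f W) (om *: w0) = X.
    apply/seteqP; split.
      by apply: adj_sub; [|apply: fX|apply/wX/W1_X].
    move=> v; rewrite -W1X => -[u [u' [W1u]]]; rewrite -{1}W1adj => -[l Wu'] ->.
    exists l; exists u, (u' - io l *: w0); split=> //.
    by rewrite scalerBr !scalerA [om * _]mulrC addrA.
  have nfw : ~ f W (om *: w0).
    move=> [u [u' [W1u Wu' E]]]; move: W1u; rewrite -W1adj => -[l Wu].
    pose Z := hull om W; have kZ : ksub Z := hull_ksub om kW.
    have wZ v : Z v -> Z (om *: v) by apply: hull_stable.
    have Zw0 : Z w0.
      apply: (@no_eigen Z l) => //; rewrite E addrAC.
      by exists (u - io l *: w0), u'.
    apply: nWX; apply/seteqP; split.
      apply: hull_sub => // v Wv; first exact/W1_X/WW1.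
      exact/wX/W1_X/WW1.
    rewrite -W1X; have W1Z : W1 `<=` Z.
      by rewrite -W1adj; apply: adj_sub => //; apply: sub_hull.
    by apply: hull_sub => // v W1v; apply/wZ/W1Z.
  by apply: (@idx1 _ _ (om *: w0)) => //; apply/wX/W1_X.
apply: (has_card_bij (f := f) (g := g)) cY => [W|Y|W] /=.
- move=> [kW AW idW nWX]; split; [exact: kf|exact: W1f|exact: fg_id].
- move=> [kY W1Y idY]; split.
    split; [exact: kg|by move=> v Av; split; [exact: AW1|apply/W1Y/AW1/wA]|exact: gf_id|].
    move=> gX; have YX : X `<=` Y.
      by rewrite -gX; apply: hull_sub => // v [W1v Yv] //; exact: W1Y.
    by have := idx0_sub kY YX idY.
  have fY : f (g Y) `<=` Y.
    by move=> _ [u [u' [W1u [_ Yu'] ->]]]; apply: ksubD => //; apply: W1Y.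
  apply/seteqP; split=> // v Yv; have [w0 W1w0 nYw0] := X_W1 Y kY W1Y idY.
  have : hull om W1 v by rewrite W1X; apply: (idx_sub idY).
  move=> [u [u' [W1u W1u' vE]]].
  have gw0 : adj (g Y) w0 = W1.
    by have := idx_exch (kg _ kY) (gf_id _ kY W1Y idY) W1w0 (fun h => nYw0 h.2).
  move: W1u'; rewrite -gw0 => -[l gl]; exists u, u'; split=> //.
  suff l0 : l = 0 by move: gl; rewrite l0 rmorph0 scale0r subr0.
  apply/eqP; apply: contra_notT nYw0 => nl; apply: (ksubZr kY nl).
  have -> : io l *: (om *: w0) = v - u - om *: (u' - io l *: w0).
    by rewrite vE [u + _]addrC addrK scalerBr subKr !scalerA mulrC.
  by apply: ksubB => //; [apply: ksubB => //; apply: W1Y|case: gl].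
move=> [kW AW idW nWX]; apply/esym.
have gk := kg _ (kf _ kW).
have Wg : W `<=` g (f W) by move=> v Wv; split; [exact: (idx_sub idW)|exact: wf].
have idg : idx 1 (g (f W)) W1 by apply: gf_id; [exact: kf|exact: W1f|exact: fg_id].
have [c1 [c2 [h1 h2 cE]]] := idx_mid kW gk idW Wg (idx_sub idg).
have c21 := idx_uniq gk h2 idg; have c10 : c1 = 0%N by lia.
by rewrite c10 in h1.
Qed.

(** Double count of the pairs of spanning subspaces W of W1 of codimensions c
    + 1 and c. Among the [D - c, 1] hyperplanes of W1 above A, exactly [c, 1]
    do not span; and all the [c + 1, c] spaces W1 above a spanning W span. *)
Lemma count_spanningS c n : has_card (spanning c) n ->
  exists2 n', has_card (spanning c.+1) n' &
    (n' * gbin q c.+1 c = n * (gbin q (D - c) 1 - gbin q c 1))%N.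
Proof.
move=> cS; have kX := idx_ksubr kA idA.
have cE : has_card [set p : set V * set V | spanning c p.1 /\
     [/\ spanning c.+1 p.2 & idx 1 p.2 p.1]] (n * (gbin q (D - c) 1 - gbin q c 1))%N.
  apply: (has_card_fib (f := fst) cS) => [[W1 W] []//|W1 sW1].
  have cb := count_bad_hyperplanes sW1; have [kW1 AW1 W1X id1] := sW1.
  have idD : idx (D - c) A W1.
    have [c1 [c2 [h1 h2 ->]]] := idx_mid kA kW1 idA AW1 (idx_sub id1).
    by rewrite (idx_uniq kW1 id1 h2) addnK.
  have := count_supplements 1 kA idD (erefl : idx 0 W1 W1).
  rewrite muln0 expn0 mul1n => ch.
  have := has_cardD ch cb; set P := (X in has_card X _) => cP.
  have {}cP : has_card P (gbin q (D - c) 1 - gbin q c 1)%N.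
    apply: cP => W [kW AW idW nWX]; split=> //.
    apply/seteqP; split=> [_ [u [u' [Wu W1u ->]]]|v W1v].
      by apply: ksubD => //; apply: (idx_sub idW).
    by exists 0, v; rewrite add0r; split=> //; apply: ksub0.
  apply: (has_card_bij (f := snd) (g := fun W => (W1, W))) cP => /=.
  - move=> [W1' W] /= [[sW1' [[kW AW WX idcW] idW]] W1E]; subst W1'.
    split; last by case.
    split=> //; apply/seteqP; split=> [_ [u [u' [Wu W1u ->]]]|v W1v].
      by apply: ksubD => //; apply: (idx_sub idW).
    by exists 0, v; rewrite add0r; split=> //; apply: ksub0.
  - move=> W [[kW AW _ idW] nbad]; do !split=> //.
      by apply: contrapT => nWX; apply: nbad.
    by rewrite -add1n; apply: idx_trans idW id1.
  by move=> [W1' W] /= [_ ->].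
have [||W|n' cn' nE] := @has_card_base _ _ _ (spanning c.+1) snd _ (gbin q c.+1 c) _ cE.
- by apply: gbin_gt0 => //; apply/card_gt0P; exists 0.
- by move=> [W1 W] /= [_ []].
- move=> sW; have [kW AW WX idW] := sW.
  have := count_supplements c kW idW (erefl : idx 0 X X).
  rewrite muln0 expn0 mul1n => cW.
  apply: (has_card_bij (f := fst) (g := fun W1 => (W1, W))) cW => /=.
  - move=> [W1 W'] /= [[[kW1 AW1 W1X id1] [sW' id']] W'E]; subst W'; split=> //.
      exact: idx_sub id'.
    apply/seteqP; split=> [_ [u [u' [Wu W1u ->]]]|v W1v].
      by apply: ksubD => //; apply: (idx_sub id1).
    by exists 0, v; rewrite add0r; split=> //; apply: ksub0.
  - move=> W1 [kW1 WW1 _ id1]; do !split=> //.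
    + by move=> v /AW /WW1.
    + apply/seteqP; split.
        apply: hull_sub => // v W1v; first exact: (idx_sub id1).
        by apply: wX; apply: (idx_sub id1).
      rewrite -WX; apply: hull_sub; first exact: hull_ksub.
        by move=> v /WW1 W1v; apply: sub_hull.
      by move=> v /WW1 W1v; apply: hull_scale.
    have [c1 [c2 [h1 h2 cE']]] := idx_mid kW kW1 idW WW1 (idx_sub id1).
    have c2c := idx_uniq kW1 h2 id1; suff <- : c1 = 1%N by [].
    by lia.
  by move=> [W1 W'] /= [_ ->].
by exists n'.
Qed.

End Quadratic.
End Codim.

(** * The orders R_m *)

Section OrderRing.
Variables (k K : fieldType) (iota : {rmorphism k -> K}).
Implicit Types (f g h : fps K) (m : nat).
Local Notation R m := (fps_order iota m).

Fact fpsC_zmod (A : comNzRingType) : zmod_morphism (@fpsC A).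
Proof. by move=> a b; apply: fpsP => -[|i] //=; rewrite subr0. Qed.
Fact fpsC_monoid (A : comNzRingType) : monoid_morphism (@fpsC A).
Proof.
split=> [|a b]; first by apply: fpsP => i.
apply: fpsP => i; rewrite fcoefM big_ord_recl /= subn0 big1 ?addr0; last first.
  by move=> j _; rewrite mul0r.
by case: eqP; rewrite ?mulr0.
Qed.
HB.instance Definition _ (A : comNzRingType) :=
  GRing.isZmodMorphism.Build A (fps A) (@fpsC A) (@fpsC_zmod A).
HB.instance Definition _ (A : comNzRingType) :=
  GRing.isMonoidMorphism.Build A (fps A) (@fpsC A) (@fpsC_monoid A).

Lemma fcoefCM (A : comNzRingType) (a : A) (f : fps A) i :
  fcoef (fpsC a * f) i = a * fcoef f i.
Proof.
rewrite fcoefM big_ord_recl /= subn0 big1 ?addr0 // => j _.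
by rewrite mul0r.
Qed.

Lemma fcoefXM (A : comNzRingType) (f : fps A) i :
  fcoef (fpsX * f) i = if i is i'.+1 then fcoef f i' else 0.
Proof.
rewrite fcoefM; case: i => [|i]; first by rewrite big_ord1 /= mul0r.
rewrite 2!big_ord_recl /= mul0r add0r mul1r subSS subn0 big1 ?addr0 // => j _.
by rewrite mul0r.
Qed.

Lemma fcoefXnM (A : comNzRingType) (f : fps A) m i :
  fcoef (fpsX ^+ m * f) i = if (i < m)%N then 0 else fcoef f (i - m).
Proof.
elim: m i => [|m IH] i; first by rewrite expr0 mul1r subn0.
rewrite exprS -mulrA fcoefXM; case: i => [|i] //; by rewrite IH ltnS subSS.
Qed.

Lemma fpsX_inj (A : comNzRingType) (f g : fps A) : fpsX * f = fpsX * g -> f = g.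
Proof.
by move=> E; apply: fpsP => i; have := congr1 (fun F : fps A => fcoef F i.+1) E; rewrite !fcoefXM.
Qed.

Lemma orderP m f :
  reflect (forall i, (i < m)%N -> exists a, fcoef f i = iota a) (f \in R m).
Proof.
apply: (iffP (asboolP _)) => [[g [h ->]] i ltim|fP].
  by exists (fcoef g i); rewrite fcoefD fcoefXnM ltim addr0.
pose c i : k := if pselect (exists a, fcoef f i = iota a) is left p
             then projT1 (cid p) else 0.
have cP i : (i < m)%N -> fcoef f i = iota (c i).
  move=> /fP fi; rewrite /c; case: pselect => // p.
  exact: projT2 (cid p).
exists (Fps (fun i => if (i < m)%N then c i else 0)), (Fps (fun i => fcoef f (i + m))).
apply: fpsP => i; rewrite fcoefD fcoefXnM /=.
have [ltim|lemi] := ltnP i m; first by rewrite addr0 cP.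
by rewrite rmorph0 add0r subnK.
Qed.

Lemma order0 f : f \in R 0. Proof. exact/orderP. Qed.

Lemma orderC m a : fpsC (iota a) \in R m.
Proof.
apply/orderP => -[|i] _ /=; first by exists a.
by exists 0; rewrite rmorph0.
Qed.

Lemma orderX m : fpsX \in R m.
Proof.
by apply/orderP => i _ /=; exists (i == 1%N)%:R; rewrite rmorph_nat.
Qed.

Lemma order_pred m f : f \in R m -> f \in R m.-1.
Proof.
move=> /orderP fP; apply/orderP => i lti; apply: fP.
by apply: leq_trans lti (leq_pred _).
Qed.

Lemma order_XM m f : f \in R m.-1 -> fpsX * f \in R m.
Proof.
move=> /orderP fP; apply/orderP => -[|i] ltim; rewrite fcoefXM.
  by exists 0; rewrite rmorph0.
by apply: fP; case: (m) ltim.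
Qed.

Lemma fps_headtail (f : fps K) :
  f = fpsC (fcoef f 0) + fpsX * Fps (fun i => fcoef f i.+1).
Proof.
apply: fpsP => -[|i]; rewrite fcoefD fcoefXM /= ?addr0 //.
by rewrite add0r.
Qed.

Lemma order_tail m f : f \in R m -> Fps (fun i => fcoef f i.+1) \in R m.-1.
Proof.
move=> /orderP fP; apply/orderP => i /=; case: m fP => //= m fP ltim.
exact: fP.
Qed.

Lemma fps_unitE (L : fieldType) (f : fps L) :
  (f \is a GRing.unit) = (fcoef f 0 != 0).
Proof. by rewrite -unitfE. Qed.

(** The orders are local rings; so a vector with a unit coordinate can be
    normalised to have the coordinate 1 there. *)
Lemma order_inv m f : f \in R m -> fcoef f 0 != 0 -> f^-1 \in R m.
Proof.
move=> /asboolP[g [h fE]] f0; case: m fE => [|m] fE; first exact: order0.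
have Uf : f \is a GRing.unit by rewrite fps_unitE.
have g0 : fcoef g 0 != 0.
  by move: f0; rewrite fE fcoefD fcoefXnM addr0 /= fmorph_eq0.
have Ug : g \is a GRing.unit by rewrite fps_unitE.
pose gi := map_fps iota g; have Ugi : gi \is a GRing.unit by apply: rmorph_unit.
apply/asboolP; exists g^-1, (- h * gi^-1 * f^-1).
rewrite rmorphV //; apply: (mulrI Uf); rewrite mulrV //.
have giE : gi = f - fpsX ^+ m.+1 * h by rewrite {1}fE addrK.
transitivity ((f - fpsX ^+ m.+1 * h) * gi^-1); first by rewrite -giE mulrV.
rewrite mulrBl mulrDr; congr (_ + _).
rewrite -[LHS]mulr1 -(mulrV Uf); ring.
Qed.

End OrderRing.

Section QuadraticOrder.
Variables (k K : finFieldType) (iota : {rmorphism k -> K}) (w : K).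
Variables (beta gam : k).
Hypothesis w_out : forall a, w <> iota a.
Hypothesis w_span : forall z, exists a b, z = iota a + iota b * w.
Hypothesis w_quad : w * w = iota beta * w + iota gam.
Implicit Types (f g h : fps K) (m : nat).
Local Notation R m := (fps_order iota m).

Definition scal : k -> fps K := @fpsC K \o iota.
HB.instance Definition _ := GRing.RMorphism.on scal.

(** An element that spans R_m over k modulo R_(m+1); see order_step. *)
Definition theta m : fps K := fpsX ^+ m * fpsC w.

Lemma fcoef_theta m i : fcoef (theta m) i = if i == m then w else 0.
Proof.
rewrite fcoefXnM /=; have [ltim|ltmi|->] := ltngtP i m; rewrite ?subnn //.
by rewrite subn_eq0 leqNgt ltmi.
Qed.

Lemma theta_mem m : theta m \in R m.
Proof.
apply/orderP => i ltim; exists 0; rewrite fcoef_theta rmorph0.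
by rewrite (ltn_eqF ltim).
Qed.

Lemma theta_notin m : theta m \notin R m.+1.
Proof.
apply/negP => /orderP/(_ m (leqnn _)) [a]; rewrite fcoef_theta eqxx.
exact: w_out.
Qed.

Lemma thetaS m : theta m.+1 = fpsX * theta m.
Proof. by rewrite /theta exprS mulrA. Qed.

Lemma theta_sq m : theta m * theta m = (fpsX ^+ m * scal beta) * theta m + fpsX ^+ m.*2 * scal gam.
Proof.
rewrite /theta /scal /= -addnn exprD.
have -> : fpsX ^+ m * fpsC w * (fpsX ^+ m * fpsC w) = fpsX ^+ m * fpsX ^+ m * fpsC (w * w).
  by rewrite rmorphM; ring.
by rewrite w_quad rmorphD rmorphM; ring.
Qed.

(** A root in k of the quadratic equation of w would force w into k. *)
Lemma w_irr (l : k) : l * l != beta * l + gam.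
Proof.
apply/negP => /eqP lE.
have : (w - iota l) * (w + iota l - iota beta) == 0.
  apply/eqP; transitivity (w * w - iota beta * w - (iota (l * l) - iota beta * iota l)).
    by rewrite rmorphM; ring.
  by rewrite w_quad lE rmorphD rmorphM; ring.
rewrite mulf_eq0 => /orP[|]; first by rewrite subr_eq0 => /eqP/w_out.
by rewrite -addrA addr_eq0 -rmorphB -rmorphN => /eqP/w_out.
Qed.

Lemma order_step m f : f \in R m ->
  exists2 g, g \in R m.+1 & exists a, f = g + scal a * theta m.
Proof.
move=> /orderP fP; have [a [b fm]] := w_span (fcoef f m).
exists (f - scal b * theta m); last by exists b; rewrite subrK.
apply/orderP => i; rewrite ltnS fcoefB fcoefCM fcoef_theta leq_eqVlt.
have [->|nim] := eqVneq i m => /=; first by exists a; rewrite fm addrK.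
by rewrite mulr0 subr0; apply: fP.
Qed.

Lemma order_res m f : (0 < m)%N -> f \in R m -> exists a, fcoef f 0 = iota a.
Proof. by move=> m0 /orderP; apply. Qed.

(** R_m / T R_m has the k-basis 1, theta_m for all m; it is the field K for m
    = 0, and the ring of dual numbers over k for m > 0. *)
Lemma order_modX m f : f \in R m ->
  exists2 g, g \in R m & exists a b, f = scal a + scal b * theta m + fpsX * g.
Proof.
case: m => [|m] fR.
  have [a [b f0]] := w_span (fcoef f 0).
  exists (Fps (fun i => fcoef f i.+1)); first exact: order0.
  exists a, b; rewrite {1}(fps_headtail f) f0 /theta expr0 mul1r /scal /=.
  by rewrite rmorphD rmorphM.
have [a f0] := order_res (ltn0Sn m) fR.
have [g gR [b gE]] := order_step (order_tail fR).
exists g => //; exists a, b.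
by rewrite {1}(fps_headtail f) f0 gE thetaS /scal /=; ring.
Qed.

End QuadraticOrder.

(** * Splitting a coordinate off a lattice *)

Section Lattices.
Variables (k K : finFieldType) (iota : {rmorphism k -> K}) (w : K).
Variables (beta gam : k).
Hypothesis w_out : forall a, w <> iota a.
Hypothesis w_span : forall z, exists a b, z = iota a + iota b * w.
Hypothesis w_quad : w * w = iota beta * w + iota gam.
Variable n : nat.
Implicit Types (f g h : fps K) (m d : nat) (l : 'I_n).
Local Notation R m := (fps_order iota m).
Local Notation scal := (scal iota).
Local Notation theta := (theta w).
Local Notation q := #|k|.
Local Notation V := 'rV[fps K]_n.
Implicit Types (L M : set V) (u v : V) (P : 'I_n -> set (fps K)^o).

Definition order_submod m L :=
  L 0 /\ forall f u v, f \in R m -> L u -> L v -> L (f *: u + v).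

Definition box P : set V := [set v | forall l, P l (v 0 l)].

Definition upd P l (S : set (fps K)^o) : 'I_n -> set (fps K)^o :=
  fun i => if i == l then S else P i.

Definition order_set m : set (fps K)^o := [set f | f \in R m].
(** The maximal ideal of R_m is T R_(m-1) for m > 0 and T R_0 for m = 0; the
    truncated predecessor covers both. *)
Definition max_ideal m : set (fps K)^o := [set f | exists2 g, g \in R m.-1 & f = fpsX * g].

Lemma scal_mem m a : scal a \in R m. Proof. exact: orderC. Qed.

Lemma order_submod_ksub m L : order_submod m L -> ksub scal L.
Proof. by move=> [L0 Lm]; split=> // a u v Lu Lv; apply: Lm => //; apply: scal_mem. Qed.

Lemma order_submodZ m L f u : order_submod m L -> f \in R m -> L u -> L (f *: u).
Proof. by move=> [L0 Lm] fR Lu; rewrite -[_ *: _]addr0; apply: Lm. Qed.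

Lemma order_submodD m L u v : order_submod m L -> L u -> L v -> L (u + v).
Proof. by move=> /order_submod_ksub; apply: ksubD. Qed.

Lemma order_submodB m L u v : order_submod m L -> L u -> L v -> L (u - v).
Proof. by move=> /order_submod_ksub; apply: ksubB. Qed.

Lemma order_submodI m L M : order_submod m L -> order_submod m M -> order_submod m (L `&` M).
Proof.
move=> [L0 Lm] [M0 Mm]; split=> // f u v fR [Lu Mu] [Lv Mv].
by split; [apply: Lm|apply: Mm].
Qed.

Lemma order_submod_box m P : (forall l, P l 0) ->
  (forall l f g h, f \in R m -> P l g -> P l h -> P l (f * g + h)) ->
  order_submod m (box P).
Proof.
move=> P0 Pm; split=> [l|f u v fR Pu Pv l]; first by rewrite mxE.
by rewrite !mxE; apply: Pm.
Qed.

Lemma upd_id P l : upd P l (P l) = P.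
Proof. by apply/funext => i; rewrite /upd; case: eqP => // ->. Qed.

Lemma ksub_box P : (forall l, ksub scal (P l)) -> ksub scal (box P).
Proof.
move=> kP; split=> [l|a u v Pu Pv l]; rewrite !mxE; first exact: ksub0 (kP l).
exact: (kP l).2.
Qed.

Lemma idx_upd P l S S' d : (forall i, ksub scal (P i)) -> ksub scal S ->
  idx scal d S S' -> idx scal d (box (upd P l S)) (box (upd P l S')).
Proof.
move=> kP; elim: d S => [S _ <- //|d IH S kS /idxS[a [S'a nSa id]]].
apply: (@idx_cons _ _ _ _ _ _ _ (a *: delta_mx 0 l)).
- move=> i; rewrite !mxE eqxx /upd /=; case: eqP => [_|_]; first by rewrite mulr1.
  by rewrite mulr0; apply: ksub0 (kP i).
- by move=> /(_ l); rewrite !mxE !eqxx mulr1 /upd eqxx.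
suff -> : adj scal (box (upd P l S)) (a *: delta_mx 0 l) = box (upd P l (adj scal S a)).
  by apply: IH => //; apply: adj_ksub.
apply/predeqP => v; split=> [[b Pv] i|Pv].
  have := Pv i; rewrite !mxE eqxx /upd /=; case: eqP => [il|_].
    by rewrite mulr1 il => Sv; exists b.
  by rewrite !mulr0 subr0.
have := Pv l; rewrite /upd eqxx => -[b Sb]; exists b => i.
have := Pv i; rewrite !mxE eqxx /upd /=; case: eqP => [il|_].
  by rewrite mulr1 il.
by rewrite !mulr0 subr0.
Qed.

Lemma idx_box P P' (c : 'I_n -> nat) (s : seq 'I_n) : uniq s ->
  (forall i, ksub scal (P i)) -> (forall i, ksub scal (P' i)) ->
  (forall i, i \in s -> idx scal (c i) (P i) (P' i)) ->
  (forall i, i \notin s -> P i = P' i) ->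
  idx scal (\sum_(i <- s) c i) (box P) (box P').
Proof.
elim: s P => [|l s IH] P us kP kP' cP nP.
  rewrite big_nil; suff -> : P = P' by [].
  by apply/funext => i; apply: nP.
move: us => /= /andP[ls us]; rewrite big_cons.
have h : idx scal (c l) (box P) (box (upd P l (P' l))).
  by rewrite -{1}(upd_id P l); apply: idx_upd => //; apply: cP; rewrite mem_head.
apply: (idx_trans (ksub_box kP) h); apply: IH => // [i|i si|i si].
- by rewrite /upd; case: eqP.
- rewrite /upd; case: eqP => [il|_]; first by rewrite -il si in ls.
  by apply: cP; rewrite inE si orbT.
rewrite /upd; case: eqP => [-> //|/eqP il]; apply: nP.
by rewrite inE negb_or il.
Qed.

Lemma idx_max_ideal0 : idx scal 2 (max_ideal 0) (order_set 0).
Proof.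
have kms : ksub scal (max_ideal 0).
  split; first by exists 0; rewrite ?mulr0 ?order0.
  move=> a u v [g _ ->] [g' _ ->]; exists (scal a * g + g'); first exact: order0.
  by rewrite mulrDr mulrCA.
apply: (@idx_cons _ _ _ _ _ _ _ 1); first exact: order0.
  move=> [g _] /(congr1 (fun F : fps K => fcoef F 0)); rewrite fcoefXM /=.
  by move/eqP; rewrite oner_eq0.
apply: (@idx1 _ _ _ _ _ _ (fpsC w : (fps K)^o)); first exact: order0.
  move=> [a [g _]] /(congr1 (fun F : fps K => fcoef F 0)).
  rewrite fcoefXM fcoefB fcoefCM /= mulr1 => /eqP; rewrite subr_eq0 => /eqP.
  exact: w_out.
apply/predeqP => f; split=> [_|_]; first exact: order0.
have [g gR [a [b fE]]] := order_modX w_span (order0 iota f).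
exists b, a, g; first exact: order0.
by rewrite fE /theta expr0 mul1r /GRing.scale /=; ring.
Qed.

Lemma idx_max_idealS m : idx scal 1 (max_ideal m.+1) (order_set m.+1).
Proof.
apply: (@idx1 _ _ _ _ _ _ 1); first by rewrite /order_set /= rpred1.
  move=> [g _] /(congr1 (fun F : fps K => fcoef F 0)); rewrite fcoefXM /=.
  by move/eqP; rewrite oner_eq0.
apply/predeqP => f; split=> [[a [g gR]] /eqP|fR].
  rewrite subr_eq => /eqP ->; rewrite /order_set /= rpredD //; first exact: order_XM.
  by rewrite /GRing.scale /= mulr1 scal_mem.
have [a f0] := order_res (ltn0Sn m) fR.
exists a, (Fps (fun i => fcoef f i.+1)); first exact: order_tail fR.
by rewrite {1}(fps_headtail f) f0 /GRing.scale /= mulr1 addrC addKr.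
Qed.

Definition T_order m : set (fps K)^o := [set f | exists2 g, g \in R m & f = fpsX * g].

Lemma idx_T_order m : idx scal 2 (T_order m) (order_set m).
Proof.
have kXs : ksub scal (T_order m).
  split; first by exists 0; rewrite ?mulr0 ?rpred0.
  move=> a u v [g gR ->] [g' gR' ->]; exists (scal a * g + g').
    by rewrite rpredD // rpredM // scal_mem.
  by rewrite mulrDr mulrCA.
apply: (@idx_cons _ _ _ _ _ _ _ 1); first by rewrite /order_set /= rpred1.
  move=> [g _] /(congr1 (fun F : fps K => fcoef F 0)); rewrite fcoefXM /=.
  by move/eqP; rewrite oner_eq0.
apply: (@idx1 _ _ _ _ _ _ (theta m : (fps K)^o)); first exact: theta_mem.
  move=> [a [g gR]] /eqP; rewrite subr_eq => /eqP thE.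
  have := theta_notin w_out m; rewrite thE /GRing.scale /= mulr1 => /negP; apply.
  by rewrite rpredD ?scal_mem //; apply: order_XM.
apply/predeqP => f; split=> [[b [a [g gR]]]|fR].
  move=> /eqP; rewrite !subr_eq => /eqP ->; rewrite /GRing.scale /= mulr1.
  rewrite /order_set /=; apply: rpredD; last by apply: rpredM; [exact: scal_mem|exact: theta_mem].
  by apply: rpredD; [apply: rpredM => //; exact: orderX|exact: scal_mem].
have [g gR [a [b fE]]] := order_modX w_span fR.
by exists b, a, g => //; rewrite fE /GRing.scale /=; ring.
Qed.

Section Split.
Variables (m d : nat) (P : 'I_n -> set (fps K)^o) (l : 'I_n).
Hypothesis Pl : P l = [set 0].
Hypothesis P0 : forall i, P i 0.
Hypothesis Pm : forall i f g h, f \in R m -> P i g -> P i h -> P i (f * g + h).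
Local Notation e := (delta_mx 0 l : V).
Local Notation M := (box (upd P l (order_set m))).
Local Notation M0 := (box (upd P l (max_ideal m))).
Local Notation M' := (box P).

Definition glue L' v : set V :=
  [set u | exists f v', [/\ f \in R m, L' v' & u = f *: (e + v) + v']].

Lemma rest_submod : order_submod m M'. Proof. exact: order_submod_box. Qed.

Lemma rest_coord v : M' v -> v 0 l = 0. Proof. by move=> /(_ l); rewrite Pl. Qed.

Lemma full_submod : order_submod m M.
Proof.
apply: order_submod_box => [i|i f g h fR]; rewrite /upd; case: eqP => // _.
  by rewrite /order_set /= rpred0.
  by rewrite /order_set /= => gR hR; rewrite rpredD ?rpredM.
exact: Pm.
Qed.

Lemma rest_full v : M' v -> M v.
Proof.
move=> M'v i; rewrite /upd; case: eqP => [->|_]; last exact: M'v.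
by rewrite rest_coord // /order_set /= rpred0.
Qed.

Lemma basis_full : M e.
Proof.
move=> i; rewrite mxE eqxx /upd; case: eqP => [_|_] /=; last exact: P0.
by rewrite /order_set /= rpred1.
Qed.

Lemma coord_e v : M' v -> (e + v) 0 l = 1.
Proof. by move=> /rest_coord vl; rewrite !mxE !eqxx vl addr0. Qed.

Lemma M_split u v : M u -> M' v -> M' (u - u 0 l *: (e + v)).
Proof.
move=> Mu M'v; have ulR : u 0 l \in R m by have := Mu l; rewrite /upd eqxx.
move=> i; rewrite !mxE eqxx /=; have := Mu i; rewrite /upd.
case: eqP => [->|/eqP nil] Pu.
  by rewrite Pl /= (rest_coord M'v) addr0 mulr1 subrr.
have := Pm ulR (M'v i) (P0 i); rewrite addr0 add0r => Puv.
have := Pm (g := u 0 l * v 0 i) _ Puv Pu => /(_ (-1)).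
by rewrite rpredN1 mulN1r addrC => /(_ isT).
Qed.

Lemma glue_submod L' v : order_submod m L' -> order_submod m (glue L' v).
Proof.
move=> oL; split.
  by exists 0, 0; rewrite scale0r addr0 rpred0; split=> //; case: oL.
move=> f _ _ fR [g [v1 [gR Lv1 ->]]] [h [v2 [hR Lv2 ->]]].
exists (f * g + h), (f *: v1 + v2); split; first by rewrite rpredD ?rpredM.
  exact: oL.2.
by rewrite scalerDr scalerDl scalerA addrACA.
Qed.

Lemma glue_I L' v : order_submod m L' -> L' `<=` M' -> M' v -> glue L' v `&` M' = L'.
Proof.
move=> oL LM M'v; apply/predeqP => u; split=> [[[f [v' [fR Lv' ->]]]]|Lu].
  move=> /rest_coord; rewrite mxE (rest_coord (LM _ Lv')) addr0 mxE coord_e // mulr1 => ->.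
  by rewrite scale0r add0r.
split; last exact: LM.
by exists 0, u; rewrite scale0r add0r rpred0.
Qed.

Lemma glue_mem L' v : order_submod m L' -> glue L' v (e + v).
Proof. by move=> [L0 _]; exists 1, 0; rewrite scale1r addr0 rpred1. Qed.

Lemma glue_sadd L' v : order_submod m L' -> L' `<=` M' -> M' v -> sadd (glue L' v) M' = M.
Proof.
move=> oL LM M'v; apply/predeqP => u; split.
  move=> [_ [u2 [[f [v' [fR Lv' ->]]] M'u2 ->]]].
  apply: (order_submodD full_submod); last exact: rest_full.
  apply: (order_submodD full_submod); last by apply/rest_full/LM.
  apply: (order_submodZ full_submod) => //; apply: (order_submodD full_submod);
    last exact: rest_full.
  exact: basis_full.
move=> Mu; exists (u 0 l *: (e + v)), (u - u 0 l *: (e + v)).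
split; last by rewrite addrC subrK.
  exists (u 0 l), 0; rewrite addr0; split=> //; last by case: oL.
  by have := Mu l; rewrite /upd eqxx.
exact: M_split.
Qed.

(** Some vector of L has a unit at the coordinate l, as R_m is local; it is
    scaled to e + v. Subtracting multiples of it brings any other vector of L
    into M'. *)
Lemma split_struct L : order_submod m L -> L `<=` M -> ~ L `<=` M0 ->
  exists2 v, M' v & L = glue (L `&` M') v.
Proof.
move=> oL LM nLM.
have [u [Lu nu]] : exists u, L u /\ ~ M0 u.
  by apply: contrapT => h; apply: nLM => u Lu; apply: contrapT => nu; apply: h; exists u.
have Mu := LM _ Lu.
have ulR : u 0 l \in R m by have := Mu l; rewrite /upd eqxx.
have u0 : fcoef (u 0 l) 0 != 0.
  apply/eqP => u0; apply: nu => i; have := Mu i; rewrite /upd.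
  case: eqP => [-> _|//]; exists (Fps (fun i => fcoef (u 0 l) i.+1)).
    exact: order_tail.
  by rewrite {1}(fps_headtail (u 0 l)) u0 rmorph0 add0r.
have Uu : u 0 l \is a GRing.unit by rewrite fps_unitE.
have iR := order_inv ulR u0.
pose v := (u 0 l)^-1 *: u - e.
have ev : e + v = (u 0 l)^-1 *: u by rewrite addrC subrK.
have Lev : L (e + v) by rewrite ev; apply: (order_submodZ oL).
have M'v : M' v.
  have Mev := LM _ Lev; have M'0 : M' 0 by case: rest_submod.
  have := M_split Mev M'0; rewrite addr0 {2}ev mxE mulVr // scale1r.
  by rewrite addrC addKr.
exists v => //; apply/predeqP => u2; split=> [Lu2|].
  have Mu2 := LM _ Lu2; have u2R : u2 0 l \in R m by have := Mu2 l; rewrite /upd eqxx.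
  exists (u2 0 l), (u2 - u2 0 l *: (e + v)); split=> //; last by rewrite addrC subrK.
  split; last exact: M_split.
  by apply: (order_submodB oL) => //; apply: (order_submodZ oL).
move=> [f [v' [fR [Lv' _] ->]]]; apply: (order_submodD oL) => //; exact: (order_submodZ oL).
Qed.

(** L is given by its intersection L' with M' and by the class of v modulo L',
    and there are q^d classes because L' has the same codimension in M' as L
    in M. The predicates st and st' stand for a further condition on L that
    can be read off from L'. *)
Lemma count_split (st st' : set V -> Prop) N :
  (forall L' v, order_submod m L' -> L' `<=` M' -> M' v -> st (glue L' v) <-> st' L') ->
  has_card [set L | [/\ order_submod m L, idx scal d L M' & st' L]] N ->
  has_card [set L | [/\ order_submod m L, idx scal d L M & st L] /\ ~ L `<=` M0] (N * q ^ d)%N.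
Proof.
move=> stP cN; have kM' := order_submod_ksub rest_submod.
apply: (has_card_fib (f := fun L => L `&` M') cN) => [L [[oL idL stL] nL]|L' [oL' idL' stL']].
  have [v M'v LE] := split_struct oL (idx_sub idL) nL.
  have oL' : order_submod m (L `&` M') by apply: order_submodI => //; exact: rest_submod.
  have L'M : L `&` M' `<=` M' by move=> u [].
  split=> //.
    apply/(idx_iso2 d (order_submod_ksub oL) kM').
    by rewrite {2}LE glue_sadd.
  by apply/(stP _ _ oL' L'M M'v); rewrite -LE.
have kL' := order_submod_ksub oL'; have L'M := idx_sub idL'.
have [s ss [us sM sA sc]] := idx_transv kL' idL'.
exists [seq glue L' v | v <- s]; split.
- rewrite map_inj_in_uniq; first exact: us.
  move=> u v us1 vs1 E; apply: (sA _ _ us1 vs1).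
  have : glue L' v (e + u) by rewrite -E; apply: glue_mem.
  move=> [f [v' [fR Lv' euE]]].
  have := congr1 (fun x : V => x 0 l) euE.
  rewrite (coord_e (sM _ us1)) [RHS]mxE [X in X + _]mxE (coord_e (sM _ vs1)).
  rewrite (rest_coord (L'M _ Lv')) addr0 mulr1 => f1; move: euE; rewrite -f1 scale1r -addrA.
  by move=> /addrI ->; rewrite [v + _]addrC addrK.
- by rewrite size_map.
move=> L; split=> [/mapP[v vs ->]|[[[oL idL stL] nL] LM]] /=.
  have M'v := sM _ vs; have oE := glue_submod v oL'.
  split; last exact: glue_I.
  split; last first.
    move=> /(_ _ (glue_mem v oL')) /(_ l); rewrite /upd eqxx coord_e // => -[g _].
    move=> /(congr1 (fun F : fps K => fcoef F 0)); rewrite fcoefXM /=.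
    by move/eqP; rewrite oner_eq0.
  split=> //; last exact/stP.
  rewrite -(glue_sadd oL' L'M M'v); apply/(idx_iso2 d (order_submod_ksub oE) kM').
  by rewrite glue_I.
have [v M'v LE] := split_struct oL (idx_sub idL) nL; rewrite LM in LE.
have [u us1 Luv] := sc v M'v; apply/mapP; exists u; first exact: us1.
rewrite LE.
apply/predeqP => u2; split=> -[f [v' [fR Lv' ->]]].
  exists f, (f *: (v - u) + v'); split=> //; first exact: oL'.2.
  by rewrite addrA -scalerDr -addrA [u + _]addrC subrK.
exists f, (v' - f *: (v - u)); split=> //.
  by apply: (order_submodB oL') => //; apply: (order_submodZ oL').
by rewrite addrA addrAC -scalerBr opprB addrA [e + v + _]addrAC addrK.
Qed.

End Split.

End Lattices.

(** * Counting lattices by codimension and defect *)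

Lemma cancel_mid (U : zmodType) (a b c d : U) : a + (b + c + d) - c = a + b + d.
Proof. by rewrite -[b + c + d]addrA [c + d]addrC !addrA addrK. Qed.

Section CountLattices.
Variables (k K : finFieldType) (iota : {rmorphism k -> K}) (w : K).
Variables (beta gam : k).
Hypothesis w_out : forall a, w <> iota a.
Hypothesis w_span : forall z, exists a b, z = iota a + iota b * w.
Hypothesis w_quad : w * w = iota beta * w + iota gam.
Variable n : nat.
Implicit Types (f g h : fps K) (m d : nat) (l : 'I_n).
Local Notation R m := (fps_order iota m).
Local Notation scal := (scal iota).
Local Notation theta := (theta w).
Local Notation q := #|k|.
Local Notation V := 'rV[fps K]_n.
Implicit Types (L M : set V) (u v : V) (P : 'I_n -> set (fps K)^o) (I J : {set 'I_n}).
Local Notation order_submod := (order_submod iota).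
Local Notation order_set := (order_set iota).
Local Notation max_ideal := (max_ideal iota).

(** Serves to divide by T, either all coordinates or only one. *)
Lemma has_card_lattice_img m d (phi : V -> V) M1 M2 (st1 st2 : set V -> Prop) N :
  (forall f u v, phi (f *: u + v) = f *: phi u + phi v) -> injective phi ->
  phi @` M1 = M2 -> (forall L, order_submod m L -> st2 (phi @` L) <-> st1 L) ->
  has_card [set L | [/\ order_submod m L, idx scal d L M1 & st1 L]] N ->
  has_card [set L | [/\ order_submod m L, idx scal d L M2 & st2 L]] N.
Proof.
move=> lin inj ME stP; have phi0 : phi 0 = 0.
  by have := lin (-1) 0 0; rewrite scaler0 addr0 scaleN1r addNr.
have linio a u v : phi (scal a *: u + v) = scal a *: phi u + phi v by exact: lin.
have imgK L : L `<=` M2 -> phi @` (phi @^-1` L) = L.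
  move=> LM; apply/predeqP => v; split=> [[u Lu <-] //|Lv].
  by have := LM _ Lv; rewrite -ME => -[u _ uE]; exists u; rewrite /= ?uE.
have preK L : phi @^-1` (phi @` L) = L.
  by apply/predeqP => v; split=> [[u Lu /inj <-] //|Lv]; exists v.
have opre L : order_submod m L -> order_submod m (phi @^-1` L).
  move=> [L0 Lm]; split=> [|f u v fR Lu Lv]; rewrite /preimage /= ?phi0 //.
  by rewrite lin; apply: Lm.
apply: (has_card_bij (f := fun L => phi @^-1` L) (g := fun L => phi @` L)).
- move=> L [oL idL stL]; have oL' := opre _ oL; split; first exact: oL'.
    by apply/(idx_img _ _ _ linio inj); rewrite ME imgK //; apply: idx_sub idL.
  by apply/(stP _ oL'); rewrite imgK //; apply: idx_sub idL.
- move=> L [oL idL stL]; split; last exact: preK.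
  split.
  + split; first by exists 0; [exact: oL.1|exact: phi0].
    move=> f _ _ fR [u Lu <-] [v Lv <-]; exists (f *: u + v); last exact: lin.
    exact: oL.2.
  + by rewrite -ME; apply: (idx_img _ _ _ linio inj).1 idL.
  by apply/(stP _ oL).
by move=> L [oL idL stL]; apply: imgK; apply: idx_sub idL.
Qed.

Definition scaleX v : V := fpsX *: v.

Lemma scaleX_lin f u v : scaleX (f *: u + v) = f *: scaleX u + scaleX v.
Proof. by rewrite /scaleX scalerDr !scalerA mulrC. Qed.

Lemma scaleXD f u v : scaleX (u + f *: v) = scaleX u + f *: scaleX v.
Proof. by rewrite addrC scaleX_lin addrC. Qed.

Lemma scaleX_inj : injective scaleX.
Proof.
move=> u v /matrixP E; apply/matrixP => i j; apply: fpsX_inj.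
by have := E i j; rewrite !mxE.
Qed.

Lemma idx_X d L M : idx scal d L M <-> idx scal d (scaleX @` L) (scaleX @` M).
Proof. by apply: idx_img; [move=> a u v; apply: scaleX_lin|exact: scaleX_inj]. Qed.

Lemma hull_X f L : hull f (scaleX @` L) = scaleX @` (hull f L).
Proof.
apply/predeqP => v; split.
  move=> [_ [_ [[u Lu <-] [u' Lu' <-] ->]]]; exists (u + f *: u'); first by exists u, u'.
  exact: scaleXD.
move=> [_ [u [u' [Lu Lu' ->]]] <-]; exists (scaleX u), (scaleX u').
by split; [exists u|exists u'|exact: scaleXD].
Qed.

Lemma order_submodX m L u : order_submod m L -> L u -> L (fpsX *: u).
Proof. by move=> oL Lu; apply: order_submodZ oL _ Lu; apply: orderX. Qed.

(** R_m = R_(m+1) + k theta_m, and theta_m^2 is a combination of theta_m and 1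
    with coefficients in R_(m+1). *)
Lemma hull_submod m L : order_submod m.+1 L -> order_submod m (hull (theta m) L).
Proof.
move=> oL; have kL := order_submod_ksub oL; split; first by apply: (sub_hull _ kL); case: oL.
have kH := hull_ksub (theta m) kL.
move=> f _ v fR [u [u' [Lu Lu' ->]]] Hv; apply: (ksubD kH) => //.
have [g gR [a ->]] := order_step w_span fR.
have XR j : fpsX ^+ j \in R m.+1 by apply: rpredX; apply: orderX.
exists (g *: u + (scal a * (fpsX ^+ m.*2 * scal gam)) *: u').
exists (scal a *: u + (g + scal a * (fpsX ^+ m * scal beta)) *: u'); split.
- apply: oL.2 => //; apply: (order_submodZ oL) => //.
  by rewrite !rpredM ?XR ?scal_mem.
- apply: oL.2 => //; first exact: scal_mem.
  apply: (order_submodZ oL) => //; apply: rpredD => //.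
  by rewrite !rpredM ?XR ?scal_mem.
have E : (g + scal a * theta m) * theta m = scal a * (fpsX ^+ m.*2 * scal gam)
    + theta m * (g + scal a * (fpsX ^+ m * scal beta)).
  by rewrite mulrDl -mulrA (theta_sq w_quad); ring.
rewrite scalerDr scalerA E (scalerDl u) (scalerDl u' (scal a * (fpsX ^+ m.*2 * scal gam))).
by rewrite scalerDr !scalerA addrACA [theta m * scal a]mulrC.
Qed.

Lemma X_hull m L : order_submod m.+1 L -> scaleX @` (hull (theta m) L) `<=` L.
Proof.
move=> oL _ [_ [u [u' [Lu Lu' ->]]] <-].
rewrite scaleXD /scaleX scalerA [theta m * _]mulrC -thetaS.
by apply: (order_submodD oL); [exact: order_submodX oL Lu|apply: (order_submodZ oL) => //;
  exact: theta_mem].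
Qed.

(** The codimension of an R_m-lattice in the R_(m-1)-lattice that it
    generates. It has to be recorded in the counts because it determines how
    many R_(m+1)-lattices generate a given R_m-lattice. For m > 0 it is the
    number of summands R_m in a decomposition of L into copies of R_0, ...,
    R_m; for m = 0 it is 0 by convention. *)
Definition defect m a L := if m is m'.+1 then idx scal a L (hull (theta m') L) else a = 0%N.

Section HullFibres.
Variables (r : nat) (N : set V).
(* N has rank r. *)
Hypothesis idN : idx scal (2 * r) (scaleX @` N) N.

Lemma ksub_X L : ksub scal L -> ksub scal (scaleX @` L).
Proof.
move=> kL; split; first by exists 0; [exact: kL.1|rewrite /scaleX scaler0].
move=> a _ _ [u Lu <-] [v Lv <-]; exists (scal a *: u + v); first exact: kL.2.
exact: scaleX_lin.
Qed.

Lemma X_sub m' L : order_submod m' L -> scaleX @` L `<=` L.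
Proof. by move=> oL _ [u Lu <-]; apply: order_submodX oL Lu. Qed.

Lemma idx_X_lattice m' d L : order_submod m' L -> idx scal d L N ->
  idx scal (2 * r) (scaleX @` L) L.
Proof.
move=> oL idL; have kL := order_submod_ksub oL; have kXL := ksub_X kL.
have idX := idx_trans kXL ((idx_X d L N).1 idL) idN.
have [c [c' [h1 h2 cE]]] := idx_mid kXL kL idX (X_sub oL) (idx_sub idL).
by rewrite (idx_uniq kL h2 idL) in cE; have -> : (2 * r)%N = c by lia.
Qed.

Lemma defect_exists m d L : order_submod m L -> idx scal d L N -> exists2 b,
  (b < (2 * r).+1)%N & defect m b L.
Proof.
case: m => [|p] oL idL; first by exists 0%N.
have kL := order_submod_ksub oL; have kH := hull_ksub (theta p) kL.
have idXL := idx_X_lattice oL idL.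
have [||c [c' [h1 h2 cE]]] := idx_mid (ksub_X kL) (ksub_X kH) idXL.
- by move=> _ [u Lu <-]; exists u => //; apply: (sub_hull _ kL).
- exact: X_hull.
exists c; last exact/idx_X.
by rewrite ltnS cE leq_addr.
Qed.

(** The maximal ideal of R_(m+1) is T R_m and its residue field is k; so every
    k-subspace between T L and the R_m-lattice L is an R_(m+1)-lattice. *)
Lemma hull_fibreP m d L W c : order_submod m L -> idx scal d L N ->
  [/\ order_submod m.+1 W, idx scal (c + d) W N,
    idx scal c W (hull (theta m) W) & hull (theta m) W = L]
  <-> [/\ ksub scal W, scaleX @` L `<=` W, hull (theta m) W = L & idx scal c W L].
Proof.
move=> oL idL; split=> [[oW idW idc WL]|[kW LW WL idc]].
  split=> //; [exact: order_submod_ksub oW|by rewrite -WL; apply: X_hull|by rewrite -WL].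
split=> //; last by rewrite WL.
  split=> [|f u v fR Wu Wv]; first exact: ksub0 kW.
  have [a f0] := order_res (ltn0Sn m) fR.
  rewrite (fps_headtail f) f0 scalerDl -addrA; apply: kW.2 => //.
  apply: (ksubD kW) => //; apply: LW.
  exists (Fps (fun i => fcoef f i.+1) *: u); last by rewrite /scaleX scalerA.
  apply: (order_submodZ oL); first exact: order_tail fR.
  exact: (idx_sub idc).
exact: idx_trans kW idc idL.
Qed.

(** L / T L has dimension 2r. For m = 0 it is K^r, and W runs over the
    k-subspaces that span it over K. For m > 0, by Nakayama, W + theta_m W = L
    amounts to W + P L = L, where P is the maximal ideal of R_m. Here P L is T
    times the hull of L, so that T L has codimension b in P L, and P L has
    codimension 2r - b in L. *)
Lemma count_hull_fibre m b c d L : order_submod m L -> idx scal d L N -> defect m b L ->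
  has_card [set W | [/\ order_submod m.+1 W, idx scal (c + d) W N,
                       idx scal c W (hull (theta m) W) & hull (theta m) W = L]]
    (fibre_count q m r b c).
Proof.
move=> oL idL stL; have kL := order_submod_ksub oL.
have idX := idx_X_lattice oL idL; have kX := ksub_X kL.
suff : has_card [set W | [/\ ksub scal W, scaleX @` L `<=` W, hull (theta m) W = L
                             & idx scal c W L]] (fibre_count q m r b c).
  by apply: has_card_ext => W; split=> h; apply/(hull_fibreP W c oL idL).
case: m oL stL => [|p] oL stL; rewrite /fibre_count.
  have w_quad0 : theta 0 * theta 0 = scal beta * theta 0 + scal gam.
    by rewrite (theta_sq w_quad) expr0 !mul1r.
  have irr := w_irr w_out w_quad.
  have h1 v : L v -> L (theta 0 *: v) by apply: (order_submodZ oL); exact: order0.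
  have h2 v : (scaleX @` L) v -> (scaleX @` L) (theta 0 *: v).
    move=> [u Lu <-]; exists (theta 0 *: u); first exact: h1.
    by rewrite /scaleX !scalerA mulrC.
  elim: c => [|c IH].
    by rewrite /nforms gbin0 big_ord0; exact: (spanning0 kX idX h1).
  have [n' cn' nE] := count_spanningS w_quad0 irr kX idX h2 h1 IH.
  suff <- : n' = nforms q r c.+1 by [].
  apply/eqP; rewrite -(eqn_pmul2r (_ : 0 < gbin q c.+1 c)%N); last first.
    by apply: gbin_gt0 => //; apply: ltnW; exact: card_finNzRing_gt1.
  by rewrite nE nforms_rec //; exact: card_finNzRing_gt1.
have kH := hull_ksub (theta p) kL; have kXH := ksub_X kH.
pose N' := scaleX @` (hull (theta p) L).
have LN' : scaleX @` L `<=` N' by move=> _ [u Lu <-]; exists u => //; apply: (sub_hull _ kL).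
have N'L : N' `<=` L := X_hull oL.
have idb : idx scal b (scaleX @` L) N' by exact: (idx_X _ _ _).1 stL.
have idr : idx scal (2 * r - b) N' L.
  have [c1 [c2 [h1 h2 cE]]] := idx_mid kX kXH idX LN' N'L.
  by rewrite cE (idx_uniq kX idb h1) addKn.
apply: has_card_ext (count_supplements c kX idb idr) => W /=.
have thL v : L v -> L (theta p.+1 *: v) by apply: (order_submodZ oL); exact: theta_mem.
suff E : ksub scal W -> scaleX @` L `<=` W -> W `<=` L ->
    sadd W N' = L <-> hull (theta p.+1) W = L.
  split=> -[kW LW WE idW]; split=> //; apply/(E kW LW (idx_sub idW)); exact: WE.
move=> kW LW WL.
(* P L = T L + theta L. *)
have N'E v : N' v <-> exists u u', [/\ L u, L u' & v = fpsX *: u + theta p.+1 *: u'].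
  split=> [[_ [u [u' [Lu Lu' ->]]] <-]|[u [u' [Lu Lu' ->]]]].
    by exists u, u'; split=> //; rewrite scaleXD /scaleX scalerA [theta p * _]mulrC -thetaS.
  exists (u + theta p *: u'); first by exists u, u'.
  by rewrite scaleXD /scaleX scalerA [theta p * _]mulrC -thetaS.
split=> WE; apply/seteqP; split.
- by apply: (hull_sub kL WL) => v /WL; exact: thL.
- rewrite -{1}WE => _ [w1 [v [Ww1 /N'E[u [u' [Lu]]] + -> ->]]].
  rewrite -{1}WE => -[w2 [v2 [Ww2 /N'E[u2 [u3 [Lu2 Lu3 ->]]] ->]]].
  (* Nakayama: in L = W + T L + theta L, the last L is replaced by the whole
     sum; this gives L = W + theta W + T L, as theta^2 lies in T R_m. *)
  pose z := u + theta p.+1 *: u2 + (fpsX ^+ p * scal beta * theta p.+1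
    + fpsX ^+ (p.*2.+1) * scal gam) *: u3.
  exists (w1 + fpsX *: z), w2; split=> //.
    apply: (ksubD kW) => //; apply: LW; exists z => //.
    apply: (order_submodD oL); first by apply: (order_submodD oL) => //; apply: thL.
    apply: (order_submodZ oL) => //; have XR j : fpsX ^+ j \in R p.+1 by apply/rpredX/orderX.
    apply: rpredD; last by apply: rpredM; [exact: XR|exact: scal_mem].
    by apply: rpredM; [apply: rpredM; [exact: XR|exact: scal_mem]|exact: theta_mem].
  have E : theta p.+1 * theta p.+1 = fpsX * (fpsX ^+ p * scal beta * theta p.+1
    + fpsX ^+ (p.*2.+1) * scal gam).
    by rewrite (theta_sq w_quad) doubleS !exprS; ring.
  rewrite /z !(scalerDr fpsX) !(scalerDr (theta p.+1)) !scalerA E [theta p.+1 * fpsX]mulrC.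
  move: (fpsX *: u) (theta p.+1 *: w2) (_ *: u2) (_ *: u3) => z1 z2 z3 z4.
  by rewrite -!addrA [z2 + _]addrC -!addrA.
- move=> _ [u [v [Wu N'v ->]]]; apply: (ksubD kL); first exact: WL.
  exact: N'L.
rewrite -{1}WE => _ [u [u' [Wu Wu' ->]]]; exists u, (theta p.+1 *: u'); split=> //.
apply/N'E; exists 0, u'; rewrite scaler0 add0r; split=> //; [exact: ksub0 kL|exact: WL].
Qed.

Lemma defect_uniq m b b' L : order_submod m L -> defect m b L -> defect m b' L -> b = b'.
Proof.
case: m => [_ -> -> //|m oL]; exact: idx_uniq (order_submod_ksub oL).
Qed.

(** The R_(m+1)-lattices are sorted by their hull, and the hulls by their
    defect b. *)
Lemma count_hulls m (cn : nat -> nat -> nat) d c : order_submod m N ->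
  (forall d b, has_card [set L | [/\ order_submod m L, idx scal d L N & defect m b L]] (cn d b)) ->
  has_card [set L | [/\ order_submod m.+1 L, idx scal d L N & defect m.+1 c L]]
    (if (c <= d)%N then \sum_(b < (2 * r).+1) cn (d - c)%N b * fibre_count q m r b c else 0)%N.
Proof.
move=> oN IH; have hull_idx L : order_submod m.+1 L -> idx scal d L N -> defect m.+1 c L ->
    exists2 d', idx scal d' (hull (theta m) L) N & d = (c + d')%N.
  move=> oL idL idc; have kL := order_submod_ksub oL; have LN := idx_sub idL.
  have HN : hull (theta m) L `<=` N.
    apply: (hull_sub (order_submod_ksub oN) LN) => v /LN; apply: (order_submodZ oN);
      exact: theta_mem.
  have [c' [d' [h1 h2 dE]]] := idx_mid kL (hull_ksub (theta m) kL) idL (idx_sub idc) HN.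
  by exists d' => //; rewrite (idx_uniq kL idc h1).
case: leqP => [lecd|ltdc]; last first.
  apply: has_card0 => L [oL idL idc].
  by have [d' _ dE] := hull_idx L oL idL idc; rewrite dE ltnNge leq_addr in ltdc.
pose Q b := [set W | [/\ order_submod m.+1 W, idx scal d W N,
  defect m.+1 c W & defect m b (hull (theta m) W)]].
have cQ b : has_card (Q b) (cn (d - c) b * fibre_count q m r b c)%N.
  apply: (has_card_fib (f := hull (theta m)) (IH (d - c)%N b)) => [W [oW idW idc sb]|L [oL idL sL]].
    have [d' idH dE] := hull_idx W oW idW idc; split=> //; first exact: hull_submod.
    by rewrite dE addKn.
  have := count_hull_fibre c oL idL sL; rewrite subnKC //; apply: has_card_ext => W /=.
  split=> [[oW idW idc WL]|[[oW idW idc sb] WL]]; last by split.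
  by split=> //; split=> //; rewrite WL.
apply: has_card_ext (has_card_sum (N := (2 * r).+1) (fun b _ => cQ b) _) => [W|b b' W _ _] /=.
  split=> [[b _ [oW idW idc sb]]|[oW idW idc]]; first by split.
  have [d' idH dE] := hull_idx W oW idW idc.
  have [b ltb sb] := defect_exists (hull_submod oW) idH.
  by exists b.
move=> [oW _ _ sb] [_ _ _ sb']; exact: defect_uniq (hull_submod oW) sb sb'.
Qed.

End HullFibres.

(** The ambient lattices that occur when the coordinates of R_m^n are split
    off one at a time: those of I are still to be treated, and those of J are
    restricted to the maximal ideal. *)
Definition lat m I J : 'I_n -> set (fps K)^o :=
  fun l => if l \in I then order_set m else if l \in J then max_ideal m else [set 0].

Lemma ksub_max_ideal m : ksub scal (max_ideal m).
Proof.
split; first by exists 0; rewrite ?mulr0 ?rpred0.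
move=> a u v [g gR ->] [g' gR' ->]; exists (scal a * g + g'); last by rewrite mulrDr mulrCA.
by rewrite rpredD // rpredM // scal_mem.
Qed.

Lemma lat0 m I J l : lat m I J l 0.
Proof.
rewrite /lat; case: ifP => _; first exact: rpred0.
by case: ifP => _ //; exists 0; rewrite ?mulr0 ?rpred0.
Qed.

Lemma lat_mod m I J l f g h : f \in R m -> lat m I J l g -> lat m I J l h ->
  lat m I J l (f * g + h).
Proof.
rewrite /lat => fR; case: ifP => _.
  by rewrite /order_set /= => gR hR; rewrite rpredD ?rpredM.
case: ifP => _; last by move=> -> ->; rewrite mulr0 addr0.
move=> [g' gR ->] [h' hR ->]; exists (f * g' + h'); last by rewrite mulrDr mulrCA.
by rewrite rpredD // rpredM // order_pred.
Qed.

Lemma lat_submod m I J : order_submod m (box (lat m I J)).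
Proof. by apply: order_submod_box; [exact: lat0|exact: lat_mod]. Qed.

Lemma ksub_lat m I J l : ksub scal (lat m I J l).
Proof.
split; first exact: lat0.
by move=> a u v Pu Pv; apply: lat_mod => //; apply: scal_mem.
Qed.

Lemma lat_upd m I J l : l \in I -> lat m I J = upd (lat m (I :\ l) J) l (order_set m).
Proof.
move=> Il; apply/funext => i; rewrite /lat /upd !inE.
by case: eqP => [->|]; rewrite ?Il.
Qed.

Lemma lat_upd_ms m I J l : lat m (I :\ l) (l |: J) = upd (lat m (I :\ l) J) l (max_ideal m).
Proof.
by apply/funext => i; rewrite /lat /upd !inE; case: eqP => [->|].
Qed.

Lemma lat_at m I J l : l \notin J -> lat m (I :\ l) J l = [set 0].
Proof. by move=> /negPf Jl; rewrite /lat !inE eqxx Jl. Qed.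

Lemma idx_lat_X m I : idx scal (2 * #|I|) (scaleX @` box (lat m I finset.set0)) (box (lat m I
  finset.set0)).
Proof.
pose P l : set (fps K)^o := if l \in I then T_order iota m else [set 0].
have -> : scaleX @` box (lat m I finset.set0) = box P.
  apply/predeqP => v; split=> [[u Pu <-] l|Pv].
    have := Pu l; rewrite /lat /P !inE mxE; case: ifP => _ uR; first by exists (u 0 l).
    by rewrite uR mulr0.
  have tl g : Fps (fun i => fcoef (fpsX * g : fps K) i.+1) = g.
    by apply: fpsP => j; exact: (fcoefXM g j.+1).
  have tl0 : Fps (fun i => fcoef (0 : fps K) i.+1) = 0 by exact: fpsP.
  pose u : V := \row_l (Fps (fun i => fcoef (v 0 l) i.+1)).
  exists u => [l|]; last first.
    apply/matrixP => i l; rewrite (ord1 i) !mxE; have := Pv l; rewrite /P.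
    case: ifP => _ => [[g gR ->]|->]; first by rewrite tl.
    by rewrite tl0 mulr0.
  have := Pv l; rewrite /lat /P mxE !inE.
  case: ifP => _ => [[g gR ->]|->]; first by rewrite tl.
  by rewrite tl0.
have kP l : ksub scal (P l).
  rewrite /P; case: ifP => _.
    split; first by exists 0; rewrite ?mulr0 ?rpred0.
    move=> a u v [g gR ->] [g' gR' ->]; exists (scal a * g + g'); last by rewrite mulrDr mulrCA.
    by rewrite rpredD // rpredM // scal_mem.
  by split=> // a u v -> ->; rewrite scaler0 addr0.
have := @idx_box _ _ iota n P (lat m I finset.set0) (fun=> 2%N) (enum I) (enum_uniq _) kP
          (ksub_lat m I finset.set0).
rewrite big_const_seq count_predT iter_addn_0 -cardE; apply.
  by move=> l; rewrite mem_enum /P /lat => ->; exact: idx_T_order.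
by move=> l; rewrite mem_enum /P /lat !inE => /negPf ->.
Qed.

(** Gluing e + v adds R_(m+1) (e + v) to the lattice and R_m (e + v) to its
    hull, and R_m / R_(m+1) has dimension 1. *)
Lemma hull_glue_idx m l P L v a :
  P l = [set 0] -> (forall i, P i 0) ->
  (forall i f g h, f \in R m.+1 -> P i g -> P i h -> P i (f * g + h)) ->
  order_submod m.+1 L -> L `<=` box P -> box P v ->
  idx scal a (glue iota m.+1 l L v) (hull (theta m) (glue iota m.+1 l L v)) <->
  exists2 a', a = a'.+1 & idx scal a' L (hull (theta m) L).
Proof.
move=> Pl P0 Pm oL LP Pv; have kL := order_submod_ksub oL.
set E := glue _ _ _ _ _; pose H := hull (theta m) L.
have oE : order_submod m.+1 E by apply: glue_submod.
have kE := order_submod_ksub oE; have kH : ksub scal H := hull_ksub (theta m) kL.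
pose e : V := delta_mx 0 l + v.
have Ee : E e by apply: glue_mem.
have el : e 0 l = 1 by apply: coord_e Pv.
have cD (u1 u2 : V) : (u1 + u2) 0 l = u1 0 l + u2 0 l by rewrite mxE.
have cZ f (u : V) : (f *: u) 0 l = f * u 0 l by rewrite mxE.
have Ll u : L u -> u 0 l = 0 by move=> /LP; apply: rest_coord.
have Hl u : H u -> u 0 l = 0.
  by move=> [u1 [u2 [L1 L2 ->]]]; rewrite cD cZ !Ll // mulr0 addr0.
have EH : E `&` H = L.
  apply/predeqP => u; split=> [[[f [v' [fR Lv' ->]]] /Hl]|Lu].
    by rewrite -/e cD cZ el (Ll _ Lv') addr0 mulr1 => ->; rewrite scale0r add0r.
  split; last exact: (sub_hull _ kL).
  by exists 0, u; rewrite scale0r add0r rpred0.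
have iso a' : idx scal a' L H <-> idx scal a' E (sadd E H).
  by rewrite -{1}EH; exact: idx_iso2.
have kEH := ksub_sadd kE kH.
have E_EH : E `<=` sadd E H.
  by move=> u Eu; exists u, 0; rewrite addr0; split=> //; exact: ksub0 kH.
have LE : L `<=` E by move=> u Lu; exists 0, u; rewrite scale0r add0r rpred0.
have kHE := hull_ksub (theta m) kE.
have EH_HE : sadd E H `<=` hull (theta m) E.
  move=> _ [u1 [u2 [Eu [v1 [v2 [Lv1 Lv2 ->]]] ->]]].
  exists (u1 + v1), v2; split; [|exact: LE|by rewrite addrA].
  by apply: (ksubD kE) => //; exact: LE.
have step : idx scal 1 (sadd E H) (hull (theta m) E).
  apply: (@idx1 _ _ _ _ _ _ (theta m *: e)); first exact: hull_scale kE Ee.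
    move=> [_ [u2 [[f [v' [fR Lv' ->]]] Hu2 thE]]].
    have := congr1 (fun x : V => x 0 l) thE.
    rewrite -/e !cD !cZ el (Hl _ Hu2) (Ll _ Lv') !addr0 !mulr1 => thf.
    by have := theta_notin w_out m; rewrite thf fR.
  apply/seteqP; split; first by apply: (adj_sub kHE EH_HE); exact: hull_scale kE Ee.
  move=> _ [u1 [_ [Eu1 [f [v' [fR Lv' ->]]] ->]]].
  have thfR : theta m * f \in R m.
    by apply: rpredM; [exact: theta_mem|exact: (order_pred fR)].
  have [g gR [b gE]] := order_step w_span thfR.
  exists b; exists (u1 + g *: e), (theta m *: v'); split.
  - by apply: (ksubD kE); [exact: Eu1|exact: order_submodZ oE gR Ee].
  - exact: hull_scale kL Lv'.
  rewrite scalerDr scalerA gE scalerDl -!scalerA.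
  exact: cancel_mid.
split=> [idE|[a' -> idL]]; last first.
  by have := idx_trans kE ((iso a').1 idL) step; rewrite addn1.
have [c [c' [h1 h2 aE]]] := idx_mid kE kEH idE E_EH EH_HE.
have c1 := idx_uniq kEH h2 step; exists c; last exact/iso.
by rewrite aE c1 addn1.
Qed.

Lemma defect_glue m l P L v a :
  P l = [set 0] -> (forall i, P i 0) ->
  (forall i f g h, f \in R m -> P i g -> P i h -> P i (f * g + h)) ->
  order_submod m L -> L `<=` box P -> box P v ->
  defect m a (glue iota m l L v) <->
  if m is 0 then a = 0%N else exists2 a', a = a'.+1 & defect m a' L.
Proof. by case: m => [|m] // Pl P0 Pm oL LP Pv; exact: (hull_glue_idx a Pl P0 Pm oL LP Pv). Qed.

(** The degree over k of the residue field of R_m. *)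
Definition resdeg m : nat := if m is 0 then 2%N else 1%N.

Lemma idx_lat_max m I J l : l \in I ->
  idx scal (resdeg m) (box (lat m (I :\ l) (l |: J))) (box (lat m I J)).
Proof.
move=> Il; rewrite (lat_upd m J Il) lat_upd_ms; apply: idx_upd.
- exact: ksub_lat.
- exact: ksub_max_ideal.
by case: m => [|m]; [exact: idx_max_ideal0|exact: idx_max_idealS].
Qed.

(** The first count is that of the lattices with only nonunits at the
    coordinate l; the others are glued from lattices without this
    coordinate. *)
Lemma count_lat_split m I J l d a N1 N2 : l \in I -> l \notin J ->
  has_card [set L | [/\ (resdeg m <= d)%N, order_submod m L,
    idx scal (d - resdeg m) L (box (lat m (I :\ l) (l |: J))) & defect m a L]] N1 ->
  has_card [set L | [/\ order_submod m L, idx scal d L (box (lat m (I :\ l) J))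
    & if m is 0 then a = 0%N else exists2 a', a = a'.+1 & defect m a' L]] N2 ->
  has_card [set L | [/\ order_submod m L, idx scal d L (box (lat m I J)) & defect m a L]]
    (N1 + N2 * q ^ d)%N.
Proof.
move=> Il Jl c1 c2; have Pl := lat_at m I Jl.
have idf := idx_lat_max m J Il.
have oM0 := lat_submod m (I :\ l) (l |: J); have kM0 := order_submod_ksub oM0.
have c3 := count_split (st := defect m a) Pl (lat0 m _ _) (@lat_mod m _ _) _ c2.
rewrite -lat_upd // -lat_upd_ms in c3.
have {}c3 := c3 (fun L' v oL' LP Pv => defect_glue a Pl (lat0 m _ _) (@lat_mod m _ _) oL' LP Pv).
apply: has_card_ext (has_cardU c1 c3 _) => L /=; last by move=> [_ _ /idx_sub LM _] [_].
split=> [[[fd oL idL sL]|[[oL idL sL] _]]|[oL idL sL]]; try by split.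
  split=> //; rewrite -(subnK fd); exact: idx_trans (order_submod_ksub oL) idL idf.
have [LM|nLM] := pselect (L `<=` box (lat m (I :\ l) (l |: J))); last by right.
left; have [c [c' [h1 h2 ->]]] := idx_mid (order_submod_ksub oL) kM0 idL LM (idx_sub idf).
by rewrite (idx_uniq kM0 idf h2) leq_addl addnK.
Qed.

Definition scale_at l (v : V) : V := \row_i (if i == l then fpsX * v 0 i else v 0 i).

(** Over R_0 = K[[T]], restricting the coordinate l to the maximal ideal gives
    a lattice isomorphic to the full one, by scale_at; so the splitting of a
    single coordinate is a recursion in n and d. *)
Lemma count_lat0 i I d : #|I| = i ->
  has_card [set L | [/\ order_submod 0 L, idx scal d L (box (lat 0 I finset.set0)) & defect 0 0 L]]
    (count0 q i d).
Proof.
elim: i I d => [|i IHi] I d.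
  move/eqP; rewrite cards_eq0 => /eqP ->; have oM := lat_submod 0 finset.set0 finset.set0.
  set M := box _ in oM *.
  have M0 v : M v -> v = 0.
    by move=> Mv; apply/matrixP => a l; rewrite (ord1 a) mxE; have := Mv l; rewrite /lat !inE.
  case: d => [|d] /=; last first.
    by apply: has_card0 => L [[L0 _] [e [/M0 -> nL0 _]]].
  by apply: (@has_card1 _ _ M) => [|L [_ -> _]].
move=> cI; have [l Il] : exists l, l \in I by apply/card_gt0P; rewrite cI.
have cIl : #|I :\ l| = i by move: cI; rewrite (cardsD1 l) Il => -[].
have lin f u v : scale_at l (f *: u + v) = f *: scale_at l u + scale_at l v.
  by apply/matrixP => a j; rewrite !mxE; case: ifP => _ //; ring.
have inj : injective (scale_at l).
  move=> u v /matrixP E; apply/matrixP => a j; rewrite (ord1 a).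
  by have := E 0 j; rewrite !mxE; case: ifP => _ // /fpsX_inj.
have img : scale_at l @` box (lat 0 I finset.set0) = box (lat 0 (I :\ l) (l |: finset.set0)).
  apply/predeqP => v; split=> [[u Pu <-] j|Pv].
    have := Pu j; rewrite /lat !inE mxE; case: eqP => [->|_] /=.
      by rewrite Il => _; exists (u 0 l); first exact: order0.
    by [].
  exists (\row_j (if j == l then Fps (fun a => fcoef (v 0 j) a.+1) else v 0 j)) => [j|].
    have := Pv j; rewrite /lat !inE mxE; case: eqP => [->|_] /=.
      by rewrite Il => _; exact: order0.
    by [].
  apply/matrixP => a j; rewrite (ord1 a) !mxE; case: eqP => [->|//].
  have := Pv l; rewrite /lat !inE eqxx /= => -[g _ ->]; congr (_ * _).
  by apply: fpsP => b; exact: (fcoefXM g b.+1).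
elim/ltn_ind: d => d IHd.
have c2 : has_card [set L | [/\ order_submod 0 L, idx scal d L (box (lat 0 (I :\ l) finset.set0))
    & 0%N = 0%N]] (count0 q i d) by exact: IHi.
suff c1 : has_card [set L | [/\ (2 <= d)%N, order_submod 0 L,
    idx scal (d - 2) L (box (lat 0 (I :\ l) (l |: finset.set0))) & defect 0 0 L]]
    (if d is d'.+2 then count0 q i.+1 d' else 0%N).
  have nl : l \notin (finset.set0 : {set 'I_n}) by rewrite inE.
  have := count_lat_split (m := 0) (a := 0) Il nl c1 c2; rewrite addnC.
  by case: (d).
case: d IHd {c2} => [|[|d]] IHd; try by apply: has_card0 => L [].
have stE L : order_submod 0 L -> defect 0 0 (scale_at l @` L) <-> defect 0 0 L by [].
have := has_card_lattice_img lin inj img stE (IHd d (leqnSn _)).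
by rewrite !subSS subn0; apply: has_card_ext => L /=; split=> -[].
Qed.

(** The link between the two steps of the recursion: once all coordinates are
    restricted to the maximal ideal of R_(m+1), the ambient lattice is T
    R_m^J, and its R_(m+1)-sublattices can be sorted by their hulls. *)
Lemma lat_max m J : scaleX @` box (lat m J finset.set0) = box (lat m.+1 finset.set0 J).
Proof.
apply/predeqP => v; split=> [[u Pu <-] j|Pv].
  have := Pu j; rewrite /lat !inE mxE; case: ifP => _ uR; first by exists (u 0 j).
  by rewrite uR mulr0.
exists (\row_j Fps (fun a => fcoef (v 0 j) a.+1)) => [j|].
  have := Pv j; rewrite /lat !inE mxE; case: ifP => _ => [[g gR ->]|->]; last exact: fpsP.
  suff -> : Fps (fun a => fcoef (fpsX * g) a.+1) = g by [].
  by apply: fpsP => b; exact: (fcoefXM g b.+1).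
apply/matrixP => a j; rewrite (ord1 a) !mxE; have := Pv j; rewrite /lat !inE.
case: ifP => _ => [[g _ ->]|->].
  by congr (_ * _); apply: fpsP => b; exact: (fcoefXM g b.+1).
have -> : Fps (fun a => fcoef (0 : fps K) a.+1) = 0 by exact: fpsP.
by rewrite mulr0.
Qed.

Lemma count_lat_IJ m (base : nat -> nat -> nat -> nat) :
  (forall J d a, has_card [set L | [/\ order_submod m.+1 L,
     idx scal d L (box (lat m.+1 finset.set0 J)) & defect m.+1 a L]] (base #|J| d a)) ->
  forall i I J d a, #|I| = i -> I :&: J = finset.set0 ->
  has_card [set L | [/\ order_submod m.+1 L, idx scal d L (box (lat m.+1 I J)) & defect m.+1 a L]]
    (split_count q base i #|J| d a).
Proof.
move=> cbase; elim=> [|i IH] I J d a cI IJ0.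
  by move/eqP: cI; rewrite cards_eq0 => /eqP ->; exact: cbase.
have [l Il] : exists l, l \in I by apply/card_gt0P; rewrite cI.
have cIl : #|I :\ l| = i by move: cI; rewrite (cardsD1 l) Il => -[].
have lJ : l \notin J.
  by apply/negP => Jl; have := finset.in_set0 l; rewrite -IJ0 inE Il Jl.
have IlJ : (I :\ l) :&: J = finset.set0.
  apply/setP => j; have := finset.in_set0 j; rewrite -{1}IJ0 !inE => h.
  by rewrite -andbA h andbF.
have IllJ : (I :\ l) :&: (l |: J) = finset.set0.
  apply/setP => j; have := finset.in_set0 j; rewrite -{1}IJ0 !inE => h.
  by case: eqP => //= _; rewrite h.
have cJ : #|l |: J| = #|J|.+1 by rewrite cardsU1 lJ.
have c1 : has_card [set L | [/\ (resdeg m.+1 <= d)%N, order_submod m.+1 L,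
    idx scal (d - resdeg m.+1) L (box (lat m.+1 (I :\ l) (l |: J))) & defect m.+1 a L]]
    (if d is d'.+1 then split_count q base i #|J|.+1 d' a else 0%N).
  case: d => [|d]; first by apply: has_card0 => L [].
  rewrite -cJ; apply: has_card_ext (IH _ _ d a cIl IllJ) => L /=.
  by rewrite subSS subn0; split=> -[].
have c2 : has_card [set L | [/\ order_submod m.+1 L, idx scal d L (box (lat m.+1 (I :\ l) J))
    & exists2 a', a = a'.+1 & defect m.+1 a' L]]
    (if a is a'.+1 then split_count q base i #|J| d a' else 0%N).
  case: a {c1} => [|a]; first by apply: has_card0 => L [_ _ []].
  apply: has_card_ext (IH _ _ d a cIl IlJ) => L /=.
  by split=> [[oL idL sL]|[oL idL [a' [<-]]]]; split=> //; exists a.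
have := count_lat_split Il lJ c1 c2 => /=; case: (a) => //.
Qed.

Theorem count_lattices m I d b :
  has_card [set L | [/\ order_submod m L, idx scal d L (box (lat m I finset.set0)) & defect m b L]]
    (lattice_count q m #|I| d b).
Proof.
elim: m I d b => [|m IH] I d b.
  case: b => [|b]; first exact: count_lat0.
  by apply: has_card0 => L [].
have base J d' a : has_card [set L | [/\ order_submod m.+1 L,
     idx scal d' L (box (lat m.+1 finset.set0 J)) & defect m.+1 a L]]
     (hull_count q m (lattice_count q m) #|J| d' a).
  have lin f u v := scaleX_lin f u v.
  apply: (has_card_lattice_img lin scaleX_inj (lat_max m J) (st1 := defect m.+1 a)).
    by move=> L oL; rewrite /defect hull_X; apply: iff_sym; exact: idx_X.
  exact: (count_hulls (idx_lat_X m J) d' a (lat_submod m J finset.set0) (IH J)).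
have := count_lat_IJ base (i := #|I|) (J := finset.set0) d b erefl; rewrite cards0; apply.
by apply/setP => j; rewrite !inE andbF.
Qed.

End CountLattices.

(** * q-series identities *)

Arguments gbin : simpl never.
Arguments poch : simpl never.

Section QSeries.
Variables (A : comNzRingType) (q : nat).
Hypothesis q_gt1 : (1 < q)%N.
Implicit Types (a b c t x y z : A) (n j k : nat).
Local Notation Q := (q%:R : A).
Local Notation gb n k := ((gbin q n k)%:R : A).

Lemma poch0 a x : poch a x 0 = 1. Proof. by rewrite /poch big_ord0. Qed.

Lemma pochS a x n : poch a x n.+1 = poch a x n * (1 - a * x ^+ n).
Proof. by rewrite /poch big_ord_recr. Qed.

Lemma poch_add a x n k : poch a x (n + k) = poch a x n * poch (a * x ^+ n) x k.
Proof.
elim: k => [|k IH]; first by rewrite addn0 poch0 mulr1.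
by rewrite addnS !pochS IH mulrA exprD mulrA.
Qed.

Lemma poch0l x n : poch 0 x n = 1.
Proof. by elim: n => [|n IH]; rewrite ?poch0 // pochS IH mul0r subr0 mulr1. Qed.

Lemma gbS n k : gb n.+1 k.+1 = gb n k.+1 + Q ^+ (n - k) * gb n k.
Proof. by rewrite gbinS natrD natrM natrX. Qed.

Lemma gbS' n k : gb n.+1 k.+1 = Q ^+ k.+1 * gb n k.+1 + gb n k.
Proof. by rewrite gbinS' // natrD natrM natrX. Qed.

Lemma gb_gt n : gb n n.+1 = 0.
Proof. by rewrite gbin_small. Qed.

Lemma sum_gbS n (F : nat -> A) : \sum_(c < n.+2) gb n.+1 c * F c =
  \sum_(c < n.+1) gb n c * F c + \sum_(c < n.+1) Q ^+ (n - c) * gb n c * F c.+1.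
Proof.
rewrite big_ord_recl [\sum_(c < n.+1) gb n c * F c]big_ord_recl !gbin0 -addrA.
congr (_ + _); under eq_bigr do rewrite /= /bump /= add1n gbS mulrDl.
rewrite big_split /=; congr (_ + _); rewrite big_ord_recr /= gb_gt mul0r addr0.
by apply: eq_bigr => i _; rewrite /bump add1n.
Qed.

Lemma sum_gbS' n (F : nat -> A) : \sum_(c < n.+2) gb n.+1 c * F c =
  \sum_(c < n.+1) gb n c * (Q ^+ c * F c) + \sum_(c < n.+1) gb n c * F c.+1.
Proof.
rewrite big_ord_recl [\sum_(c < n.+1) gb n c * (_ * _)]big_ord_recl !gbin0 -addrA.
rewrite expr0 !mul1r; congr (_ + _).
under eq_bigr do rewrite /= /bump /= add1n gbS' mulrDl.
rewrite big_split /=; congr (_ + _); rewrite big_ord_recr /= gb_gt mulr0 mul0r addr0.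
by apply: eq_bigr => i _; rewrite /bump add1n mulrCA mulrA.
Qed.

(** A form of the q-binomial theorem without denominators. The induction rests
    on 1 - a b q^n = (1 - b q^(n-k)) + b q^(n-k) (1 - a q^k). *)
Lemma poch_mul a b n :
  poch (a * b) Q n = \sum_(k < n.+1) gb n k * b ^+ k * poch a Q k * poch b Q (n - k).
Proof.
elim: n => [|n IH]; first by rewrite big_ord1 gbin0 !poch0 !mulr1.
pose T k := gb n k * b ^+ k * poch a Q k * poch b Q (n - k).
have -> : poch (a * b) Q n.+1 = \sum_(k < n.+1)
    (T k * (1 - b * Q ^+ (n - k)) + T k * (b * Q ^+ (n - k) * (1 - a * Q ^+ k))).
  rewrite pochS IH big_distrl; apply: eq_bigr => k _; rewrite /= -/(T k) -mulrDr.
  congr (_ * _); have -> : Q ^+ n = Q ^+ (n - k) * Q ^+ k.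
    by rewrite -exprD subnK // -ltnS.
  by move: (Q ^+ (n - k)) (Q ^+ k) => u v; ring.
rewrite big_split /= [RHS]big_ord_recl.
pose U k := gb n k * b ^+ k * poch a Q k * poch b Q (n.+1 - k).
have -> : \sum_(i < n.+1) T i * (1 - b * Q ^+ (n - i)) = \sum_(i < n.+2) U i.
  rewrite [RHS]big_ord_recr /= {2}/U gb_gt !mul0r addr0; apply: eq_bigr => i _.
  by rewrite /U subSn ?pochS ?mulrA // -ltnS.
rewrite [X in X + _ = _]big_ord_recl -[LHS]addrA; congr (_ + _); first by rewrite /U !gbin0.
rewrite -big_split; apply: eq_bigr => i _; rewrite /= /U /T gbS /bump /= subSS.
rewrite exprS pochS.
by move: (Q ^+ (n - i)) (poch a Q i) (poch b Q (n - i)) (Q ^+ i) (b ^+ i) => u v p r s; ring.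
Qed.

Lemma sum_triangle n (F : nat -> nat -> A) :
  \sum_(j < n.+1) \sum_(i < (n - j).+1) F j (i + j)%N
  = \sum_(k < n.+1) \sum_(j < k.+1) F j k.
Proof.
transitivity (\sum_(0 <= j < n.+1) \sum_(0 <= k < n.+1 | (j <= k)%N) F j k).
  rewrite big_mkord; apply: eq_bigr => j _.
  have jn : (j <= n)%N by rewrite -ltnS.
  rewrite [RHS](big_cat_nat (n := j)) //=; last by rewrite ltnW.
  rewrite [X in _ = X + _]big_nat_cond [X in _ = X + _]big1 ?add0r; last first.
    by move=> i /andP[/andP[_ ij] ji]; move: ij; rewrite ltnNge ji.
  rewrite [RHS]big_nat_cond (eq_bigl (fun k => (j <= k < n.+1)%N && true)); last first.
    by move=> i; case: (leqP j i).
  rewrite -big_nat_cond; have := big_addn 0 n.+1 j xpredT (F j); rewrite add0n => ->.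
  by rewrite subSn // big_mkord.
rewrite (exchange_big_dep_nat xpredT) //= big_mkord; apply: eq_bigr => k _.
rewrite [LHS](big_cat_nat (n := k.+1)) //=.
rewrite [X in _ + X]big_nat_cond [X in _ + X]big1 ?addr0; last first.
  by move=> i /andP[/andP[ki _] ik]; move: ki; rewrite ltnNge ik.
rewrite big_nat_cond (eq_bigl (fun j => (0 <= j < k.+1)%N && true)); last first.
  by move=> i /=; rewrite ltnS; case: (leqP i k).
by rewrite -big_nat_cond big_mkord.
Qed.

Lemma gb_multi n j i : (i + j <= n)%N -> gb n j * gb (n - j) i = gb n i * gb (n - i) j.
Proof. by move=> ijn; rewrite -!natrM gbin_multi. Qed.

Lemma gb_revision n j i : (i <= j)%N -> (j <= n)%N ->
  gb n j * gb j i = gb n i * gb (n - i) (j - i).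
Proof. by move=> ij jn; rewrite -!natrM gbin_revision. Qed.

(** The left side is symmetric under the exchange of a and z: when (z t;
    q)_(n-c) is expanded by poch_mul, it becomes a sum over i + c <= n in
    which (a, c) and (z, i) play the same role. *)
Lemma poch_convolution a t z n :
  \sum_(c < n.+1) gb n c * t ^+ c * poch a Q c * poch (z * t) Q (n - c)
  = \sum_(i < n.+1) gb n i * t ^+ i * poch z Q i * poch (a * t) Q (n - i).
Proof.
transitivity (\sum_(c < n.+1) \sum_(i < (n - c).+1)
   gb n i * t ^+ i * poch z Q i *
   (gb (n - i) c * t ^+ c * poch a Q c * poch t Q (n - i - c))).
  apply: eq_bigr => c _; rewrite poch_mul big_distrr /=; apply: eq_bigr => i _.
  have ic : (i + c <= n)%N by have := ltn_ord i; have := ltn_ord c; lia.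
  have -> : (n - i - c = n - c - i)%N by lia.
  transitivity (gb n c * gb (n - c) i *
    (t ^+ c * t ^+ i * poch a Q c * poch z Q i * poch t Q (n - c - i))); first by ring.
  by rewrite gb_multi //; ring.
pose F (c k : nat) := gb n (k - c) * t ^+ (k - c) * poch z Q (k - c)
   * (gb (n - (k - c)) c * t ^+ c * poch a Q c * poch t Q (n - (k - c) - c)).
transitivity (\sum_(c < n.+1) \sum_(i < (n - c).+1) F c (i + c)%N).
  by apply: eq_bigr => c _; apply: eq_bigr => i _; rewrite /F addnK.
rewrite sum_triangle.
pose G (i k : nat) := gb n i * t ^+ i * poch z Q i
   * (gb (n - i) (k - i) * t ^+ (k - i) * poch a Q (k - i) * poch t Q (n - i - (k - i))).
transitivity (\sum_(k < n.+1) \sum_(i < k.+1) G i k).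
  apply: eq_bigr => k _; rewrite (reindex_inj rev_ord_inj); apply: eq_bigr => i _ /=.
  rewrite /F /G subSS; have ik : (i <= k)%N by rewrite -ltnS.
  by have -> : (k - (k - i) = i)%N by lia.
rewrite -sum_triangle; apply: eq_bigr => i _.
rewrite poch_mul [RHS]big_distrr; apply: eq_bigr => c _.
by rewrite /G addnK.
Qed.

(** The case a = 0, where the symmetry relates two expansions of the
    polynomials szego below. *)
Lemma rogers_szego t z n :
  \sum_(c < n.+1) gb n c * t ^+ c * poch (z * t) Q (n - c)
  = \sum_(i < n.+1) gb n i * t ^+ i * poch z Q i.
Proof.
have := poch_convolution 0 t z n; rewrite mul0r.
under eq_bigr do rewrite poch0l mulr1.
by move=> ->; apply: eq_bigr => i _; rewrite poch0l mulr1.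
Qed.

Section Inverse.
Variables (x t : A).
Hypothesis Qx : Q * x = 1.

Lemma Qx_exp n k : (k <= n)%N -> Q ^+ k * x ^+ n = x ^+ (n - k).
Proof.
move=> kn; rewrite -{1}(subnK kn) exprD mulrCA -exprMn Qx expr1n mulr1 //.
Qed.

(** In the application p i j is the series of the lattices in R^i + P^j, where
    P is the maximal ideal of R, and the first hypothesis comes from the
    splitting of one coordinate. The closed form is needed for j = 0 alone,
    but the induction on i moves coordinates from R to P. *)
Lemma split_recursion (p : nat -> nat -> A) (v : nat -> A) :
  (forall i j, p i.+1 j = x ^+ (i + j).+1 * t * p i j.+1 + p i j) ->
  (forall j, poch (t * x) x j * p 0%N j = \sum_(k < j.+1) gb j k * v k) ->
  forall i j, poch (t * x) x (i + j) * p i j =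
    \sum_(s < i.+1) \sum_(l < j.+1)
      gb i s * (t * x ^+ i) ^+ s * (gb j l * x ^+ (s * l) * v (s + l)%N).
Proof.
move=> prec p0; elim=> [|i IH] j.
  rewrite add0n p0 big_ord1; apply: eq_bigr => l _.
  by rewrite /= gbin0 mul0n !expr0 !mul1r mulr1 add0n.
pose T i (s j l : nat) := gb i s * (t * x ^+ i) ^+ s * (gb j l * x ^+ (s * l) * v (s + l)%N).
have {}IH j' : poch (t * x) x (i + j') * p i j' = \sum_(s < i.+1) \sum_(l < j'.+1) T i s j' l.
  exact: IH.
pose W (s l : nat) := gb i s * gb j l * t ^+ s.+1 * x ^+ (i.+1 * s.+1) * x ^+ (s.+1 * l) * v
  (s.+1 + l)%N.
(* The terms that the step from i to i + 1 adds: p i j.+1 and p i j differ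
   only by the Gaussian binomials [j + 1, l] and [j, l]. *)
have dif : t * x ^+ (i + j).+1 * (\sum_(s < i.+1) \sum_(l < j.+2) T i s j.+1 l
    - \sum_(s < i.+1) \sum_(l < j.+1) T i s j l) = \sum_(s < i.+1) \sum_(l < j.+1) W s l.
  rewrite -sumrB big_distrr; apply: eq_bigr => s _ /=.
  have -> : \sum_(l < j.+1) T i s j l = \sum_(l < j.+2) T i s j l.
    have T0 : T i s j j.+1 = 0 by rewrite /T gb_gt !mul0r mulr0.
    by rewrite [RHS]big_ord_recr /= T0 addr0.
  rewrite -sumrB big_ord_recl {1 2}/T /= !gbin0 subrr add0r big_distrr.
  apply: eq_bigr => l _; rewrite /= /T /W /bump /= gbS.
  have lj : (l <= j)%N by rewrite -ltnS.
  have -> : (s + l.+1 = s.+1 + l)%N by rewrite addnS.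
  transitivity (gb i s * gb j l * t ^+ s.+1 * (x ^+ (i + j).+1 * Q ^+ (j - l)
     * x ^+ (i * s) * x ^+ (s * l.+1)) * v (s.+1 + l)%N).
    rewrite exprMn -exprM (exprS t).
    move: (x ^+ (i + j).+1) (Q ^+ (j - l)) (x ^+ (i * s)) (x ^+ (s * l.+1)) (t ^+ s).
    by move=> z1 z2 z3 z4 z5; ring.
  rewrite [x ^+ _ * Q ^+ _]mulrC Qx_exp; last by lia.
  rewrite -!exprD; set N := (X in x ^+ X).
  have -> : N = (i.+1 * s.+1 + s.+1 * l)%N.
    by rewrite /N !mulSn !mulnS; lia.
  by rewrite exprD !mulrA.
rewrite addSn pochS prec mulrDr.
transitivity (poch (t * x) x (i + j) * p i j + t * x ^+ (i + j).+1 *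
  (poch (t * x) x (i + j.+1) * p i j.+1 - poch (t * x) x (i + j) * p i j)).
  by rewrite addnS pochS exprS; move: (x ^+ _) (poch _ _ _) (p i j) (p i j.+1) => y z1 z2 z3; ring.
rewrite !IH dif.
rewrite [RHS]big_ord_recl.
have -> : \sum_(s < i.+1) \sum_(l < j.+1) T i s j l = \sum_(l < j.+1) T i.+1 0%N j l
   + \sum_(s < i.+1) \sum_(l < j.+1) Q ^+ s.+1 * gb i s.+1 * (t * x ^+ i.+1) ^+ s.+1 *
       (gb j l * x ^+ (s.+1 * l) * v (s.+1 + l)%N).
  rewrite big_ord_recl; congr (_ + _).
    by apply: eq_bigr => l _; rewrite /T /= !gbin0 !expr0.
  rewrite [RHS]big_ord_recr /= [X in _ + X]big1 ?addr0; last first.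
    by move=> l _; rewrite gb_gt mulr0 !mul0r.
  apply: eq_bigr => s _; apply: eq_bigr => l _; rewrite /T /bump /= add1n; congr (_ * _).
  rewrite [_ * gb i s.+1]mulrC -mulrA; congr (_ * _); rewrite !exprMn mulrCA; congr (_ * _).
  rewrite -!exprM mulSn exprD mulrA Qx_exp // subnn expr0 mul1r //.
rewrite -addrA; congr (_ + _); rewrite -big_split; apply: eq_bigr => s _ /=.
rewrite -big_split; apply: eq_bigr => l _ /=; rewrite /W /bump /= add1n gbS'.
rewrite [in RHS]mulrDl [in RHS]mulrDl; congr (_ + _).
rewrite exprMn -exprM.
by move: (x ^+ _) (x ^+ _) (t ^+ _) => z1 z2 z3; ring.
Qed.

Lemma split_recursion_top (p : nat -> nat -> A) (v : nat -> A) :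
  (forall i j, p i.+1 j = x ^+ (i + j).+1 * t * p i j.+1 + p i j) ->
  (forall j, poch (t * x) x j * p 0%N j = \sum_(k < j.+1) gb j k * v k) ->
  forall n, poch (t * x) x n * p n 0%N =
    \sum_(k < n.+1) gb n k * (t * x ^+ n) ^+ k * v k.
Proof.
move=> prec p0 n; have := split_recursion prec p0 n 0; rewrite addn0 => ->.
apply: eq_bigr => k _.
by rewrite big_ord1 /= gbin0 muln0 expr0 !mul1r addn0.
Qed.

End Inverse.

End QSeries.

Section Transfer.
Variables (A : comNzRingType) (q : nat) (t : A).
Hypothesis q_gt1 : (1 < q)%N.
Implicit Types (P : {poly A}) (n h N j : nat).
Local Notation S := {poly A}.
Local Notation Q := (q%:R : S).
Local Notation T := (t%:P : S).
Local Notation gb n k := ((gbin q n k)%:R : S).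

(** A deformation of the Rogers-Szego polynomial in t, which is its value at z
    = 'X = 0. *)
Definition szego N : S := \sum_(i < N.+1) gb N i * T ^+ i * poch 'X Q i.

(** On the polynomials rank_poly below, this linear map is the passage from
    the R_m-lattices of rank n to the R_(m+1)-lattices that generate them over
    R_m. It substitutes szego (n - i) for the i-th power of the variable. *)
Definition transfer n P : S := \sum_(i < n.+1) (P`_i)%:P * szego (n - i).

Lemma transferD n : {morph transfer n : P P' / P + P'}.
Proof.
move=> P P'; rewrite /transfer -big_split; apply: eq_bigr => i _.
by rewrite coefD polyCD mulrDl.
Qed.

Lemma transferZ n (c : A) P : transfer n (c%:P * P) = c%:P * transfer n P.
Proof.
rewrite /transfer big_distrr; apply: eq_bigr => i _ /=.
by rewrite coefCM polyCM mulrA.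
Qed.

Lemma transferB n P P' : transfer n (P - P') = transfer n P - transfer n P'.
Proof. by rewrite transferD -[- P']mulN1r -polyCN transferZ polyCN mulN1r. Qed.

Lemma transfer_sum n (m : nat) (F : nat -> S) :
  transfer n (\sum_(i < m) F i) = \sum_(i < m) transfer n (F i).
Proof.
apply: (big_morph _ (transferD n)); rewrite /transfer big1 // => i _.
by rewrite coef0 mul0r.
Qed.

Lemma transfer1 n : transfer n 1 = szego n.
Proof.
rewrite /transfer big_ord_recl coef1 mul1r subn0 big1 ?addr0 // => i _.
by rewrite coef1 mul0r.
Qed.

Lemma transferX n P : transfer n.+1 ('X * P) = transfer n P.
Proof.
rewrite /transfer big_ord_recl coefXM mul0r add0r; apply: eq_bigr => i _.
by rewrite coefXM.
Qed.

Lemma natQ n : (n%:R : S) = (n%:R)%:P. Proof. by rewrite polyC_natr. Qed.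

(** The coefficients on the right are, up to the weights, the numbers
    fibre_count for m > 0: this is why transfer describes the fibres of the
    hull map. *)
Lemma transfer_poch_t h N : transfer (h + N) (poch ('X * T) Q h) =
  \sum_(c < N.+1) gb N c * (T * Q ^+ h) ^+ c * poch ('X * T) Q (h + N - c).
Proof.
elim: h N => [|h IH] N.
  rewrite poch0 transfer1 /szego -(rogers_szego q_gt1); apply: eq_bigr => c _.
  by rewrite expr0 mulr1.
have -> : poch ('X * T) Q h.+1 = poch ('X * T) Q h
    - (t * q%:R ^+ h)%:P * ('X * poch ('X * T) Q h).
  by rewrite pochS polyCM polyC_exp -natQ; ring.
rewrite transferB transferZ addSn transferX -addnS !IH.
have := sum_gbS' q_gt1 N (fun c => (T * Q ^+ h) ^+ c * poch ('X * T) Q (h + N.+1 - c)).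
under eq_bigr do rewrite mulrA.
move=> ->; rewrite polyCM polyC_exp -natQ big_distrr /= -addrA -sumrB [X in _ + X]big1 ?addr0.
  have -> : T * Q ^+ h.+1 = Q * (T * Q ^+ h) by rewrite exprS; ring.
  by apply: eq_bigr => c _; rewrite [(Q * _) ^+ c]exprMn !mulrA.
move=> c _; apply/eqP; rewrite subr_eq0; apply/eqP.
by rewrite addnS subSS exprS; ring.
Qed.

(** With this formula transfer can be applied to the closed form of rank_poly,
    which is written in the basis of the symbols (z; q)_j. *)
Lemma transfer_poch j N : transfer (j + N) (poch 'X Q j) =
  \sum_(i < N.+1) gb N i * Q ^+ (j * (N - i)) * T ^+ (i + j) * poch 'X Q (i + j).
Proof.
elim: j N => [|j IH] N.
  rewrite poch0 transfer1; apply: eq_bigr => i _.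
  by rewrite mul0n expr0 mulr1 addn0.
have -> : poch 'X Q j.+1 = poch 'X Q j - (q%:R ^+ j)%:P * ('X * poch 'X Q j).
  by rewrite pochS polyC_exp -natQ; ring.
rewrite transferB transferZ addSn transferX -addnS !IH.
pose E i : S := Q ^+ (j * (N.+1 - i)) * T ^+ (i + j) * poch 'X Q (i + j).
have := sum_gbS q N E; rewrite /E; under eq_bigr do rewrite !mulrA.
move=> ->; rewrite polyC_exp -natQ big_distrr /= addrAC -sumrB [X in X + _]big1 ?add0r.
  apply: eq_bigr => c _; rewrite subSS addSnnS !mulrA [Q ^+ _ * _]mulrC.
  by congr (_ * _ * _); rewrite -mulrA -exprD mulSn.
move=> c _; apply/eqP; rewrite subr_eq0; apply/eqP.
rewrite subSn; last by rewrite -ltnS.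
by rewrite mulnS exprD; ring.
Qed.

End Transfer.

(** * Generating series of the lattice counts *)

Lemma rmorph_poch (A B : comNzRingType) (f : {rmorphism A -> B}) a x n :
  f (poch a x n) = poch (f a) (f x) n.
Proof.
rewrite /poch rmorph_prod; apply: eq_bigr => i _.
by rewrite rmorphB rmorph1 rmorphM rmorphXn.
Qed.

Section CountSmall.
Variable q : nat.

(** The defect is at most the rank, which shows in each of the recursions. *)
Lemma lattice_count_small m n d b : (n < b)%N -> lattice_count q m n d b = 0%N.
Proof.
elim: m n d b => [|m IH] n d b nb /=; first by case: b nb.
have hs r d' c : (r < c)%N -> hull_count q m (lattice_count q m) r d' c = 0%N.
  move=> rc; rewrite /hull_count; case: ifP => // _; rewrite big1 // => b' _.
  have [rb|br] := ltnP r b'; first by rewrite IH.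
  rewrite /fibre_count; case: (m) => [|m']; first by rewrite /nforms gbin_small // mul0n muln0.
  by rewrite gbin_small ?muln0 // (leq_ltn_trans br).
have : forall i j d' a, (i + j < a)%N -> split_count q (hull_count q m (lattice_count q m)) i j
  d' a = 0%N.
  elim=> [|i IHi] j d' a ija /=; first exact: hs.
  case: a ija => [|a] ija; first by [].
  rewrite (IHi j d' a) ?mul0n ?addn0; last by rewrite addSn ltnS in ija.
  by case: d' => // d'; rewrite IHi // addnS -addSn.
by apply; rewrite addn0.
Qed.

End CountSmall.

Section Series.
Variable q : nat.
Hypothesis q_gt1 : (1 < q)%N.
Local Notation A := (fps rat).
Local Notation S := {poly A}.
Local Notation t := (fpsX : A).
Local Notation x := ((q%:R : A)^-1).
Local Notation xr := ((q%:R : rat)^-1).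

Lemma natr_fps n : (n%:R : A) = fpsC (n%:R : rat).
Proof. by rewrite rmorph_nat. Qed.

Lemma q_neq0 : (q%:R : rat) != 0.
Proof. by rewrite pnatr_eq0 -lt0n ltnW. Qed.

Lemma xE : x = fpsC xr.
Proof.
have Uq : (q%:R : A) \is a GRing.unit by rewrite fps_unitE natr_fps /= q_neq0.
by apply: (mulrI Uq); rewrite mulrV // natr_fps -rmorphM mulfV ?rmorph1 ?q_neq0.
Qed.

Lemma Qx : q%:R * x = 1.
Proof. by rewrite xE natr_fps -rmorphM mulfV ?rmorph1 ?q_neq0. Qed.

(** The factor x^(r d) comes from the shift of s by the rank r. *)
Definition weighted_series (r : nat) (c : nat -> nat) : A :=
  Fps (fun d => (c d)%:R * xr ^+ (r * d)).

Lemma fcoef_xM n (f : A) d : fcoef (x ^+ n * f) d = xr ^+ n * fcoef f d.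
Proof. by rewrite xE -rmorphXn fcoefCM. Qed.

Lemma fcoef_natM n (f : A) d : fcoef (n%:R * f) d = n%:R * fcoef f d.
Proof. by rewrite natr_fps fcoefCM. Qed.

Definition count_series m n b : A := weighted_series n (fun d => lattice_count q m n d b).
Definition split_series m i j a : A :=
  weighted_series (i + j) (fun d => split_count q (hull_count q m (lattice_count q m)) i j d a).

Lemma count_series_small m n b : (n < b)%N -> count_series m n b = 0.
Proof. by move=> nb; apply: fpsP => d; rewrite /= lattice_count_small // mul0r. Qed.

Lemma count_seriesS m n b : count_series m.+1 n b = split_series m n 0 b.
Proof. by rewrite /split_series addn0. Qed.

Lemma split_seriesS m i j a : split_series m i.+1 j a =
  x ^+ (i + j).+1 * t * split_series m i j.+1 a + (if a is a'.+1 then split_series m i j a' else 0).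
Proof.
apply: fpsP => d; rewrite fcoefD -mulrA fcoef_xM fcoefXM /= natrD mulrDl; congr (_ + _).
  case: d => [|d]; first by rewrite mul0r mulr0.
  by rewrite mulnS exprD addSn addnS mulrCA.
case: a => [|a]; first by rewrite mul0r.
rewrite natrM natrX -mulrA; congr (_ * _); rewrite addSn mulSn exprD mulrA.
by rewrite -exprMn mulfV ?q_neq0 // expr1n mul1r.
Qed.

Lemma split_series0 m j c : split_series m 0 j c =
  \sum_(b < j.+1) count_series m j b * ((x ^+ j * t) ^+ c * (fibre_count q m j b c)%:R).
Proof.
have -> : \sum_(b < j.+1) count_series m j b * ((x ^+ j * t) ^+ c * (fibre_count q m j b c)%:R)
  = x ^+ (j * c) * (t ^+ c * \sum_(b < (2 * j).+1) (fibre_count q m j b c)%:R * count_series m j b).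
  rewrite -(big_mkord xpredT (fun b => (fibre_count q m j b c)%:R * count_series m j b)).
  rewrite (big_cat_nat (n := j.+1)) //=; last by rewrite ltnS leq_pmull.
  rewrite [X in _ + X]big_nat_cond [X in _ + X]big1 ?addr0; last first.
    by move=> b /andP[/andP[jb _] _]; rewrite count_series_small // mulr0.
  rewrite big_mkord !big_distrr /=; apply: eq_bigr => b _.
  by rewrite exprMn -exprM; ring.
apply: fpsP => d; rewrite fcoef_xM fcoefXnM /= /hull_count add0n.
case: leqP => [cd|dc]; last by rewrite mul0r mulr0.
rewrite fcoef_sum natr_sum big_distrl big_distrr; apply: eq_bigr => b _.
rewrite fcoef_natM /= natrM.
have -> : xr ^+ (j * d) = xr ^+ (j * c) * xr ^+ (j * (d - c)).
  by rewrite -exprD -mulnDr subnKC.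
by move: (xr ^+ _) (xr ^+ _) => y1 y2; ring.
Qed.

Lemma count_series00 : count_series 0 0 0 = 1.
Proof. by apply: fpsP => -[|d] /=; rewrite ?mul0r // mul0n expr0 mulr1. Qed.

Lemma count_series0S n : count_series 0 n.+1 0 * (1 - (t * x ^+ n.+1) ^+ 2) = count_series 0 n 0.
Proof.
suff E : count_series 0 n.+1 0 = count_series 0 n 0
  + x ^+ (n.+1 * 2) * (t ^+ 2 * count_series 0 n.+1 0).
  by rewrite exprMn -exprM mulrBr mulr1 {1}E; move: (x ^+ _) => y; ring.
apply: fpsP => d; rewrite fcoefD fcoef_xM fcoefXnM.
have count0E n' d' : count0 q n'.+1 d' =
    (count0 q n' d' * q ^ d' + (if d' is d''.+2 then count0 q n'.+1 d'' else 0))%N by case: d'.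
have DE n' d' : fcoef (count_series 0 n' 0) d' = (count0 q n' d')%:R * xr ^+ (n' * d') by [].
rewrite !DE count0E natrD mulrDl; congr (_ + _).
  rewrite natrM natrX mulSn exprD mulrA -[X in X * _]mulrA -exprMn mulfV ?q_neq0 //.
  by rewrite expr1n mulr1.
case: d => [|[|d]]; rewrite ?mul0r ?mulr0 //.
have -> : (d.+2 < 2)%N = false by [].
rewrite !subSS subn0 [RHS]mulrCA -exprD.
by congr (_ * _ ^+ _); rewrite -mulnDr addnC addn2.
Qed.

(** The zeta function to be computed, as a series in t. *)
Definition lattice_series m n : A := \sum_(b < n.+1) count_series m n b.
(** The expected numerator of lattice_series. *)
Definition u_series m n : A := poch (t * x) x n * lattice_series m n.

Lemma lattice_series0 n : lattice_series 0 n = count_series 0 n 0.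
Proof.
rewrite /lattice_series big_ord_recl big1 ?addr0 // => b _.
by apply: fpsP => d; rewrite /= mul0r.
Qed.

Lemma u_series0S n : u_series 0 n.+1 * (1 + t * x ^+ n.+1) = u_series 0 n.
Proof.
rewrite /u_series !lattice_series0 pochS -(count_series0S n).
have -> : t * x * x ^+ n = t * x ^+ n.+1 by rewrite -mulrA -exprS.
by move: (x ^+ _) => y; ring.
Qed.

(** As u_series 0 j is 1 / (- t x; x)_j, the quotient of two of these series
    is a Pochhammer symbol, which can be read in the base q instead of x. *)
Lemma u_series0_shift j s : u_series 0 j = u_series 0 (j + s)%N * poch (- x ^+ (j + s) * t) q%:R s.
Proof.
elim: s => [|s IH]; first by rewrite addn0 poch0 mulr1.
rewrite IH addnS -[s.+1]add1n poch_add pochS poch0 mul1r expr0 mulr1 mulrA.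
rewrite -u_series0S; congr (_ * _ * poch _ _ _); first by rewrite mulNr opprK mulrC.
by rewrite expr1 !mulNr exprS -[in RHS]mulrA [t * q%:R]mulrC mulrA [x * _]mulrC -!mulrA [x * (_ *
  _)]mulrA [x * q%:R]mulrC Qx mul1r.
Qed.

Local Notation Q := (q%:R : S).
Local Notation T := (t%:P : S).
Local Notation X := (x%:P : S).
Local Notation gb n k := ((gbin q n k)%:R : S).

Lemma QX : Q * X = 1.
Proof. by rewrite natQ -polyCM Qx. Qed.

(** The generating polynomial of the defects b, in the variable z = 'X. The
    basis (z t; q)_(n-b) makes both steps of the recursion linear: the
    splitting of a coordinate by split_polyS, and the passage to the hulls by
    transfer_poch_t. At z = 0 the defects are forgotten. *)
Definition rank_poly m n : S := \sum_(b < n.+1) (count_series m n b)%:P * poch ('X * T) Q (n - b).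
Definition split_poly m i j : S :=
  \sum_(a < (i + j).+1) (split_series m i j a)%:P * poch ('X * T) Q (i + j - a).

Lemma rank_polyS m n : rank_poly m.+1 n = split_poly m n 0.
Proof. by rewrite /split_poly addn0; apply: eq_bigr => b _; rewrite count_seriesS. Qed.

Lemma split_polyS m i j : split_poly m i.+1 j
  = X ^+ (i + j).+1 * T * split_poly m i j.+1 + split_poly m i j.
Proof.
rewrite {1}/split_poly; under eq_bigr do rewrite split_seriesS polyCD mulrDl.
rewrite big_split /= addSn; congr (_ + _).
  rewrite /split_poly addnS big_distrr; apply: eq_bigr => a _ /=.
  by rewrite !polyCM polyC_exp mulrA.
rewrite big_ord_recl /= mul0r add0r; apply: eq_bigr => a _.
by rewrite /bump /= add1n subSS.
Qed.

(** The invariant of the induction on m. It gives in closed form the series of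
    the R_(m+1)-lattices in R_m^j, together with their defects. *)
Definition transfer_identity m := forall j, poch (T * X) X j * split_poly m 0 j =
  \sum_(k < j.+1) gb j k * (T ^+ k * poch 'X Q k * (u_series m k)%:P).

Lemma rank_poly_eq m n : transfer_identity m -> poch (T * X) X n * rank_poly m.+1 n =
  \sum_(k < n.+1) gb n k * (T * X ^+ n) ^+ k * (T ^+ k * poch 'X Q k * (u_series m k)%:P).
Proof.
by move=> H; rewrite rank_polyS; exact: (@split_recursion_top _ _ q_gt1 _ _ QX (split_poly m)
  (fun k => T ^+ k * poch 'X Q k * (u_series m k)%:P) (split_polyS m) H n).
Qed.

(** The value at z = 0 of rank_poly_eq. *)
Lemma u_series_rec m n : transfer_identity m -> u_series m.+1 n =
  \sum_(k < n.+1) (gbin q n k)%:R * (t * x ^+ n) ^+ k * t ^+ k * u_series m k.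
Proof.
pose f : {rmorphism S -> A} := horner_eval (0 : A).
move=> /(rank_poly_eq n) /(congr1 f).
have poch0X y N : f (poch ('X * y) Q N) = 1.
  by rewrite rmorph_poch rmorphM [f 'X]hornerX mul0r poch0l.
have poch0X' N : f (poch 'X Q N) = 1 by rewrite -['X]mulr1 poch0X.
have evC (c : A) : f c%:P = c by exact: hornerC.
rewrite rmorphM rmorph_poch rmorphM !evC !rmorph_sum => E.
transitivity (poch (t * x) x n * \sum_(b < n.+1) f ((count_series m.+1 n b)%:P * poch ('X * T) Q
  (n - b))).
  by congr (_ * _); apply: eq_bigr => b _; rewrite rmorphM poch0X mulr1 evC.
rewrite E; apply: eq_bigr => k _.
rewrite !rmorphM !rmorphXn !rmorphM !rmorphXn !evC poch0X' rmorph_nat mulr1.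
by rewrite !mulrA.
Qed.

(** Sorting by hulls gives that the left side is the image of rank_poly by
    transfer. On the closed form rank_poly_eq of rank_poly, transfer_poch
    produces a double sum, and its inner sum is the recursion of u_series. *)
Lemma transfer_identityS m : transfer_identity m -> transfer_identity m.+1.
Proof.
move=> H j.
have pochC : poch (T * X) X j = (poch (t * x) x j)%:P.
  by rewrite -polyCM (rmorph_poch (@polyC A)).
have -> : split_poly m.+1 0 j = transfer q t j (rank_poly m.+1 j).
  rewrite /rank_poly (transfer_sum q t j j.+1 (fun b => (count_series m.+1 j b)%:P * poch ('X *
    T) Q (j - b))).
  under [RHS]eq_bigr do rewrite transferZ.
  rewrite /split_poly add0n.
  under [LHS]eq_bigr do rewrite split_series0 rmorph_sum big_distrl /=.
  rewrite exchange_big; apply: eq_bigr => b _ /=.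
  have bj : (b <= j)%N by rewrite -ltnS.
  have := @transfer_poch_t _ q t q_gt1 (j - b) b; rewrite subnK // => ->.
  rewrite big_distrr /=.
  rewrite -(big_mkord xpredT (fun a => (count_series m.+1 j b * ((x ^+ j * t) ^+ a * (fibre_count
    q m.+1 j b a)%:R))%:P * poch ('X * T) Q (j - a))).
  rewrite (big_cat_nat (n := b.+1)) //=.
  rewrite [X in _ + X]big_nat_cond [X in _ + X]big1 ?addr0; last first.
    move=> a /andP[/andP[ba _] _].
    by rewrite gbin_small // muln0 !mulr0 polyC0 mul0r.
  rewrite big_mkord; apply: eq_bigr => a _; rewrite polyCM -!mulrA; congr (_ * _).
  rewrite mulrA; congr (_ * _).
  have -> : (x ^+ j * t) ^+ a * (q ^ (a * (2 * j - b)) * gbin q b a)%:R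
      = (gbin q b a)%:R * (t * q%:R ^+ (j - b)) ^+ a.
    rewrite natrM natrX !exprMn -!exprM.
    have -> : (a * (2 * j - b) = (j - b) * a + j * a)%N.
      by rewrite [in LHS]mulnC -mulnDl; congr (_ * _)%N; lia.
    have xQ : q%:R ^+ (j * a) * x ^+ (j * a) = 1 by rewrite -exprMn Qx expr1n.
    rewrite exprD; move: (_ ^+ (j * a)) (x ^+ _) xQ => y1 y2 xQ.
    by transitivity ((gbin q b a)%:R * (t ^+ a * q%:R ^+ ((j - b) * a)) * (y1 * y2));
      [ring|rewrite xQ mulr1].
  by rewrite polyCM !polyC_exp polyCM polyC_exp !polyC_natr.
rewrite pochC -transferZ -pochC (rank_poly_eq j H).
pose c k : A := (gbin q j k)%:R * (t * x ^+ j) ^+ k * t ^+ k * u_series m k.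
transitivity (transfer q t j (\sum_(k < j.+1) (c k)%:P * poch 'X Q k)).
  congr (transfer q t j _); apply: eq_bigr => k _.
  rewrite /c; move: (u_series m k) (poch 'X Q k) => U P.
  rewrite !polyCM !polyC_exp !polyCM !polyC_exp polyC_natr -!mulrA.
  by rewrite [P * _]mulrC.
rewrite (transfer_sum q t j j.+1 (fun k => (c k)%:P * poch 'X Q k)).
under eq_bigr do rewrite transferZ.
pose F (l k : nat) : S := (c l)%:P * (gb (j - l) (k - l) * Q ^+ (l * (j - k)) * T ^+ k * poch 'X
  Q k).
transitivity (\sum_(l < j.+1) \sum_(i < (j - l).+1) F l (i + l)%N).
  apply: eq_bigr => l _; have lj : (l <= j)%N by rewrite -ltnS.
  have := @transfer_poch _ q t l (j - l); rewrite subnKC // => ->.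
  rewrite big_distrr; apply: eq_bigr => i _ /=; rewrite /F addnK.
  by have -> : (j - (i + l) = j - l - i)%N by lia.
rewrite sum_triangle; apply: eq_bigr => k _; rewrite (u_series_rec k H) rmorph_sum.
rewrite big_distrr big_distrr /=; apply: eq_bigr => l _.
have kj : (k <= j)%N by rewrite -ltnS.
have lk : (l <= k)%N by rewrite -ltnS.
have cE : c l * (gbin q (j - l) (k - l))%:R * q%:R ^+ (l * (j - k))
    = (gbin q j k)%:R * ((gbin q k l)%:R * (t * x ^+ k) ^+ l * t ^+ l * u_series m l).
  rewrite /c !exprMn -!exprM.
  have -> : x ^+ (k * l) = q%:R ^+ (l * (j - k)) * x ^+ (j * l).
    rewrite (Qx_exp Qx); last by rewrite mulnC leq_mul2r leq_subr orbT.
    by congr (_ ^+ _); rewrite [(l * _)%N]mulnC -mulnBl subKn.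
  have := @gb_revision A q q_gt1 j k l lk kj.
  move: (_ ^+ (l * (j - k))) (x ^+ _) => y1 y2 gE.
  transitivity (((gbin q j l)%:R * (gbin q (j - l) (k - l))%:R) * (t ^+ l * y2 * t ^+ l *
    u_series m l * y1)); first by ring.
  by rewrite -gE; ring.
rewrite /F !mulrA; transitivity ((c l * (gbin q (j - l) (k - l))%:R * q%:R ^+ (l * (j - k)))%:P *
  (T ^+ k * poch 'X Q k)).
  by move: (c l) => cl; rewrite !polyCM polyC_exp !polyC_natr !mulrA.
rewrite cE polyCM polyC_natr.
by rewrite -!mulrA; congr (_ * _); rewrite mulrC -!mulrA.
Qed.

Lemma nforms_poch j a : (a <= j)%N -> (x ^+ j * t) ^+ a * (nforms q j a)%:R
  = (gbin q j a)%:R * t ^+ a * poch (- x ^+ j) q%:R a.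
Proof.
move=> aj; rewrite /nforms natrM natr_prod exprMn.
have -> : (x ^+ j) ^+ a = \prod_(i < a) x ^+ j by rewrite prodr_const card_ord.
have -> : poch (- x ^+ j) q%:R a = \prod_(i < a) x ^+ j * \prod_(i < a) ((q ^ j + q ^ i)%:R : A).
  rewrite -big_split; apply: eq_bigr => i _ /=.
  have xQ : x ^+ j * q%:R ^+ j = 1 by rewrite mulrC -exprMn Qx expr1n.
  by rewrite natrD !natrX mulrDr xQ mulNr opprK.
by move: (\prod_(i < a) x ^+ j) (\prod_(i < a) _) => y1 y2; ring.
Qed.

(** Over K[[T]] all defects are 0, and the numbers nforms of spanning
    subspaces are Pochhammer symbols by nforms_poch; the identity is then
    poch_convolution at a = - x^j. *)
Lemma transfer_identity0 : transfer_identity 0.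
Proof.
move=> j.
have G0 a : (a <= j)%N -> split_series 0 0 j a
  = count_series 0 j 0 * ((gbin q j a)%:R * t ^+ a * poch (- x ^+ j) q%:R a).
  move=> aj; rewrite split_series0 big_ord_recl big1 ?addr0 => [|b _]; first by rewrite nforms_poch.
  suff -> : count_series 0 j (lift ord0 b) = 0 by rewrite mul0r.
  by apply: fpsP => d; rewrite /= mul0r.
transitivity (poch (T * X) X j * ((count_series 0 j 0)%:P * \sum_(a < j.+1)
   gb j a * T ^+ a * poch (- X ^+ j) Q a * poch ('X * T) Q (j - a))).
  congr (_ * _); rewrite /split_poly add0n big_distrr; apply: eq_bigr => a _ /=.
  rewrite G0; last by rewrite -ltnS.
  have pE : (poch (- x ^+ j) q%:R a)%:P = poch (- X ^+ j) Q a.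
    by rewrite (rmorph_poch (@polyC A)) rmorphN rmorphXn rmorph_nat.
  rewrite !polyCM polyC_natr polyC_exp pE.
  by rewrite !mulrA.
rewrite (poch_convolution q_gt1) !big_distrr /=; apply: eq_bigr => k _.
have kj : (k <= j)%N by rewrite -ltnS.
have -> : u_series 0 k = u_series 0 j * poch (- x ^+ j * t) q%:R (j - k).
  by rewrite (u_series0_shift k (j - k)) subnKC.
have pE s : (poch (- x ^+ j * t) q%:R s)%:P = poch (- X ^+ j * T) Q s.
  by rewrite (rmorph_poch (@polyC A)) rmorphM rmorphN rmorphXn rmorph_nat.
have pE' : (poch (t * x) x j)%:P = poch (T * X) X j.
  by rewrite (rmorph_poch (@polyC A)) rmorphM.
rewrite polyCM pE /u_series lattice_series0 polyCM pE'.
by move: (count_series 0 j 0)%:P (T ^+ k) => y4 y5; ring.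
Qed.

Lemma transfer_identity_all m : transfer_identity m.
Proof. by elim: m => [|m IH]; [exact: transfer_identity0|exact: transfer_identityS]. Qed.

Lemma u_series0_inv n : u_series 0 n * poch (- t * x) x n = 1.
Proof.
elim: n => [|n IH]; first by rewrite /u_series !poch0 lattice_series0 count_series00 !mulr1.
rewrite pochS.
have -> : 1 - - t * x * x ^+ n = 1 + t * x ^+ n.+1 by rewrite !mulNr opprK -mulrA -exprS.
by rewrite [X in _ * X]mulrC mulrA u_series0S.
Qed.

Lemma unit_poch (a : A) n : fcoef a 0 = 0 -> poch (a * x) x n \is a GRing.unit.
Proof.
move=> a0; rewrite fps_unitE; elim: n => [|n IH]; first by rewrite poch0 fcoef1 oner_eq0.
by rewrite pochS fcoefM0 mulf_neq0 // fcoefB !fcoefM0 a0 !mul0r subr0 fcoef1 eqxx oner_eq0.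
Qed.

Lemma lattice_seriesE m n : lattice_series m n = (poch (t * x) x n)^-1 * u_series m n.
Proof. by rewrite /u_series mulrA mulVr ?mul1r // unit_poch. Qed.

(** Divided by (x; x)_n, this is a step of the Bailey chain relative to a =
    t^2. *)
Lemma u_seriesS m n : u_series m.+1 n =
  \sum_(k < n.+1) (gbin q n k)%:R * x ^+ (n * k) * t ^+ (2 * k) * u_series m k.
Proof.
rewrite u_series_rec; last exact: transfer_identity_all.
apply: eq_bigr => k _; rewrite exprMn -exprM; congr (_ * _).
by rewrite mul2n -addnn exprD; move: (x ^+ _) (t ^+ _) => y1 y2; ring.
Qed.

End Series.

(** * The Bressoud sum as an iterated sum *)

Section BressoudUnroll.
Variables (A : comUnitRingType) (t x : A).

Lemma sum_tuple_cons (T : finType) m (F : m.+1.-tuple T -> A) :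
  \sum_(nu : m.+1.-tuple T) F nu = \sum_(a : T) \sum_(nu : m.-tuple T) F [tuple of a :: nu].
Proof.
rewrite pair_big /= (reindex (fun p : T * m.-tuple T => [tuple of p.1 :: p.2])) //.
exists (fun nu : m.+1.-tuple T => (thead nu, [tuple of behead nu])) => [[a nu] _|nu _] /=.
  by congr (_, _); apply: val_inj.
by apply: val_inj; rewrite /= [in RHS](tuple_eta nu).
Qed.

(** The Bressoud sum without its prefactor, and with the factor that depends
    on n_1 alone replaced by a weight w; this makes it possible to remove n_1.
    N only bounds the entries. *)
Definition chain_sum m N n (w : nat -> A) : A :=
  \sum_(nu : m.-tuple 'I_N.+1) let c i := nth n (map val nu) i in
    t ^+ (\sum_(i < m) 2 * c i) * x ^+ (\sum_(i < m) c i ^ 2)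
    * (\prod_(i < m) inv_poch x ((c i.+1)%:Z - (c i)%:Z)) * w (c 0%N).

(** What the sum over n_1 contributes as a function of n_2. *)
Definition chain_step (w : nat -> A) (b : nat) : A :=
  \sum_(a < b.+1) t ^+ (2 * a) * x ^+ (a ^ 2) * (poch x x (b - a))^-1 * w a.

Lemma inv_poch_sub (a b : nat) : inv_poch x (b%:Z - a%:Z) =
  if (a <= b)%N then (poch x x (b - a))^-1 else 0.
Proof.
case: leqP => [ab|ba]; first by rewrite subzn.
by rewrite -opprB subzn ?(ltnW ba) //; case: (a - b)%N (subn_gt0 b a) => [|j] //; rewrite ba.
Qed.

Lemma chain_stepE N w b : (b <= N)%N -> chain_step w b =
  \sum_(a < N.+1) t ^+ (2 * a) * x ^+ (a ^ 2) * inv_poch x (b%:Z - (val a)%:Z) * w a.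
Proof.
move=> bN; pose F a := t ^+ (2 * a) * x ^+ (a ^ 2) * inv_poch x (b%:Z - a%:Z) * w a.
rewrite -(big_mkord xpredT F) (big_cat_nat (n := b.+1)) //=.
rewrite [X in _ + X]big_nat_cond [X in _ + X]big1 ?addr0; last first.
  by move=> a /andP[/andP[ba _] _]; rewrite /F inv_poch_sub leqNgt ba mulr0 mul0r.
rewrite big_mkord; apply: eq_bigr => a _; rewrite /F inv_poch_sub.
by have -> : (a <= b)%N by rewrite -ltnS.
Qed.

Lemma eq_chain_sum m N n w w' : (n <= N)%N -> (forall b, (b <= N)%N -> w b = w' b) ->
  chain_sum m N n w = chain_sum m N n w'.
Proof.
move=> nN ww'; apply: eq_bigr => nu _; congr (_ * _); apply: ww'.
case: nu => -[|a nu] _ //=; by rewrite -ltnS.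
Qed.

Lemma chain_sum0 N n w : chain_sum 0 N n w = w n.
Proof.
rewrite /chain_sum (eq_bigr (fun=> w n)); last first.
  by move=> nu _; rewrite tuple0 /= !big_ord0 !expr0 !mul1r.
by rewrite big_const card_tuple expn0 /= addr0.
Qed.

Lemma chain_sumS m N n w : (n <= N)%N ->
  chain_sum m.+1 N n w = chain_sum m N n (chain_step w).
Proof.
move=> nN; rewrite {1}/chain_sum sum_tuple_cons exchange_big; apply: eq_bigr => nu _ /=.
set c := fun i => nth n [seq val i | i <- nu] i.
have c0N : (c 0%N <= N)%N.
  by rewrite /c; case: (nu) => -[|a s] _ //=; rewrite -ltnS.
rewrite (chain_stepE _ c0N) big_distrr; apply: eq_bigr => a _ /=.
pose c' i := nth n (val a :: [seq val i | i <- nu]) i.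
have E1 : (\sum_(i < m.+1) 2 * c' i = 2 * a + \sum_(i < m) 2 * c i)%N by rewrite big_ord_recl.
have E2 : (\sum_(i < m.+1) c' i ^ 2 = a ^ 2 + \sum_(i < m) c i ^ 2)%N by rewrite big_ord_recl.
have E3 : \prod_(i < m.+1) inv_poch x ((c' i.+1)%:Z - (c' i)%:Z)
  = inv_poch x ((c 0%N)%:Z - (val a)%:Z) * \prod_(i < m) inv_poch x ((c i.+1)%:Z - (c i)%:Z).
  by rewrite big_ord_recl.
rewrite -/(c' _) E1 E2 E3 !exprD /=.
by move: (\prod_(i < m) _) (t ^+ (2 * a)) (x ^+ (a ^ 2)) (t ^+ _) (x ^+ _) => y1 y2 y3 y4 y5; ring.
Qed.

Lemma bressoud_chain m n : bressoud m n t x =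
  poch x x n * chain_sum m n n (fun b => (poch x x b)^-1 / poch (- t * x) x b).
Proof.
rewrite /bressoud; congr (_ * _); apply: eq_bigr => nu _ /=.
set c := fun i => nth n [seq val i | i <- nu] i.
have E1 : (\sum_(1 <= i < m.+1) 2 * nth n (0%N :: [seq val i | i <- nu]) i
    = \sum_(i < m) 2 * c i)%N by rewrite big_add1 big_mkord.
have E2 : (\sum_(1 <= i < m.+1) nth n (0%N :: [seq val i | i <- nu]) i ^ 2
    = \sum_(i < m) c i ^ 2)%N by rewrite big_add1 big_mkord.
rewrite E1 E2 big_mkord big_ord_recl inv_poch_sub.
rewrite /= subn0 -/(c 0%N) -!mulrA.
congr (_ * (_ * _)); rewrite mulrA [RHS]mulrA; congr (_ * _); rewrite mulrC.
by congr (_ * _).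
Qed.

End BressoudUnroll.

(** * The lattice series is a Bressoud sum *)

Section ZCount.
Variable q : nat.
Hypothesis q_gt1 : (1 < q)%N.
Local Notation A := (fps rat).
Local Notation t := (fpsX : A).
Local Notation x := ((q%:R : A)^-1).

Lemma poch_x_unit n : poch x x n \is a GRing.unit.
Proof.
rewrite fps_unitE /poch xE //.
have xr1 : (q%:R : rat)^-1 < 1 by rewrite invf_lt1 ?ltr0n ?ltr1n // ltnW.
have xr0 : 0 < (q%:R : rat)^-1 by rewrite invr_gt0 ltr0n ltnW.
elim: n => [|n IH]; first by rewrite big_ord0 fcoef1 oner_eq0.
rewrite big_ord_recr fcoefM0 mulf_neq0 // -rmorphXn -rmorphM -(rmorph1 (@fpsC rat)) -rmorphB /=.
by rewrite subr_eq0 gt_eqF // -exprS exprn_ilt1 // ltW.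
Qed.

(** The Gaussian binomials at q and at x = 1/q differ by the factor q^(k (n -
    k)). *)
Lemma gbin_inverse n k : (k <= n)%N ->
  (gbin q n k)%:R * x ^+ (n * k) * poch x x k * poch x x (n - k)
  = x ^+ (k ^ 2) * poch x x n.
Proof.
move=> kn; have [a nE] : exists a, n = (a + k)%N by exists (n - k)%N; lia.
have pE j : poch x x j = fpsC (qfact q j * (q%:R : rat)^-1 ^+ (\sum_(i < j) i.+1)).
  elim: j => [|j IH]; first by rewrite poch0 big_ord0 /qfact big_ord0 mulr1 rmorph1.
  rewrite pochS IH qfactS big_ord_recr /= exprD -exprS xE // -rmorphXn -(rmorph1 (@fpsC rat)).
  rewrite -rmorphB -rmorphM; congr fpsC; rewrite -!mulrA; congr (_ * _).
  rewrite mulrCA; congr (_ * _); rewrite mulrBl mul1r -exprMn mulfV ?expr1n //.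
  exact: q_neq0.
rewrite !pE xE // natr_fps -!rmorphXn -!rmorphM; congr fpsC.
have := gbin_fact q_gt1 a k; rewrite -nE => <-.
have -> : (n - k = a)%N by lia.
set e1 := (\sum_(i < k) i.+1)%N; set e2 := (\sum_(i < a) i.+1)%N; set e3 := (\sum_(i < n) i.+1)%N.
have tri j : (2 * \sum_(i < j) i.+1 = j * j.+1)%N.
  elim: j => [|j IH]; first by rewrite big_ord0.
  by rewrite big_ord_recr /= mulnDr IH; lia.
have eE : (n * k + (e1 + e2) = k ^ 2 + e3)%N.
  apply/eqP; rewrite -(eqn_pmul2l (isT : 0 < 2)%N) !mulnDr !tri nE; apply/eqP.
  by rewrite -mulnn; lia.
transitivity ((gbin q n k)%:R * qfact q a * qfact q k * (q%:R : rat)^-1 ^+ (n * k + (e1 + e2))).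
  by rewrite !exprD; move: (_ ^+ (n * k)) (_ ^+ e1) (_ ^+ e2) => y1 y2 y3; ring.
by rewrite eE exprD; move: (_ ^+ (k ^ 2)) (_ ^+ e3) => y1 y2; ring.
Qed.

(** By u_seriesS and gbin_inverse, one chain_step takes u_series j n / (x;
    x)_n to the same quotient for j + 1, and for j = 0 the quotient is the
    weight of n_1 in the Bressoud sum. *)
Lemma lattice_series_bressoud m n : lattice_series q m n = (poch (t * x) x n)^-1 * bressoud m n t x.
Proof.
rewrite lattice_seriesE // bressoud_chain; congr (_ * _).
pose w j b : A := (poch x x b)^-1 * u_series q j b.
have wS j b : w j.+1 b = chain_step t x (w j) b.
  rewrite /w u_seriesS // big_distrr; apply: eq_bigr => a _ /=.
  have ab : (a <= b)%N by rewrite -ltnS.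
  have := gbin_inverse ab; set g := _%:R => gE.
  apply: (mulrI (poch_x_unit b)); rewrite mulrA mulrA mulrV ?poch_x_unit // mul1r.
  have -> : poch x x b * (t ^+ (2 * a) * x ^+ (a ^ 2) / poch x x (b - a) * ((poch x x a)^-1 *
    u_series q j a))
    = (x ^+ (a ^ 2) * poch x x b) * (t ^+ (2 * a) / poch x x (b - a) / poch x x a * u_series q j a).
    by ring.
  rewrite -gE.
  have u1 := poch_x_unit a; have u2 := poch_x_unit (b - a).
  transitivity (g * x ^+ (b * a) * t ^+ (2 * a) * u_series q j a * (poch x x a / poch x x a)
     * (poch x x (b - a) / poch x x (b - a))).
    by rewrite !mulrV // !mulr1.
  by ring.
have w0 b : w 0%N b = (poch x x b)^-1 / poch (- t * x) x b.
  have up : poch (- t * x) x b \is a GRing.unit.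
    by apply: unit_poch => //; rewrite fcoefN oppr0.
  by rewrite /w; congr (_ * _); apply: (mulIr up); rewrite u_series0_inv // mulVr.
have -> : chain_sum t x m n n (fun b => (poch x x b)^-1 / poch (- t * x) x b) = w m n.
  have chain_w m' j : chain_sum t x m' n n (w j) = w (m' + j)%N n.
    elim: m' j => [|m' IH] j; first exact: chain_sum0.
    rewrite chain_sumS // addSnnS -IH; apply: eq_chain_sum; first by [].
    by move=> b _; rewrite -wS.
  by rewrite -[in RHS](addn0 m) -chain_w; apply: eq_chain_sum; last by move=> b _; rewrite w0.
by rewrite /w mulrA mulrV ?poch_x_unit // mul1r.
Qed.

End ZCount.

(** * Submodules of R^n as lattices *)

Section SubmodulesAreLattices.
Variables (k K : finFieldType) (iota : {rmorphism k -> K}) (w : K).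
Variables (beta gam : k).
Hypothesis w_out : forall a, w <> iota a.
Hypothesis w_span : forall z, exists a b, z = iota a + iota b * w.
Hypothesis w_quad : w * w = iota beta * w + iota gam.
Variables (m n : nat).
Local Notation R := (Rprime iota m).
Local Notation scal := (scal iota).
Local Notation q := #|k|.
Local Notation V := 'rV[fps K]_n.
Local Notation U := 'rV[R]_n.
Local Notation full := (box (lat iota m [set: 'I_n] finset.set0)).
Implicit Types (L : set U) (a b : U).

Definition embed a : V := map_mx (@Rprime_val _ _ iota m) a.

Lemma embed_lin (c : R) a b : embed (c *: a + b) = Rprime_val c *: embed a + embed b.
Proof. by apply/matrixP => i j; rewrite !mxE. Qed.

Lemma embedB a b : embed (a - b) = embed a - embed b.
Proof. by apply/matrixP => i j; rewrite !mxE. Qed.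

Lemma embed_inj : injective embed.
Proof.
move=> a b /matrixP E; apply/matrixP => i j; apply: val_inj.
by have := E i j; rewrite !mxE.
Qed.

Lemma embed_full a : full (embed a).
Proof. by move=> l; rewrite /lat finset.in_setT mxE; exact: valP. Qed.

Lemma embed_surj v : full v -> exists a, embed a = v.
Proof.
move=> fv; have vR l : v 0 l \in fps_order iota m.
  by have := fv l; rewrite /lat finset.in_setT.
exists (\row_l (Rprime_of (vR l))); apply/matrixP => i j.
by rewrite (ord1 i) !mxE.
Qed.

Lemma embed_submod L : submod_closed (mem L) -> order_submod iota m (embed @` L).
Proof.
move=> [L0 Lm]; split; first by exists 0; [exact/set_mem|apply/matrixP => i j; rewrite !mxE].
move=> f _ _ fR [a La <-] [b Lb <-]; exists (Rprime_of fR *: a + b); last exact: embed_lin.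
by apply/set_mem/Lm; apply/mem_set.
Qed.

Lemma embed_sub L : embed @` L `<=` full.
Proof. by move=> _ [a _ <-]; exact: embed_full. Qed.

Lemma preimage_submod (L' : set V) : order_submod iota m L' -> submod_closed (mem (embed @^-1` L')).
Proof.
move=> [L0 Lm]; split.
  apply/mem_set; rewrite /preimage /=; suff -> : embed 0 = 0 by [].
  by apply/matrixP => i j; rewrite !mxE.
move=> c a b /set_mem La /set_mem Lb; apply/mem_set; rewrite /preimage /= embed_lin.
by apply: Lm => //; exact: valP.
Qed.

Lemma cosets_card L d : submod_closed (mem L) -> idx scal d (embed @` L) full ->
  has_card (cosets L) (q ^ d)%N.
Proof.
move=> sL idL; have oL := embed_submod sL; have kL := order_submod_ksub oL.
have [s ss [us sM sA sc]] := idx_transv kL idL.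
pose C v : set U := [set a | (embed @` L) (embed a - v)].
have CE a v : (embed @` L) (embed a - v) -> [set a + b | b in L] = C v.
  move=> Lav; apply/predeqP => c; split=> [[b Lb <-]|Lcv].
    rewrite /C /=; have -> : embed (a + b) - v = embed b + (embed a - v).
      by rewrite addrA; congr (_ - _); apply/matrixP => i j; rewrite !mxE addrC.
    by apply: (ksubD kL) => //; exists b.
  have : (embed @` L) (embed (c - a)).
    have -> : embed (c - a) = (embed c - v) - (embed a - v).
      by rewrite embedB opprB addrA subrK.
    exact: ksubB kL Lcv Lav.
  by move=> [b Lb /embed_inj bE]; exists b => //; rewrite bE addrC subrK.
exists [seq C v | v <- s]; split.
- rewrite map_inj_in_uniq; first exact: us.
  move=> u v us' vs E; apply: (sA _ _ us' vs).
  have [a aE] := embed_surj (sM _ us').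
  have : C u a by rewrite /C /= aE subrr; exact: ksub0 kL.
  by rewrite E /C /= aE.
- by rewrite size_map.
move=> X; split=> [/mapP[v vs ->]|[a ->]].
  have [a aE] := embed_surj (sM _ vs); exists a; apply/esym/CE.
  by rewrite aE subrr; exact: ksub0 kL.
have [v vs Lv] := sc _ (embed_full a); apply/mapP; exists v; first exact: vs.
exact: CE.
Qed.

(** A finite quotient is a vector space over k, so its order is a power of
    q. *)
Lemma finite_index L N : submodules_of_index U N L ->
  exists2 d, N = (q ^ d)%N & idx scal d (embed @` L) full.
Proof.
move=> [sL /has_card_eq cN]; have oL := embed_submod sL; have kL := order_submod_ksub oL.
have [s [us ss sP]] := cN.
have [d idL] : exists d, idx scal d (embed @` L) full.
  pose r (C : set U) : V := embed (xget 0 C).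
  apply: (@idx_of_cover _ _ _ _ _ _ [seq r C | C <- s] kL).
  - exact: order_submod_ksub (lat_submod _ _ _ _).
  - exact: embed_sub.
  move=> v /embed_surj[a <-]; right.
  have Ca : cosets L [set a + b | b in L] by exists a.
  exists (r [set a + b | b in L]); first by apply: map_f; exact/sP.
  have L0 : L 0 by case: sL => /set_mem.
  have : [set a + b | b in L] a by exists 0; rewrite ?addr0.
  move=> /(xgetI 0) [b Lb bE]; rewrite /r -bE -embedB.
  have -> : a - (a + b) = - b by rewrite opprD addrA subrr add0r.
  have -> : embed (- b) = - embed b by apply/matrixP => i j; rewrite !mxE.
  by apply: (ksubN kL); exists b.
by exists d => //; exact: has_card_inj cN (cosets_card sL idL).
Qed.

Lemma submodule_count d :
  has_card (submodules_of_index U (q ^ d)%N) (\sum_(b < (2 * n).+1) lattice_count q m n d b)%N.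
Proof.
have oF : order_submod iota m full := lat_submod iota m [set: 'I_n] finset.set0.
have idX : idx scal (2 * n) (@scaleX K n @` full) full.
  have := idx_lat_X w_out w_span m [set: 'I_n]; rewrite cardsT card_ord; exact.
have cL : has_card [set L' | order_submod iota m L' /\ idx scal d L' full]
    (\sum_(b < (2 * n).+1) lattice_count q m n d b)%N.
  have cb (c : nat) : has_card
      [set L' | [/\ order_submod iota m L', idx scal d L' full & defect iota w m c L']]
        (lattice_count q m n d c).
    by have := count_lattices w_out w_span w_quad m [set: 'I_n] d c; rewrite cardsT card_ord.
  apply: has_card_ext (has_card_sum (N := (2 * n).+1) (fun c _ => cb c) _) => [L'|c c' L' _ _] /=.
    split=> [[c _ []]//|[oL idL]].
    have [c lc sc] := defect_exists w idX oL idL.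
    by exists c.
  by move=> [oL _ sb] [_ _ sb']; exact: defect_uniq oL sb sb'.
have imgK (L' : set V) : L' `<=` full -> embed @` (embed @^-1` L') = L'.
  move=> LF; apply/predeqP => v; split=> [[a La <-] //|Lv].
  by have [a aE] := embed_surj (LF _ Lv); exists a => //; rewrite /preimage /= aE.
have preK L : embed @^-1` (embed @` L) = L.
  by apply/predeqP => a; split=> [[b Lb /embed_inj <-] //|La]; exists a.
refine (@has_card_bij _ _ _ _ (fun L : set U => embed @` L) (fun L' : set V => embed @^-1` L') _
  _ _ _ cL).
- move=> L sL; have [d' dE idL] := finite_index sL.
  split; first by apply: embed_submod; case: sL.
  suff -> : d = d' by [].
  by apply/eqP; rewrite -(eqn_exp2l _ _ (card_finNzRing_gt1 k)) dE.
- move=> L' [oL idL]; have LF := idx_sub idL; split; last exact: imgK.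
  have sL := preimage_submod oL; split=> //; apply/has_card_eq.
  by apply: cosets_card => //; rewrite imgK.
by move=> L _; exact: preK.
Qed.

End SubmodulesAreLattices.

(** Any w outside k will do: the |k|^2 elements a + b w are distinct. *)
Lemma quadratic_generator (k K : finFieldType) (iota : {rmorphism k -> K}) :
  #|K| = (#|k| ^ 2)%N -> exists w : K, [/\ forall a, w <> iota a,
    forall z, exists a b, z = iota a + iota b * w &
    exists beta gam, w * w = iota beta * w + iota gam].
Proof.
move=> cK; have k1 := card_finNzRing_gt1 k.
have [w wout] : exists w, w \notin codom iota.
  apply/existsP; rewrite -negb_forall; apply/negP => /forallP all_in.
  have : (#|K| <= #|k|)%N.
    rewrite -(card_codom (fmorph_inj iota)); apply: subset_leq_card.
    by apply/fintype.subsetP => z _; exact: all_in.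
  by rewrite cK leqNgt -{1}[#|k|]expn1 ltn_exp2l.
have w_out a : w <> iota a by move=> wE; case/negP: wout; rewrite wE codom_f.
pose f (p : k * k) := iota p.1 + iota p.2 * w.
have f_inj : injective f.
  move=> [a b] [a' b'] /eqP; rewrite /f /= -subr_eq0 => /eqP E.
  have E' : iota (a - a') = iota (b' - b) * w by apply/eqP; rewrite -subr_eq0 -E !rmorphB;
    apply/eqP; ring.
  have [bb|bb] := eqVneq b' b; last first.
    have nz : iota (b' - b) != 0 by rewrite fmorph_eq0 subr_eq0.
    case: (w_out ((a - a') / (b' - b))); rewrite fmorph_div E' mulrAC mulfV ?mul1r //.
  move: E'; rewrite bb subrr rmorph0 mul0r => /eqP; rewrite fmorph_eq0 subr_eq0.
  by move=> /eqP ->.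
have w_span z : exists a b, z = iota a + iota b * w.
  have : z \in codom f.
    by apply: (inj_card_onto f_inj); rewrite card_prod cK expnS expn1.
  by move=> /codomP[[a b] ->]; exists a, b.
exists w; split=> //; have [gam [beta E]] := w_span (w * w).
by exists beta, gam; rewrite E addrC.
Qed.

Theorem theorem1p2 (q m n : nat) (Fq Fq2 : finFieldType)
    (iota : {rmorphism Fq -> Fq2}) (hq : #|Fq| = q) (hq2 : #|Fq2| = (q ^ 2)%N)
    (hm : (1 <= m)%N) (hn : (1 <= n)%N) :
  (forall N : nat, finite_set (submodules_of_index 'rV[Rprime iota m]_n N)) /\
  (let t : fps rat := fpsX in
   let x : fps rat := (q%:R)^-1 in
   coh_zeta (Rprime iota m) n =
     dirichlet_of_fps q ((poch (t * x) x n)^-1 * bressoud m n t x)).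
Proof.
rewrite -hq in hq2 *; have [w [w_out w_span [beta [gam w_quad]]]] := quadratic_generator iota hq2.
have q1 : (1 < #|Fq|)%N := card_finNzRing_gt1 Fq.
have cnt d := submodule_count w_out w_span w_quad m n d.
have no N L : submodules_of_index 'rV[Rprime iota m]_n N L -> exists d, N = (#|Fq| ^ d)%N.
  by move=> sL; have [d dE _] := finite_index sL; exists d.
split=> [N|t x].
  have [[d ->]|nd] := pselect (exists d, N = (#|Fq| ^ d)%N).
    by have [] := has_card_finite (cnt d).
  suff -> : submodules_of_index 'rV[Rprime iota m]_n N = set0 by exact: finite_set0.
  by apply/seteqP; split=> // L /no.
apply/funext => N; rewrite /coh_zeta /dirichlet_shift /quot_zeta -lattice_series_bressoud //.
rewrite /dirichlet_of_fps.
have [[d ->]|nd] := pselect (exists d, N = (#|Fq| ^ d)%N).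
  have [_ ->] := has_card_finite (cnt d).
  have dN : (d < (#|Fq| ^ d).+1)%N by rewrite ltnS ltnW // ltn_expl.
  rewrite (big_pred1 (Ordinal dN)) => [|j]; last first.
    by rewrite /= eqn_exp2l.
  rewrite /= /lattice_series fcoef_sum -(big_mkord xpredT (fun b => lattice_count #|Fq| m n d b)).
  (* submodule_count sums over the defects up to 2n, those above n contribute
     nothing. *)
  rewrite (big_cat_nat (n := n.+1)) //=; last by rewrite ltnS leq_pmull.
  rewrite [X in (_ + X)%N]big_nat_cond [X in (_ + X)%N]big1 ?addn0; last first.
    by move=> b /andP[/andP[nb _] _]; rewrite lattice_count_small.
  rewrite big_mkord natr_sum big_distrl; apply: eq_bigr => b _ /=.
  by rewrite natrX -exprM mulnC exprVn.
rewrite big_pred0 => [|j]; last first.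
  by apply/negP => /eqP E; apply: nd; exists j.
suff -> : submodules_of_index 'rV[Rprime iota m]_n N = set0 by rewrite fset_set0 mul0r.
by apply/seteqP; split=> // L /no.
Qed.
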